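(* Consider the polynomial Liénard system $$\dot x=y,\qquad \dot y=-g(x)-f(x)y,\qquad g(x)=\sum_{i=r}^{m}a_ix^i,\quad f(x)=\sum_{i=s}^{n}b_ix^i,$$ where $m,n,r,s\in\mathbb{N}$, the coefficients are real and $a_ra_mb_sb_n\neq 0$. Assume that $g$ is an odd function. Consider the conditions: (i) $xg(x)>0$ for all $x\neq 0$; (ii) $r=1$, $s\ge 1$, $a_r>0$; (ii* ) either $r$ is odd, $2<r<2s+1$ and $a_r>0$; or $r=2s+1\ge 3$ and $b_s^2-2(r+1)a_r<0$; (iii) either $m$ is odd, $m>2n+1$ and $a_m>0$; or $m=2n+1$ and $4(n+1)a_mb_n^{-2}>1$. Then the system has a linear type global center at the origin if and only if (i), (ii), (iii) hold and $f$ is an odd function; and the system has a nilpotent type global center at the origin if and only if (i), (ii* ), (iii) hold and $f$ is an odd function.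
   Context: Here $\mathbb{N}$ includes $0$ and the dot denotes the derivative with respect to the independent variable $t$. An equilibrium $p$ of a planar differential system is a center if it has a neighbourhood $U$ such that $U\setminus\{p\}$ is filled with periodic (closed) orbits. The period annulus of a center $p$ is the maximal connected set of periodic orbits surrounding $p$ and having $p$ in its boundary. A center $p$ is a global center if its period annulus is $\mathbb{R}^2\setminus\{p\}$. A (global) center is of linear type if the Jacobian matrix of the system at it has (nonzero) purely imaginary eigenvalues, and of nilpotent type if both eigenvalues of that Jacobian matrix are zero but the matrix is not identically zero. *)

(* Defs.v *)
From HB Require Import structures.
From mathcomp Require Import all_boot all_order all_algebra.
From mathcomp Require Import all_classical all_reals all_analysis.
From mathcomp Require Import complex.

Set Implicit Arguments.
Unset Strict Implicit.
Unset Printing Implicit Defensive.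

Import Order.TTheory GRing.Theory Num.Theory.
Import numFieldNormedType.Exports.

Local Open Scope classical_set_scope.
Local Open Scope ring_scope.

Section PlanarSystems.
Variable R : realType.
Local Notation plane := 'rV[R]_2.
Implicit Types (X : plane -> plane) (p q : plane) (A B O : set plane).

Definition is_solution X (u : R -> plane) : Prop :=
  forall t : R, is_derive t (1 : R) u (X (u t)).

Definition periodic_orbit X O : Prop :=
  exists u : R -> plane,
    [/\ is_solution X u,
        exists2 T : R, 0 < T & forall t : R, u (t + T) = u t,
        exists t : R, u t != u 0
      & O = range u].

(* The orbits filling A lie inside A, so A is exactly a union of periodic
   orbits. *)
Definition filled_with_periodic_orbits X A : Prop :=
  forall q, A q -> exists O, [/\ periodic_orbit X O, O q & O `<=` A].

Definition equilibrium X p : Prop := X p = 0.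

Definition center X p : Prop :=
  equilibrium X p /\
  exists2 U : set plane, nbhs p U & filled_with_periodic_orbits X (U `\ p).

(* p lies in a bounded component of the complement of O, i.e. in the interior
   of O when O is a Jordan curve. The condition ~ O p is needed because
   connected_component (~` O) p is empty when p belongs to O. *)
Definition surrounds O p : Prop :=
  ~ O p /\ bounded_set (connected_component (~` O) p).

Definition boundary A : set plane := closure A `&` closure (~` A).

Definition annular_set X p A : Prop :=
  [/\ forall q, A q ->
        exists O, [/\ periodic_orbit X O, surrounds O p, O q & O `<=` A],
      connected A
    & boundary A p].

Definition period_annulus X p A : Prop :=
  annular_set X p A /\
  forall B, annular_set X p B -> A `<=` B -> B = A.

Definition global_center X p : Prop :=
  center X p /\ period_annulus X p (~` [set p]).

(* 'J X p acts on row vectors, so it is the transpose of the usual Jacobian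
   matrix; the two have the same eigenvalues and vanish simultaneously. *)
Definition jacobian_eigenvalue X p (z : R[i]) : bool :=
  eigenvalue (map_mx (real_complex R) ('J X p)) z.

Definition linear_type X p : Prop :=
  forall z : R[i], jacobian_eigenvalue X p z ->
    complex.Re z = 0 /\ complex.Im z <> 0.

Definition nilpotent_type X p : Prop :=
  (forall z : R[i], jacobian_eigenvalue X p z -> z = 0) /\ 'J X p <> 0.

(* x' = y, y' = - g(x) - f(x) y, with x = p 0 0 and y = p 0 1. *)
Definition lienard (f g : R -> R) : plane -> plane := fun p =>
  \row_(j < 2) if j == 0 then p 0 1 else - g (p 0 0) - f (p 0 0) * p 0 1.

Definition poly_fun (c : nat -> R) (lo hi : nat) : R -> R := fun x =>
  \sum_(lo <= i < hi.+1) c i * x ^+ i.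

Definition odd_function (h : R -> R) : Prop := forall x, h (- x) = - h x.

End PlanarSystems.

(* Main.v *)
(* In the Lienard plane z = y + F x, F an even primitive of f, the system reads
   x' = z - F x, z' = - g x, and for odd f and g it is reversible under
   (t, x) -> (- t, - x).

   Sufficiency: truncating x gives global solutions. In the quasi-polar
   coordinate v = y / x^(n+1), near infinity the quadratic (n+1) v^2 - b v + a
   is positive definite by (iii), so an orbit turns around before escaping and
   comes back to the x-axis; near the origin (ii) or (ii') give in the same way
   that it reaches the y-axis at a nonzero ordinate. Every arc in x >= 0 is
   therefore completed by its mirror image to a closed orbit around 0.

   Necessity: a failure of (iii), or of (ii'), makes this quadratic nonpositive
   at some v0, and a curve y ~ v0 x^(n+1) then confines a solution, which escapes
   to infinity or tends to the origin. If the even part of f is not zero, the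
   right-hand arc of a small periodic orbit and its mirror image bound a region
   that traps the orbit, which can never close up. *)

Require Import Defs.
From mathcomp Require Import all_boot all_order all_algebra.
From mathcomp Require Import all_classical all_reals all_analysis.
From mathcomp Require Import complex ring lra zify.
Set Implicit Arguments.
Unset Strict Implicit.
Unset Printing Implicit Defensive.

Import Order.TTheory GRing.Theory Num.Theory.
Import numFieldNormedType.Exports.

Local Open Scope classical_set_scope.
Local Open Scope ring_scope.


(** * Calculus on the line *)

(** A center asks for solutions on the whole time axis, but the polynomial field is not globally
    Lipschitz. In sufficiency the amplitude of an orbit is first bounded from the original data; the
    arguments of [f] and [g] are then truncated beyond that bound, and the closed orbit of the
    modified system never leaves the region where nothing was changed. In necessity the global
    periodic solutions come with the center itself.

    Reversing time replaces [F] by [- F] and keeps [g], so each argument about damping is made for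
    one sign only.

    The delicate case is a vanishing discriminant at infinity or at the origin: the quadratic has a
    double root v0, and along y = v0 x^(n+1) the leading terms cancel. The curve is therefore bent
    by a term of relative order 1/x (resp. x), which wins because the neglected terms of odd [f] and
    [g] have relative order 1/x^2 (resp. x^2). This is why the oddness of [f] is established before
    these two conditions. *)

Section Calculus.
Variable R : realType.
Implicit Types (f g h x y z : R -> R) (a b c d t s e C : R).

Lemma is_deriveD1 f g t c d : is_derive t (1 : R) f c -> is_derive t (1 : R) g d ->
  is_derive t (1 : R) (fun s => f s + g s) (c + d).
Proof. move=> ? ?; exact: is_deriveD. Qed.

Lemma is_deriveB1 f g t c d : is_derive t (1 : R) f c -> is_derive t (1 : R) g d ->
  is_derive t (1 : R) (fun s => f s - g s) (c - d).
Proof. move=> ? ?; exact: is_deriveB. Qed.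

Lemma is_deriveN1 f t c : is_derive t (1 : R) f c ->
  is_derive t (1 : R) (fun s => - f s) (- c).
Proof. move=> ?; exact: is_deriveN. Qed.

Lemma is_deriveM1 f g t c d : is_derive t (1 : R) f c -> is_derive t (1 : R) g d ->
  is_derive t (1 : R) (fun s => f s * g s) (c * g t + f t * d).
Proof.
move=> fc gd; apply: (is_derive_eq (@is_deriveM _ _ f g t 1 c d fc gd)).
by rewrite /GRing.scale /=; ring.
Qed.

Lemma is_deriveC1 a t : is_derive t (1 : R) (fun _ => a) (0 : R).
Proof. exact: is_derive_cst. Qed.

Lemma is_deriveX1 f n t c : is_derive t (1 : R) f c ->
  is_derive t (1 : R) (fun s => f s ^+ n) (n%:R * f t ^+ n.-1 * c).
Proof.
move=> df; have -> : (fun s => f s ^+ n) = f ^+ n.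
  by apply/funext => s; rewrite exprfctE.
exact: (is_derive_eq (@is_deriveX _ _ f n t 1 c df)).
Qed.

Lemma is_derive_comp1 f g t c d : is_derive (g t) (1 : R) f c ->
  is_derive t (1 : R) g d -> is_derive t (1 : R) (fun s => f (g s)) (c * d).
Proof. by move=> ? ?; exact: is_derive1_comp. Qed.

Lemma is_derive_id1 t : is_derive t (1 : R) (fun s : R => s) 1.
Proof. exact: is_derive_id. Qed.

Lemma is_derive_cts f t d : is_derive t (1 : R) f d -> {for t, continuous f}.
Proof.
by case=> df _; apply/differentiable_continuous/derivable1_diffP.
Qed.

Lemma continuous_gt f t c : {for t, continuous f} -> c < f t ->
  exists2 e : R, 0 < e & forall s, `|s - t| < e -> c < f s.
Proof.
move=> cf cft; have := cf _ (@open_nbhs_nbhs _ _ _ (conj (@open_gt R c) cft)).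
move=> /nbhs_ballP[e /= e0 He]; exists e => // s hs.
by apply: He; rewrite /ball /= distrC.
Qed.

Lemma continuous_lt f t c : {for t, continuous f} -> f t < c ->
  exists2 e : R, 0 < e & forall s, `|s - t| < e -> f s < c.
Proof.
move=> cf cft; have := cf _ (@open_nbhs_nbhs _ _ _ (conj (@open_lt R c) cft)).
move=> /nbhs_ballP[e /= e0 He]; exists e => // s hs.
by apply: He; rewrite /ball /= distrC.
Qed.

Lemma continuous_within_seg f a b : (forall t, a <= t <= b -> {for t, continuous f}) ->
  {within `[a, b]%classic, continuous f}.
Proof.
by move=> cf; apply: continuous_in_subspaceT => t; rewrite inE /= in_itv /= => /cf.
Qed.

Lemma mean_value f a b : a < b -> (forall t, a <= t <= b -> {for t, continuous f}) ->
  (forall t, a < t < b -> derivable f t 1) ->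
  exists2 t : R, a < t < b & f b - f a = 'D_1 f t * (b - a).
Proof.
move=> ab cf df.
have [||t] := @MVT R f (fun t => 'D_1 f t) a b ab.
- by move=> t; rewrite in_itv /= => /df/derivableP.
- exact: continuous_within_seg.
by rewrite in_itv => ? ?; exists t.
Qed.

Lemma derive_ge0_le f a b : a <= b -> (forall t, a <= t <= b -> {for t, continuous f}) ->
  (forall t, a < t < b -> exists2 d : R, 0 <= d & is_derive t (1 : R) f d) -> f a <= f b.
Proof.
rewrite le_eqVlt => /predU1P[->//|ab] cf df; rewrite -subr_ge0.
have [t tab ->] : exists2 t : R, a < t < b & f b - f a = 'D_1 f t * (b - a).
  by apply: mean_value => // t /df[d _ []].
have [d d0 [_ ->]] := df _ tab.
by rewrite mulr_ge0// subr_ge0 ltW.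
Qed.

Lemma derive_gt0_lt f a b : a < b -> (forall t, a <= t <= b -> {for t, continuous f}) ->
  (forall t, a < t < b -> exists2 d : R, 0 < d & is_derive t (1 : R) f d) -> f a < f b.
Proof.
move=> ab cf df; rewrite -subr_gt0.
have [t tab ->] : exists2 t : R, a < t < b & f b - f a = 'D_1 f t * (b - a).
  by apply: mean_value => // t /df[d _ []].
have [d d0 [_ ->]] := df _ tab.
by rewrite mulr_gt0// subr_gt0.
Qed.

Lemma derive_le0_ge f a b : a <= b -> (forall t, a <= t <= b -> {for t, continuous f}) ->
  (forall t, a < t < b -> exists2 d : R, d <= 0 & is_derive t (1 : R) f d) -> f b <= f a.
Proof.
move=> ab cf df; rewrite -lerN2.
apply: (@derive_ge0_le (fun t => - f t)) => // t tab.
  by apply: continuousN; exact: cf.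
by have [d d0 fd] := df _ tab; exists (- d); [rewrite oppr_ge0|exact: is_deriveN1].
Qed.

Lemma derive_lt0_gt f a b : a < b -> (forall t, a <= t <= b -> {for t, continuous f}) ->
  (forall t, a < t < b -> exists2 d : R, d < 0 & is_derive t (1 : R) f d) -> f b < f a.
Proof.
move=> ab cf df; rewrite -ltrN2.
apply: (@derive_gt0_lt (fun t => - f t)) => // t tab.
  by apply: continuousN; exact: cf.
by have [d d0 fd] := df _ tab; exists (- d); [rewrite oppr_gt0|exact: is_deriveN1].
Qed.

Lemma derive_gt0_near f t d : is_derive t (1 : R) f d -> 0 < d ->
  exists2 e : R, 0 < e & forall s, 0 < s < e -> f (t - s) < f t < f (t + s).
Proof.
move=> [df <-] d0.
have : h^-1 *: (f (h + t) - f t) @[h --> 0^'] --> 'D_1 f t.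
  have := df; rewrite /derivable => /cvg_ex[l /= hl].
  have -> : 'D_1 f t = l.
    apply/cvg_lim; first exact: Rhausdorff.
    by apply: cvg_trans hl; apply: near_eq_cvg; near=> h.
  apply: cvg_trans hl; apply: near_eq_cvg; near=> h.
  by rewrite /= [h *: 1]mulr1.
move=> /(_ _ (@open_nbhs_nbhs _ _ _ (conj (@open_gt R 0) d0))).
move=> /nbhs_ballP[e /= e0 He]; exists e => // s /andP[s0 se].
apply/andP; split.
- have : 0 < (- s)^-1 *: (f (- s + t) - f t).
    apply: (He (- s)); last by rewrite oppr_eq0 gt_eqF.
    by rewrite /ball /= sub0r opprK gtr0_norm.
  rewrite /GRing.scale /= invrN mulNr oppr_gt0 pmulr_rlt0 ?invr_gt0//.
  by rewrite subr_lt0 addrC.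
- have : 0 < s^-1 *: (f (s + t) - f t).
    apply: (He s); last by rewrite gt_eqF.
    by rewrite /ball /= sub0r normrN gtr0_norm.
  by rewrite /GRing.scale /= pmulr_rgt0 ?invr_gt0// subr_gt0 addrC.
Unshelve. all: by end_near.
Qed.

Lemma derive_lt0_near f t d : is_derive t (1 : R) f d -> d < 0 ->
  exists2 e : R, 0 < e & forall s, 0 < s < e -> f (t + s) < f t < f (t - s).
Proof.
move=> fd d0.
have [|e e0 He] := @derive_gt0_near (fun s => - f s) t (- d) (is_deriveN1 fd).
  by rewrite oppr_gt0.
by exists e => // s /He /=; rewrite !ltrN2 andbC.
Qed.

(** The supremum of the times up to which [P] holds is itself such a time by the third hypothesis,
    and could be passed by the second one. *)
Lemma real_induction (P : R -> Prop) a :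
  P a ->
  (forall t, a <= t -> (forall s, a <= s <= t -> P s) ->
    exists2 e : R, 0 < e & forall s, t < s < t + e -> P s) ->
  (forall t, a < t -> (forall s, a <= s < t -> P s) -> P t) ->
  forall t, a <= t -> P t.
Proof.
move=> Pa Pr Pl b ab; apply: contrapT => nPb.
pose S := [set t | a <= t <= b /\ (forall s, a <= s <= t -> P s)]%classic.
have Sa : S a.
  by split=> [|s]; [rewrite lexx ab|rewrite -eq_le => /eqP <-].
have supS : has_sup S.
  by split; [exists a|exists b => t [/andP[]]].
set c := sup S.
have ac : a <= c by apply: ub_le_sup => //; case: supS.
have cb : c <= b by apply: ge_sup; [exists a|move=> t [/andP[]]].
have Plt s : a <= s < c -> P s.
  move=> /andP[as_ sc]; have [|t [/andP[_ _] Ht]] := @sup_gt _ S s _ sc.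
    by exists a.
  by move=> st; apply: Ht; rewrite as_ ltW.
have Pc : P c.
  by move: ac; rewrite le_eqVlt => /predU1P[<-//|ac]; apply: Pl.
have Ple s : a <= s <= c -> P s.
  move=> /andP[as_]; rewrite le_eqVlt => /predU1P[->//|sc].
  by apply: Plt; rewrite as_.
have [e e0 He] := Pr _ ac Ple.
have cltb : c < b.
  by rewrite lt_neqAle cb andbT; apply/negP => /eqP cE; apply: nPb; rewrite -cE.
set d := Num.min (c + e / 2) b.
have cd : c < d.
  by rewrite lt_min cltb andbT ltrDl divr_gt0.
have Sd : S d.
  split; first by rewrite (le_trans ac (ltW cd)) ge_min lexx orbT.
  move=> s /andP[as_ sd]; have [sc|cs] := leP s c; first by apply: Ple; rewrite as_.
  apply: He; rewrite cs (le_lt_trans sd)// gt_min ltrD2l.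
  by rewrite ltr_pdivrMr// ltr_pMr// ltr1n.
have : d <= c by apply: ub_le_sup => //; case: supS.
by rewrite leNgt cd.
Qed.

Lemma first_zero f a b : a <= b -> (forall t, a <= t <= b -> {for t, continuous f}) ->
  0 < f a -> f b <= 0 ->
  exists2 T : R, a < T <= b & f T = 0 /\ forall t, a <= t < T -> 0 < f t.
Proof.
move=> ab cf fa fb.
pose S := [set t | a <= t <= b /\ (forall s, a <= s <= t -> 0 < f s)]%classic.
have Sa : S a.
  by split=> [|s]; [rewrite lexx ab|rewrite -eq_le => /eqP <-].
have supS : has_sup S.
  by split; [exists a|exists b => t [/andP[]]].
set c := sup S.
have ac : a <= c by apply: ub_le_sup => //; case: supS.
have cb : c <= b by apply: ge_sup; [exists a|move=> t [/andP[]]].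
have Plt s : a <= s < c -> 0 < f s.
  move=> /andP[as_ sc]; have [|t [/andP[_ _] Ht]] := @sup_gt _ S s _ sc.
    by exists a.
  by move=> st; apply: Ht; rewrite as_ ltW.
have cfc : {for c, continuous f} by apply: cf; rewrite ac.
have fc0 : f c <= 0.
  rewrite leNgt; apply/negP => fc0.
  have cltb : c < b.
    by rewrite lt_neqAle cb andbT; apply: contraTneq fc0 => ->; rewrite -leNgt.
  have [e e0 He] := continuous_gt cfc fc0.
  set d := Num.min (c + e / 2) b.
  have cd : c < d by rewrite lt_min cltb andbT ltrDl divr_gt0.
  have Sd : S d.
    split; first by rewrite (le_trans ac (ltW cd)) ge_min lexx orbT.
    move=> s /andP[as_ sd]; have [sc|cs] := ltP s c; first by apply: Plt; rewrite as_.
    apply: He; rewrite ger0_norm ?subr_ge0// ltrBlDl.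
    rewrite (le_lt_trans sd)// gt_min ltrD2l.
    by rewrite ltr_pdivrMr// ltr_pMr// ltr1n.
  have : d <= c by apply: ub_le_sup => //; case: supS.
  by rewrite leNgt cd.
have altc : a < c.
  by rewrite lt_neqAle ac andbT; apply: contraTneq fa => ->; rewrite -leNgt.
exists c; first by rewrite altc.
split=> //; apply/eqP; rewrite eq_le fc0 /= leNgt; apply/negP => fcn.
have [e e0 He] := continuous_lt cfc fcn.
set s := Num.max a (c - e / 2).
have sc : s < c by rewrite gt_max altc /= ltrBlDr ltrDl divr_gt0.
have as_ : a <= s by rewrite le_max lexx.
have : 0 < f s by apply: Plt; rewrite as_.
apply/negP; rewrite -leNgt ltW// He//.
rewrite ltr0_norm ?subr_lt0// opprB ltrBlDl.
rewrite -ltrBlDr (lt_le_trans _ (_ : c - e / 2 <= s))//.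
  by rewrite ltrD2l ltrN2 ltr_pdivrMr// ltr_pMr// ltr1n.
by rewrite le_max lexx orbT.
Qed.

(** At a zero the derivative is negative, so [f] would have been positive just before. The
    derivative is only asked for where [f] has been nonpositive since [a]: for a trapped solution
    this history yields the position bounds on which the sign of the derivative depends. *)
Lemma barrier f a b : f a <= 0 ->
  (forall t, a <= t <= b -> {for t, continuous f}) ->
  (forall t, a <= t <= b -> (forall s, a <= s <= t -> f s <= 0) -> f t = 0 ->
    exists2 d : R, d < 0 & is_derive t (1 : R) f d) ->
  forall t, a < t <= b -> f t < 0.
Proof.
move=> fa cf df.
suff le0 t : a <= t <= b -> f t <= 0.
  move=> t /andP[at_ tb]; rewrite lt_neqAle le0 ?(ltW at_)// andbT.
  apply/negP => /eqP ft0.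
  have [|s /andP[as_ st]|d d0 /derive_lt0_near/(_ d0)[e e0 He]] := df t _ _ ft0.
  - by rewrite (ltW at_).
  - by apply: le0; rewrite as_ (le_trans st).
  set s := Num.min (e / 2) (t - a).
  have s0 : 0 < s by rewrite lt_min divr_gt0//= subr_gt0.
  have /He : 0 < s < e.
    by rewrite s0 gt_min ltr_pdivrMr// ltr_pMr// ltr1n.
  rewrite ft0 => /andP[_]; apply/negP; rewrite -leNgt; apply: le0.
  rewrite lerBrDl -lerBrDr ge_min lexx orbT /=.
  by rewrite lerBlDr (le_trans tb)// lerDl ltW.
move=> /andP[+]; move: t.
apply: (@real_induction (fun t => t <= b -> f t <= 0)) => //.
- move=> t at_ IH.
  have [tb|bt] := ltP t b; last first.
    by exists 1 => // s /andP[ts _] sb; move: (lt_le_trans ts sb); rewrite ltNge bt.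
  have IH' s : a <= s <= t -> f s <= 0.
    by move=> /[dup]/andP[_ st] /IH; apply; rewrite (le_trans st)// ltW.
  have cft : {for t, continuous f} by apply: cf; rewrite at_ ltW.
  have := IH' t; rewrite at_ lexx => /(_ isT); rewrite le_eqVlt => /predU1P[ft0|ft0].
    have [|d d0 /derive_lt0_near/(_ d0)[e e0 He]] := df t _ IH' ft0.
      by rewrite at_ ltW.
    exists e => // s /andP[ts ste] _.
    have /He : 0 < s - t < e by rewrite subr_gt0 ts ltrBlDl.
    by rewrite subrKC ft0 => /andP[/ltW].
  have [e e0 He] := continuous_lt cft ft0.
  exists e => // s /andP[ts ste] _; apply/ltW/He.
  by rewrite gtr0_norm ?subr_gt0// ltrBlDl.
- move=> t at_ IH tb; rewrite leNgt; apply/negP => ft0.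
  have [|e e0 He] := continuous_gt (_ : {for t, continuous f}) ft0.
    by apply: cf; rewrite ltW.
  set s := Num.max a (t - e / 2).
  have st : s < t by rewrite gt_max at_ /= ltrBlDr ltrDl divr_gt0.
  have as_ : a <= s by rewrite le_max lexx.
  have : f s <= 0.
    by apply: IH; rewrite ?as_//; apply: le_trans tb; exact: ltW.
  apply/negP; rewrite -ltNge He//.
  rewrite ltr0_norm ?subr_lt0// opprB ltrBlDl.
  rewrite -ltrBlDr (lt_le_trans _ (_ : t - e / 2 <= s))//.
    by rewrite ltrD2l ltrN2 ltr_pdivrMr// ltr_pMr// ltr1n.
  by rewrite le_max lexx orbT.
Qed.

Lemma gronwall f C a b : a <= b ->
  (forall t, a <= t <= b -> {for t, continuous f}) ->
  (forall t, a < t < b -> exists2 d : R, d <= C * f t & is_derive t (1 : R) f d) ->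
  f b <= f a * expR (C * (b - a)).
Proof.
move=> ab cf df.
have E t : is_derive t (1 : R) (fun s => expR (- C * (s - a))) (- C * expR (- C * (t - a))).
  by apply: is_derive_eq; rewrite /GRing.scale /=; ring.
have : f b * expR (- C * (b - a)) <= f a * expR (- C * (a - a)).
  apply: (@derive_le0_ge (fun t => f t * expR (- C * (t - a)))) => // t tab.
    by apply: continuousM; [exact: cf|exact: is_derive_cts (E t)].
  have [d dC fd] := df _ tab.
  exists ((d - C * f t) * expR (- C * (t - a))).
    by rewrite mulr_le0_ge0 ?subr_le0// expR_ge0.
  by apply: (is_derive_eq (is_deriveM1 fd (E t))); ring.
rewrite subrr mulr0 expR0 mulr1 mulNr expRN.
by rewrite ler_pdivrMr ?expR_gt0.
Qed.

Lemma continuous_bounded f a b : (forall t, a <= t <= b -> {for t, continuous f}) ->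
  exists2 M : R, 0 < M & forall t, a <= t <= b -> `|f t| <= M.
Proof.
move=> cf; have [ab|ba] := leP a b; last first.
  by exists 1 => // t /andP[at_ tb]; move: (le_trans at_ tb); rewrite leNgt ba.
have [||c _ Hc] := @EVT_max R (fun t => `|f t|) a b.
- exact: ab.
- by apply: continuous_within_seg => t /cf ct; apply: continuous_comp => //; exact: norm_continuous.
exists (`|f c| + 1); first by rewrite ltr_wpDl.
by move=> t tab; rewrite (le_trans (Hc t _)) ?lerDl// in_itv.
Qed.

Lemma continuous_pos_bounded f a b : (forall t, a <= t <= b -> {for t, continuous f}) ->
  (forall t, a <= t <= b -> 0 < f t) ->
  exists2 c : R, 0 < c & forall t, a <= t <= b -> c <= f t.
Proof.
move=> cf f0; have [ab|ba] := leP a b; last first.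
  by exists 1 => // t /andP[at_ tb]; move: (le_trans at_ tb); rewrite leNgt ba.
have [||c /[!in_itv]/= cab Hc] := @EVT_min R f a b.
- exact: ab.
- exact: continuous_within_seg.
by exists (f c) => [|t tab]; [exact: f0|apply: Hc; rewrite in_itv].
Qed.

End Calculus.

(** * Existence and uniqueness of Lienard solutions *)

Section Picard.
Variable R : realType.
Implicit Types (F g h x z : R -> R) (a b c d t s e C L : R).

Lemma is_derive_near_eq (f h : R -> R) t d e : 0 < e ->
  (forall s, `|s - t| < e -> f s = h s) ->
  is_derive t (1 : R) f d -> is_derive t (1 : R) h d.
Proof.
move=> e0 fh; apply: near_eq_is_derive.
near=> s; apply: fh; near: s.
by apply/nbhs_ballP; exists e => //= s; rewrite /ball /= distrC.
Unshelve. all: by end_near. Qed.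

Lemma is_derive_oppr_arg (f : R -> R) t d : is_derive (- t) (1 : R) f d ->
  is_derive t (1 : R) (fun s => f (- s)) (- d).
Proof.
move=> fd; apply: (is_derive_eq (is_derive_comp1 fd (is_deriveN1 (is_derive_id1 t)))).
by rewrite mulrN1.
Qed.

Lemma is_derive_shift1 (f : R -> R) a t d : is_derive (a + t) (1 : R) f d ->
  is_derive t (1 : R) (fun s => f (a + s)) d.
Proof.
move=> fd; apply: (is_derive_eq (is_derive_comp1 fd
  (is_deriveD1 (is_deriveC1 a t) (is_derive_id1 t)))).
by rewrite add0r mulr1.
Qed.

Lemma derive0_cst (f : R -> R) a b : a <= b ->
  (forall t, a <= t <= b -> is_derive t (1 : R) f 0) -> f a = f b.
Proof.
move=> ab df; apply/eqP; rewrite eq_le.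
apply/andP; split.
- apply: derive_ge0_le => // [t /df/is_derive_cts//|t /andP[t1 t2]].
  by exists 0 => //; apply: df; rewrite !ltW.
- apply: derive_le0_ge => // [t /df/is_derive_cts//|t /andP[t1 t2]].
  by exists 0 => //; apply: df; rewrite !ltW.
Qed.

Lemma primitive_right h a : continuous h ->
  exists H : R -> R, forall t, a < t -> is_derive t (1 : R) H (h t).
Proof.
move=> ch.
exists (fun y : R => \int[lebesgue_measure]_(t in [set` `[a, y]]) (h t)) => t at_.
have [||df fE] := @continuous_FTC1_closed R h a t (t + 1) _ _ at_ (ch t).
- by rewrite ltrDl.
- apply: continuous_compact_integrable; first exact: segment_compact.
  exact: continuous_subspaceT.
exact: (DeriveDef df (etrans (esym (derive1E _ _)) fE)).
Qed.

(** Integration from a base point gives a primitive to its right only, so a primitive of [h (- t)]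
    is reflected and glued on. The base point -1 makes the two pieces overlap around 0, where the
    glued function must be differentiable. *)
Lemma primitive h : continuous h ->
  exists H : R -> R, H 0 = 0 /\ forall t, is_derive t (1 : R) H (h t).
Proof.
move=> ch; have [H dH] := primitive_right (-1) ch.
have chN : continuous (fun t => h (- t)).
  by move=> t; apply: continuous_comp; [exact: opp_continuous|exact: ch].
have [G dG] := primitive_right (-1) chN.
pose P t := if t < 0 then - G (- t) + G 0 else H t - H 0.
have dG' t : t < 1 -> is_derive t (1 : R) (fun t => - G (- t) + G 0) (h t).
  move=> t1; have Gt : is_derive (- t) (1 : R) G (h t).
    by rewrite -[in h t](opprK t); apply: dG; rewrite ltrN2.
  apply: (is_derive_eq (is_deriveD1 (is_deriveN1 (is_derive_oppr_arg Gt)) (is_deriveC1 _ t))).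
  by rewrite opprK addr0.
have dH' t : -1 < t -> is_derive t (1 : R) (fun t => H t - H 0) (h t).
  move=> t1; apply: (is_derive_eq (is_deriveB1 (dH _ t1) (is_deriveC1 _ t))).
  by rewrite subr0.
have GH t : - 1 < t < 1 -> - G (- t) + G 0 = H t - H 0.
  move=> /andP[t1 t2]; apply/eqP; rewrite -subr_eq0; apply/eqP.
  have D s : -1 < s < 1 ->
      is_derive s (1 : R) (fun t => - G (- t) + G 0 - (H t - H 0)) 0.
    move=> /andP[s1 s2].
    by apply: (is_derive_eq (is_deriveB1 (dG' _ s2) (dH' _ s1))); rewrite subrr.
  pose N (t : R) := - G (- t) + G 0 - (H t - H 0).
  have N0 : N 0 = 0 by rewrite /N oppr0 addNr subrr subr0.
  have [t0|t0] := leP 0 t.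
    rewrite -[RHS]N0; apply/esym/(@derive0_cst N _ _ t0) => s /andP[s0 st].
    by apply: D; rewrite (lt_le_trans _ s0)//= (le_lt_trans st).
  rewrite -[RHS]N0; apply: (@derive0_cst N _ _ (ltW t0)) => s /andP[s0 st].
  by apply: D; rewrite (lt_le_trans t1)//= (le_lt_trans st).
exists P; split; first by rewrite /P ltxx subrr.
move=> t; have [t0|t0|t0] := ltgtP t 0.
- apply: (@is_derive_near_eq (fun t => - G (- t) + G 0) _ _ _ (- t)).
  + by rewrite oppr_gt0.
  + by move=> s st; rewrite /P ifT//; move: st; rewrite ltr_norml; lra.
  + by apply: dG'; lra.
- apply: (@is_derive_near_eq (fun t => H t - H 0) _ _ _ t) => //.
  + by move=> s st; rewrite /P ifF//; apply/negbTE; move: st; rewrite ltr_norml; lra.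
  + by apply: dH'; lra.
- apply: (@is_derive_near_eq (fun t => H t - H 0) _ _ _ 1) => //.
  + move=> s; rewrite t0 subr0 ltr_norml /P => s1.
    by case: ifP => // _; rewrite GH.
  + by apply: dH'; rewrite t0; lra.
Qed.

Definition prim h : R -> R :=
  xget (fun _ => 0) [set H | H 0 = 0 /\ forall t, is_derive t (1 : R) H (h t)].

Lemma primP h : continuous h ->
  prim h 0 = 0 /\ forall t, is_derive t (1 : R) (prim h) (h t).
Proof.
move=> /primitive[H HP]; rewrite /prim.
by case: xgetP => [G _ []//|/(_ H)].
Qed.

(** In the norm weighted by exp(- k |t|), integration gains a factor 1/k. The Picard step is thus a
    contraction on the whole line at once, without gluing local solutions. *)
Lemma exp_growth_bound (u p : R -> R) A k :
  (forall t, is_derive t (1 : R) u (p t)) ->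
  (forall t, `|p t| <= A * k * expR (k * `|t|)) ->
  forall t, `|u t - u 0| <= A * (expR (k * `|t|) - 1).
Proof.
suff H (v q : R -> R) : (forall t, is_derive t (1 : R) v (q t)) ->
    (forall t, `|q t| <= A * k * expR (k * `|t|)) ->
    forall t, 0 <= t -> `|v t - v 0| <= A * (expR (k * t) - 1).
  move=> du pb t; have [t0|t0] := leP 0 t.
    by rewrite [X in k * X]ger0_norm//; apply: (H u p).
  rewrite [X in k * X]ltr0_norm//.
  have := H (fun s => u (- s)) (fun s => - p (- s)) _ _ (- t).
  rewrite oppr0 opprK; apply; last by rewrite oppr_ge0 ltW.
    by move=> s; apply: is_derive_oppr_arg; exact: du.
  by move=> s; rewrite normrN (le_trans (pb _))// normrN.
move=> dv qb t t0.
have D s : is_derive s (1 : R) (fun s => A * (expR (k * s) - 1)) (A * k * expR (k * s)).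
  by apply: is_derive_eq; rewrite /GRing.scale /=; ring.
have qb' s : 0 < s -> `|q s| <= A * k * expR (k * s).
  by move=> s0; rewrite -[in k * s](gtr0_norm s0).
rewrite ler_norml; apply/andP; split.
- suff : A * (expR (k * 0) - 1) + v 0 <= A * (expR (k * t) - 1) + v t.
    by rewrite mulr0 expR0 subrr mulr0; lra.
  apply: (@derive_ge0_le _ (fun s => A * (expR (k * s) - 1) + v s)) => // s.
    by move=> _; exact: is_derive_cts (is_deriveD1 (D s) (dv s)).
  move=> /andP[/qb' + _]; rewrite ler_norml => /andP[q1 q2].
  by exists (A * k * expR (k * s) + q s); [lra|exact: is_deriveD1].
- suff : A * (expR (k * 0) - 1) - v 0 <= A * (expR (k * t) - 1) - v t.
    by rewrite mulr0 expR0 subrr mulr0; lra.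
  apply: (@derive_ge0_le _ (fun s => A * (expR (k * s) - 1) - v s)) => // s.
    by move=> _; exact: is_derive_cts (is_deriveB1 (D s) (dv s)).
  move=> /andP[/qb' + _]; rewrite ler_norml => /andP[q1 q2].
  by exists (A * k * expR (k * s) - q s); [lra|exact: is_deriveB1].
Qed.

(** The intervals [[lo n, hi n]] are nested, and the supremum of the lower ends lies in all of them.
    The explicit rate is what makes the limit of the Picard iterates continuous. *)
Lemma geometric_limit (u : nat -> R) M :
  (forall n, `|u n.+1 - u n| <= M / 2 ^+ n) ->
  exists l, forall n, `|u n - l| <= 2 * M / 2 ^+ n.
Proof.
move=> uM.
pose lo n := u n - 2 * M / 2 ^+ n; pose hi n := u n + 2 * M / 2 ^+ n.
have h2 n : 2 * M / 2 ^+ n.+1 = M / 2 ^+ n :> R.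
  by rewrite exprS invfM mulrACA divff ?mul1r// pnatr_eq0.
have M0 : 0 <= M.
  by have := uM 0%N; rewrite expr0 divr1; apply: le_trans.
have loS n : lo n <= lo n.+1.
  by have := uM n; rewrite /lo h2 ler_norml => /andP[]; lra.
have hiS n : hi n.+1 <= hi n.
  by have := uM n; rewrite /hi h2 ler_norml => /andP[]; lra.
have lohi n : lo n <= hi n.
  have : 0 <= 2 * M / 2 ^+ n by rewrite divr_ge0 ?mulr_ge0// exprn_ge0.
  by rewrite /lo /hi; lra.
have loM m n : (m <= n)%N -> lo m <= lo n.
  by move=> mn; apply: (homo_leq le_refl le_trans loS).
have hiM m n : (m <= n)%N -> hi n <= hi m.
  move=> mn; rewrite -lerN2.
  by apply: (@homo_leq _ (fun n => - hi n) <=%R le_refl le_trans) => // k; rewrite lerN2.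
have lh m n : lo m <= hi n.
  apply: (@le_trans _ _ (lo (maxn m n))); first by apply: loM; rewrite leq_maxl.
  by apply: (le_trans (lohi _)); apply: hiM; rewrite leq_maxr.
exists (sup (range lo)) => n; rewrite ler_norml.
have A1 : lo n <= sup (range lo).
  apply: ub_le_sup; last by exists n.
  by exists (hi 0%N) => _ [m _ <-].
have A2 : sup (range lo) <= hi n.
  by apply: ge_sup; [exists (lo 0%N); exists 0%N|move=> _ [m _ <-]].
by move: A1 A2; rewrite /lo /hi; lra.
Qed.

Lemma geometric_small a M : 0 < a -> exists n, M / 2 ^+ n < a :> R.
Proof.
move=> a0; exists (Num.bound (M / a)).
rewrite ltr_pdivrMr ?exprn_gt0// mulrC -ltr_pdivrMr//.
apply: (le_lt_trans (ler_norm _)); apply: lt_le_trans (archi_boundP (normr_ge0 _)) _.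
rewrite [Num.bound `|_|](_ : _ = Num.bound (M / a)).
  by rewrite -natrX ler_nat ltnW// ltn_expl.
by rewrite /Num.bound normr_id.
Qed.

(** In the Lienard plane the field is globally Lipschitz as soon as [F] and [g] are; the product
    f(x) y of the original plane would not be, even for bounded Lipschitz f. *)
Definition lsol F g x z := forall t,
  is_derive t (1 : R) x (z t - F (x t)) /\ is_derive t (1 : R) z (- g (x t)).

Definition lipschitz_fun L F := forall u v, `|F u - F v| <= L * `|u - v|.

Lemma lipschitz_fun_continuous L F : 0 <= L -> lipschitz_fun L F -> continuous F.
Proof.
move=> L0 FL t; apply/cvgrPdist_lt => e e0; near=> s.
apply: (le_lt_trans (FL _ _)); apply: (@le_lt_trans _ _ ((L + 1) * `|t - s|)).
  by rewrite ler_wpM2r// lerDl.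
rewrite -ltr_pdivlMl ?ltr_wpDl// mulrC; near: s.
by apply: cvgr_dist_lt; rewrite ?divr_gt0 ?ltr_wpDl//; exact: cvg_id.
Unshelve. all: by end_near. Qed.

Theorem lsol_exists L F g (x0 z0 : R) : 0 <= L -> lipschitz_fun L F -> lipschitz_fun L g ->
  exists x z : R -> R, [/\ lsol F g x z, x 0 = x0 & z 0 = z0].
Proof.
move=> L0 FL gL.
have cF := lipschitz_fun_continuous L0 FL; have cg := lipschitz_fun_continuous L0 gL.
pose step (p : (R -> R) * (R -> R)) :=
  (fun t => x0 + prim (fun s => p.2 s - F (p.1 s)) t,
   fun t => z0 + prim (fun s => - g (p.1 s)) t).
pose u n := iter n step (fun _ => x0, fun _ => z0).
pose x n := (u n).1; pose z n := (u n).2.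
have rhs_cts (p q : R -> R) : continuous p -> continuous q ->
    continuous (fun s => q s - F (p s)) /\ continuous (fun s => - g (p s)).
  move=> cp cq; split=> s.
    by apply: continuousB; [exact: cq|apply: continuous_comp; [exact: cp|exact: cF]].
  by apply: continuousN; apply: continuous_comp; [exact: cp|exact: cg].
have step_der (p q : R -> R) : continuous p -> continuous q -> forall t,
    is_derive t (1 : R) (fun t => x0 + prim (fun s => q s - F (p s)) t) (q t - F (p t)) /\
    is_derive t (1 : R) (fun t => z0 + prim (fun s => - g (p s)) t) (- g (p t)).
  move=> cp cq t; have [c1 c2] := rhs_cts _ _ cp cq.
  have [_ d1] := primP c1; have [_ d2] := primP c2.
  split; first by apply: (is_derive_eq (is_deriveD1 (is_deriveC1 x0 t) (d1 t))); rewrite add0r.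
  by apply: (is_derive_eq (is_deriveD1 (is_deriveC1 z0 t) (d2 t))); rewrite add0r.
have step_0 (p q : R -> R) : continuous p -> continuous q ->
    x0 + prim (fun s => q s - F (p s)) 0 = x0 /\ z0 + prim (fun s => - g (p s)) 0 = z0.
  move=> cp cq; have [c1 c2] := rhs_cts _ _ cp cq.
  by have [-> _] := primP c1; have [-> _] := primP c2; rewrite !addr0.
have cts n : continuous (x n) /\ continuous (z n).
  elim: n => [|n [cx cz]]; first by split=> t; exact: cvg_cst.
  by split=> t; have [d1 d2] := step_der _ _ cx cz t; [exact: is_derive_cts d1|exact: is_derive_cts d2].
have dx n t : is_derive t (1 : R) (x n.+1) (z n t - F (x n t)).
  by have [cx cz] := cts n; have [] := step_der _ _ cx cz t.
have dz n t : is_derive t (1 : R) (z n.+1) (- g (x n t)).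
  by have [cx cz] := cts n; have [] := step_der _ _ cx cz t.
have xn0 n : x n 0 = x0 /\ z n 0 = z0.
  by case: n => [//|n]; have [cx cz] := cts n; exact: step_0.
(* The right-hand side changes by at most 2K times the larger change of its arguments, so k = 4K
   makes each Picard step halve the weighted distance. [C] bounds the speed at the initial point. *)
pose K := L + 1; pose k := 4 * K.
pose C := `|z0 - F x0| + `|g x0|.
have K1 : 1 <= K by rewrite /K; lra.
have C0 : 0 <= C by rewrite addr_ge0.
have rhs_lip (a b a' b' B : R) : `|a - a'| <= B -> `|b - b'| <= B ->
    `|(b - F a) - (b' - F a')| <= 2 * K * B /\ `|(- g a) - (- g a')| <= 2 * K * B.
  move=> aB bB; have B0 : 0 <= B by apply: le_trans aB.
  have F1 := FL a a'; have g1 := gL a a'.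
  have LB : L * `|a - a'| <= L * B by rewrite ler_wpM2l.
  have LB0 : 0 <= L * B by rewrite mulr_ge0.
  split.
    have -> : (b - F a) - (b' - F a') = (b - b') - (F a - F a') by ring.
    by apply: (le_trans (ler_normB _ _)); rewrite /K; nra.
  have -> : (- g a) - (- g a') = - (g a - g a') by ring.
  by rewrite normrN /K; nra.
have E1 t : 1 <= expR (k * `|t|).
  by rewrite -expR0 ler_expR mulr_ge0// /k /K; lra.
pose W t := C * expR (k * `|t|).
have W0 t : 0 <= W t by rewrite mulr_ge0// expR_ge0.
have diff n : forall t, `|x n.+1 t - x n t| <= W t / 2 ^+ n /\ `|z n.+1 t - z n t| <= W t / 2 ^+ n.
  elim: n => [|n IH] t.
    have Ck s : C <= C * k * expR (k * `|s|).
      rewrite -mulrA ler_peMr// mulr_ege1//; rewrite /k; lra.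
    have EW : C * (expR (k * `|t|) - 1) <= W t / 2 ^+ 0.
      by rewrite expr0 divr1 ler_wpM2l// lerBlDr lerDl.
    split; apply: le_trans EW.
      have := @exp_growth_bound (x 1%N) (fun t => z 0%N t - F (x 0%N t)) C k (dx 0%N) _ t.
      rewrite (proj1 (xn0 1%N)); apply=> s; apply: le_trans (Ck s).
      by rewrite /C lerDl.
    have := @exp_growth_bound (z 1%N) (fun t => - g (x 0%N t)) C k (dz 0%N) _ t.
    rewrite (proj2 (xn0 1%N)); apply=> s; apply: le_trans (Ck s).
    by rewrite normrN /C lerDr.
  have EW : C / 2 ^+ n.+1 * (expR (k * `|t|) - 1) <= W t / 2 ^+ n.+1.
    rewrite /W mulrAC ler_wpM2r ?invr_ge0 ?exprn_ge0// ler_wpM2l//.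
    by rewrite lerBlDr lerDl.
  have WW s : 2 * K * (W s / 2 ^+ n) = C / 2 ^+ n.+1 * k * expR (k * `|s|).
    have := @expf_neq0 R 2 n; rewrite pnatr_eq0 /W /k exprS; move: (2 ^+ n) => q q0; field; exact: q0.
  split; apply: le_trans EW.
    have := @exp_growth_bound (fun t => x n.+2 t - x n.+1 t)
      (fun t => (z n.+1 t - F (x n.+1 t)) - (z n t - F (x n t))) (C / 2 ^+ n.+1) k
      (fun t => is_deriveB1 (dx n.+1 t) (dx n t)) _ t.
    rewrite !(proj1 (xn0 _)) subrr subr0; apply=> s; rewrite -WW.
    by have [i1 i2] := IH s; have [] := rhs_lip _ _ _ _ _ i1 i2.
  have := @exp_growth_bound (fun t => z n.+2 t - z n.+1 t)
      (fun t => (- g (x n.+1 t)) - (- g (x n t))) (C / 2 ^+ n.+1) k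
      (fun t => is_deriveB1 (dz n.+1 t) (dz n t)) _ t.
  rewrite !(proj2 (xn0 _)) subrr subr0; apply=> s; rewrite -WW.
  by have [i1 i2] := IH s; have [] := rhs_lip _ _ _ _ _ i1 i2.
have [X XP] : exists X, forall t n, `|x n t - X t| <= 2 * W t / 2 ^+ n.
  have H t : exists l, forall n, `|x n t - l| <= 2 * W t / 2 ^+ n.
    by apply: geometric_limit => n; have [] := diff n t.
  by have [X XP] := choice H; exists X.
have [Z ZP] : exists Z, forall t n, `|z n t - Z t| <= 2 * W t / 2 ^+ n.
  have H t : exists l, forall n, `|z n t - l| <= 2 * W t / 2 ^+ n.
    by apply: geometric_limit => n; have [] := diff n t.
  by have [Z ZP] := choice H; exists Z.
have Wmono s t : `|s| <= `|t| -> W s <= W t.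
  by move=> st; rewrite ler_wpM2l// ler_expR ler_wpM2l// /k; lra.
have lim_cts (v : nat -> R -> R) (V : R -> R) : (forall n, continuous (v n)) ->
    (forall t n, `|v n t - V t| <= 2 * W t / 2 ^+ n) -> continuous V.
  move=> cv vV t; apply/cvgrPdist_lt => e e0.
  have [n Hn] := @geometric_small (e / 4) (2 * W (`|t| + 1)) (divr_gt0 e0 (ltr0n _ 4)).
  have vn s : `|s| <= `|t| + 1 -> `|v n s - V s| < e / 4.
    move=> st; apply: le_lt_trans Hn; apply: (le_trans (vV _ _)).
    rewrite ler_wpM2r ?invr_ge0 ?exprn_ge0// ler_wpM2l// Wmono//.
    by rewrite [leRHS]ger0_norm// addr_ge0.
  near=> s.
  have s1 : `|s| <= `|t| + 1.
    have : `|t - s| < 1 by near: s; apply: cvgr_dist_lt => //; exact: cvg_id.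
    have := ler_normB t (t - s); rewrite subKr => h1 h2; lra.
  have : `|v n t - v n s| < e / 4.
    near: s; have := cv n t; move/cvgrPdist_lt; apply.
    by rewrite divr_gt0.
  have v1 := vn _ s1; have v2 : `|v n t - V t| < e / 4 by apply: vn; rewrite lerDl.
  move: v1 v2; rewrite !ltr_norml => v1 v2 v3; lra.
have cX : continuous X by apply: lim_cts XP => n; have [] := cts n.
have cZ : continuous Z by apply: lim_cts ZP => n; have [] := cts n.
(* The limit [X], [Z] is only known to be continuous. Its Picard image [X'], [Z'] is differentiable
   with the wanted derivatives, and it equals the limit because the iterates converge to both. *)
pose X' t := x0 + prim (fun s => Z s - F (X s)) t.
pose Z' t := z0 + prim (fun s => - g (X s)) t.
have D t := step_der _ _ cX cZ t.
have [X'0 Z'0] : X' 0 = x0 /\ Z' 0 = z0 by exact: step_0.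
have WW n s : 2 * K * (2 * W s / 2 ^+ n) = C / 2 ^+ n * k * expR (k * `|s|).
  have := @expf_neq0 R 2 n; rewrite pnatr_eq0 /W /k; move: (2 ^+ n) => q q0; field; exact: q0.
have limE (v : nat -> R -> R) (V V' : R -> R) t :
    (forall n, `|v n t - V t| <= 2 * W t / 2 ^+ n) ->
    (forall n, `|v n.+1 t - V' t| <= W t / 2 ^+ n) -> V t = V' t.
  move=> h1 h2; apply/eqP; rewrite -subr_eq0 -normr_eq0; apply/negPn/negP => ne.
  have e0 : 0 < `|V t - V' t| by rewrite lt_neqAle eq_sym ne normr_ge0.
  have [n Hn] := @geometric_small (`|V t - V' t| / 2) (W t) (divr_gt0 e0 (ltr0n _ 2)).
  have := h1 n.+1; have := h2 n.
  have -> : 2 * W t / 2 ^+ n.+1 = W t / 2 ^+ n.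
    have := @expf_neq0 R 2 n; rewrite pnatr_eq0 exprS; move: (2 ^+ n) => q q0; field; exact: q0.
  have := ler_distD (v n.+1 t) (V t) (V' t).
  rewrite [`|V t - v n.+1 t|]distrC; lra.
have XE t : X t = X' t.
  apply: (@limE x) => [n|n]; first exact: XP.
  have := @exp_growth_bound (fun t => x n.+1 t - X' t)
      (fun t => (z n t - F (x n t)) - (Z t - F (X t))) (C / 2 ^+ n) k
      (fun t => is_deriveB1 (dx n t) (proj1 (D t))) _ t.
  rewrite !(proj1 (xn0 _)) X'0 subrr subr0 => H.
  apply: le_trans (H _) _.
    by move=> s; rewrite -WW; have [] := rhs_lip _ _ _ _ _ (XP s n) (ZP s n).
  rewrite /W mulrAC ler_wpM2r ?invr_ge0 ?exprn_ge0// ler_wpM2l//.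
  by rewrite lerBlDr lerDl.
have ZE t : Z t = Z' t.
  apply: (@limE z) => [n|n]; first exact: ZP.
  have := @exp_growth_bound (fun t => z n.+1 t - Z' t)
      (fun t => (- g (x n t)) - (- g (X t))) (C / 2 ^+ n) k
      (fun t => is_deriveB1 (dz n t) (proj2 (D t))) _ t.
  rewrite !(proj2 (xn0 _)) Z'0 subrr subr0 => H.
  apply: le_trans (H _) _.
    by move=> s; rewrite -WW; have [] := rhs_lip _ _ _ _ _ (XP s n) (ZP s n).
  rewrite /W mulrAC ler_wpM2r ?invr_ge0 ?exprn_ge0// ler_wpM2l//.
  by rewrite lerBlDr lerDl.
exists X', Z'; split=> // t; rewrite -XE -ZE; exact: D.
Unshelve. all: by end_near.
Qed.

Definition locally_lipschitz F :=
  forall K, exists2 L, 0 <= L & forall u v, `|u| <= K -> `|v| <= K -> `|F u - F v| <= L * `|u - v|.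

Lemma lsol_cts F g x z : lsol F g x z -> continuous x /\ continuous z.
Proof. by move=> S; split=> t; have [d1 d2] := S t; [exact: is_derive_cts d1|exact: is_derive_cts d2]. Qed.

Lemma lsol_shift F g x z a : lsol F g x z -> lsol F g (fun t => x (a + t)) (fun t => z (a + t)).
Proof. by move=> S t; have [d1 d2] := S (a + t); split; exact: is_derive_shift1. Qed.

Lemma lsol_reverse F g x z : lsol F g x z ->
  lsol (fun u => - F u) g (fun t => x (- t)) (fun t => - z (- t)).
Proof.
move=> S t; have [d1 d2] := S (- t); split.
  by apply: (is_derive_eq (is_derive_oppr_arg d1)); ring.
by apply: (is_derive_eq (is_deriveN1 (is_derive_oppr_arg d2))); ring.
Qed.

Lemma lsol_mirror F g x z : (forall u, g (- u) = - g u) -> lsol F g x z ->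
  lsol (fun u => F (- u)) g (fun t => - x (- t)) (fun t => z (- t)).
Proof.
move=> go S t; have [d1 d2] := S (- t); split.
  by apply: (is_derive_eq (is_deriveN1 (is_derive_oppr_arg d1))); rewrite !opprK.
by apply: (is_derive_eq (is_derive_oppr_arg d2)); rewrite go !opprK.
Qed.

Lemma lsol_unique_right F g x z (x' z' : R -> R) t0 t :
  locally_lipschitz F -> locally_lipschitz g -> t0 <= t ->
  lsol F g x z -> lsol F g x' z' -> x t0 = x' t0 -> z t0 = z' t0 ->
  x t = x' t /\ z t = z' t.
Proof.
move=> lF lg t0t S S' e1 e2.
have [cx cz] := lsol_cts S; have [cx' cz'] := lsol_cts S'.
have [M1 M10 B1] := @continuous_bounded _ x t0 t (fun s _ => cx s).
have [M2 M20 B2] := @continuous_bounded _ x' t0 t (fun s _ => cx' s).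
have [L1 L10 H1] := lF (M1 + M2); have [L2 L20 H2] := lg (M1 + M2).
pose E s := (x s - x' s) ^+ 2 + (z s - z' s) ^+ 2.
pose E' s := 2 * (x s - x' s) * ((z s - z' s) - (F (x s) - F (x' s)))
   - 2 * (z s - z' s) * (g (x s) - g (x' s)).
have dE s : is_derive s (1 : R) E (E' s).
  have [d1 d2] := S s; have [d1' d2'] := S' s.
  apply: (is_derive_eq (is_deriveD1 (is_deriveX1 2 (is_deriveB1 d1 d1')) (is_deriveX1 2 (is_deriveB1 d2 d2')))).
  by rewrite /E' /=; ring.
have : E t <= E t0 * expR ((1 + 2 * L1 + L2) * (t - t0)).
  apply: gronwall => // s; first by move=> _; exact: is_derive_cts (dE s).
  move=> /andP[s1 s2]; exists (E' s) => //.
  have xs : `|x s| <= M1 + M2.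
    by rewrite (le_trans (B1 _ _)) ?lerDl// ?ltW// !ltW.
  have xs' : `|x' s| <= M1 + M2.
    by rewrite (le_trans (B2 _ _)) ?lerDr// ?ltW// !ltW.
  have := H1 _ _ xs xs'; have := H2 _ _ xs xs'; rewrite /E /E'.
  move: (x s - x' s) (z s - z' s) (F (x s) - F (x' s)) (g (x s) - g (x' s)) => p q r w hw hr.
  have qq : 2 * (p * q) <= p ^+ 2 + q ^+ 2 by have := sqr_ge0 (p - q); nra.
  have n1 : - (p * r) <= L1 * p ^+ 2.
    rewrite -mulrN (le_trans (ler_norm _))// normrM normrN -[p ^+ 2]real_normK ?num_real//.
    by rewrite expr2 mulrCA ler_wpM2l.
  have n2 : - (q * w) <= L2 * (`|q| * `|p|).
    rewrite -mulrN (le_trans (ler_norm _))// normrM normrN.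
    by rewrite mulrCA ler_wpM2l.
  have n3 : 2 * (`|q| * `|p|) <= p ^+ 2 + q ^+ 2.
    have := sqr_ge0 (`|p| - `|q|); rewrite -[p ^+ 2]real_normK ?num_real//.
    by rewrite -[q ^+ 2]real_normK ?num_real//; nra.
  have n4 : L2 * (2 * (`|q| * `|p|)) <= L2 * (p ^+ 2 + q ^+ 2) by rewrite ler_wpM2l.
  have n5 : 0 <= L1 * q ^+ 2 by rewrite mulr_ge0// sqr_ge0.
  by lra.
rewrite /E e1 e2 !subrr expr0n addr0 mul0r => E0.
have : (x t - x' t) ^+ 2 == 0 /\ (z t - z' t) ^+ 2 == 0.
  have := sqr_ge0 (x t - x' t); have := sqr_ge0 (z t - z' t) => q1 q2.
  by split; rewrite eq_le; apply/andP; split; lra.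
by rewrite !sqrf_eq0 !subr_eq0 => -[/eqP-> /eqP->].
Qed.

Theorem lsol_unique F g x z (x' z' : R -> R) t0 :
  locally_lipschitz F -> locally_lipschitz g ->
  lsol F g x z -> lsol F g x' z' -> x t0 = x' t0 -> z t0 = z' t0 ->
  forall t, x t = x' t /\ z t = z' t.
Proof.
move=> lF lg S S' e1 e2 t; have [t0t|tt0] := leP t0 t; first exact: (lsol_unique_right lF lg t0t S S' e1 e2).
have lFN : locally_lipschitz (fun u => - F u).
  move=> K; have [L L0 H] := lF K; exists L => // u v uK vK.
  by rewrite -opprD normrN; exact: H.
have := @lsol_unique_right _ _ _ _ _ _ (- t0) (- t) lFN lg _
  (lsol_reverse S) (lsol_reverse S').
rewrite !opprK lerN2 => /(_ (ltW tt0) e1); rewrite e2 => /(_ erefl)[-> /oppr_inj ->].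
by [].
Qed.

End Picard.

(** * Polynomial functions and their thresholds *)

Section PolynomialFunctions.
Variable R : realType.
Implicit Types (c : nat -> R) (x e a b M u v : R) (p : {poly R}) (lo hi d i : nat).

Definition poly_coef c lo hi : {poly R} := \sum_(lo <= i < hi.+1) c i *: 'X^i.

Lemma poly_funE c lo hi x : poly_fun c lo hi x = (poly_coef c lo hi).[x].
Proof.
rewrite /poly_fun /poly_coef horner_sum; apply: eq_bigr => i _.
by rewrite hornerZ hornerXn.
Qed.

Lemma coef_poly_coef c lo hi i :
  (poly_coef c lo hi)`_i = if (lo <= i <= hi)%N then c i else 0.
Proof.
rewrite /poly_coef coef_sum.
under eq_bigr do rewrite coefZ coefXn.
case: ifPn => H.
  rewrite (bigD1_seq i) ?iota_uniq//= ?eqxx ?mulr1 ?big1 ?addr0//.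
    by move=> j ji; rewrite eq_sym (negbTE ji) mulr0.
  by rewrite mem_index_iota ltnS.
rewrite big_seq big1// => j; rewrite mem_index_iota ltnS => jj.
by case: eqP => [ij|_]; [rewrite ij jj in H|rewrite mulr0].
Qed.

Lemma is_derive_horner p x : is_derive x (1 : R) (horner p) (p^`()).[x].
Proof.
apply: DeriveDef; first exact: derivable_horner.
by rewrite -derive1E -derivE.
Qed.

Lemma bounded_derive_lipschitz (F f : R -> R) a b M :
  (forall u, is_derive u (1 : R) F (f u)) -> (forall u, a <= u <= b -> `|f u| <= M) ->
  forall u v, a <= u <= b -> a <= v <= b -> `|F u - F v| <= M * `|u - v|.
Proof.
move=> dF HM.
suff H u v : u <= v -> a <= u <= b -> a <= v <= b -> `|F v - F u| <= M * `|v - u|.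
  move=> u v uK vK; have [uv|vu] := leP u v; last by apply: H => //; exact: ltW.
  by rewrite distrC [`|u - v|]distrC; apply: H.
rewrite le_eqVlt => /predU1P[->|uv] uK vK; first by rewrite !subrr normr0 mulr0.
have [||t /andP[ut tv] ->] := @mean_value R F u v uv.
- by move=> t _; exact: is_derive_cts (dF t).
- by move=> t _; have [] := dF t.
rewrite normrM ler_wpM2r//; have [_ ->] := dF t.
by apply: HM; move: uK vK; lra.
Qed.

Lemma C1_locally_lipschitz (F f : R -> R) :
  (forall u, is_derive u (1 : R) F (f u)) -> continuous f -> locally_lipschitz F.
Proof.
move=> dF cf K; have [M M0 HM] := @continuous_bounded R f (- K) K (fun t _ => @cf t).
exists M; first exact: ltW.
by move=> u v; rewrite ![`|_| <= K]ler_norml => uK vK; exact: (bounded_derive_lipschitz dF HM).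
Qed.

Lemma locally_lipschitz_horner p : locally_lipschitz (horner p).
Proof.
exact: (C1_locally_lipschitz (is_derive_horner p) (@continuous_horner _ _)).
Qed.

Lemma poly_fun_cts c lo hi : continuous (poly_fun c lo hi).
Proof.
rewrite (_ : poly_fun c lo hi = horner (poly_coef c lo hi)); last exact/funext/poly_funE.
by move=> x; exact: continuous_horner.
Qed.

Lemma poly_fun_locally_lipschitz c lo hi : locally_lipschitz (poly_fun c lo hi).
Proof.
rewrite (_ : poly_fun c lo hi = horner (poly_coef c lo hi)); last exact/funext/poly_funE.
exact: locally_lipschitz_horner.
Qed.

Lemma poly_fun_derivable c lo hi x :
  is_derive x (1 : R) (poly_fun c lo hi) (poly_coef c lo hi)^`().[x].
Proof.
rewrite (_ : poly_fun c lo hi = horner (poly_coef c lo hi)); last exact/funext/poly_funE.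
exact: is_derive_horner.
Qed.

Definition antideriv_coef c (i : nat) : R := c i.-1 / i%:R.

Lemma is_derive_antideriv c lo hi x :
  is_derive x (1 : R) (poly_fun (antideriv_coef c) lo.+1 hi.+1) (poly_fun c lo hi x).
Proof.
apply: (is_derive_eq (poly_fun_derivable _ _ _ x)).
rewrite poly_funE; congr (_.[_]); apply/polyP => i.
rewrite coef_deriv !coef_poly_coef !ltnS /antideriv_coef /=.
by case: ifP => _; [rewrite -[LHS]mulr_natr divfK ?pnatr_eq0|rewrite mul0rn].
Qed.

Lemma poly_fun0 c lo hi : (0 < lo)%N -> poly_fun c lo hi 0 = 0.
Proof.
move=> lo0; rewrite /poly_fun big_seq big1// => i.
rewrite mem_index_iota => /andP[loi _].
by rewrite expr0n gtn_eqF ?mulr0// (leq_trans lo0).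
Qed.

Lemma horner_eq0 p : (forall x, p.[x] = 0) -> p = 0.
Proof.
move=> p0; apply/eqP/negPn/negP => pN0.
have := @max_poly_roots _ p [seq i%:R | i <- iota 0 (size p)] pN0.
rewrite size_map size_iota ltnn => H.
suff : false by [].
apply: H; first by apply/allP => y _; rewrite /root p0.
by rewrite map_inj_uniq ?iota_uniq// => i j /eqP; rewrite eqr_nat => /eqP.
Qed.

Lemma odd_poly_funP c lo hi : odd_function (poly_fun c lo hi) <->
  forall i, (lo <= i <= hi)%N -> ~~ odd i -> c i = 0.
Proof.
split=> [fo i loi iev|H].
  pose c' j := (-1) ^+ j * c j.
  have c'E x : poly_fun c' lo hi x = poly_fun c lo hi (- x).
    rewrite /poly_fun; apply: eq_bigr => j _.
    by rewrite exprNn /c' mulrAC mulrC [c j * _]mulrC.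
  have : poly_coef c lo hi + poly_coef c' lo hi = 0.
    by apply: horner_eq0 => x; rewrite hornerD -!poly_funE c'E fo subrr.
  move=> /(congr1 (fun q : {poly R} => q`_i)).
  rewrite coefD coef0 !coef_poly_coef loi /c'.
  rewrite -signr_odd (negbTE iev) expr0 mul1r -mulr2n => /eqP.
  by rewrite mulrn_eq0 /= => /eqP.
move=> x; rewrite /poly_fun -sumrN big_seq [RHS]big_seq; apply: eq_bigr => i.
rewrite mem_index_iota ltnS => loi.
have [io|iev] := boolP (odd i); last by rewrite H// !mul0r oppr0.
by rewrite exprNn -signr_odd io expr1 mulN1r mulrN.
Qed.

(** [d] is a gap in the exponents after the lowest one: 1 for every polynomial, 2 for an odd one.
    The value 2 is needed when the discriminant vanishes. *)
Lemma poly_fun_near0 c lo hi d : (lo <= hi)%N ->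
  (forall i, (lo < i < lo + d)%N -> (i <= hi)%N -> c i = 0) ->
  exists2 C : R, 0 <= C & forall x, 0 <= x <= 1 ->
    `|poly_fun c lo hi x - c lo * x ^+ lo| <= C * x ^+ (lo + d).
Proof.
move=> lohi c0; exists (\sum_(lo.+1 <= i < hi.+1) `|c i|); first exact: sumr_ge0.
move=> x /andP[x0 x1]; rewrite /poly_fun big_ltn_cond// [X in `|X|]addrAC subrr add0r.
apply: (le_trans (ler_norm_sum _ _ _)); rewrite mulr_suml big_seq [leRHS]big_seq.
apply: ler_sum => i; rewrite mem_index_iota ltnS => /andP[loi ihi].
have [ilo|loi'] := ltnP i (lo + d).
  by rewrite c0 ?loi// mul0r normr0 mul0r.
by rewrite normrM normrX (ger0_norm x0) ler_wpM2l// ler_wiXn2l.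
Qed.

Lemma poly_fun_nearoo c lo hi d : (lo <= hi)%N ->
  (forall i, (lo <= i < hi)%N -> (hi < i + d)%N -> c i = 0) ->
  exists2 C : R, 0 <= C & forall x, 1 <= x ->
    `|poly_fun c lo hi x - c hi * x ^+ hi| * x ^+ d <= C * x ^+ hi.
Proof.
move=> lohi c0; exists (\sum_(lo <= i < hi) `|c i|); first exact: sumr_ge0.
move=> x x1; have x0 : 0 <= x by rewrite (le_trans _ x1).
rewrite /poly_fun big_nat_recr//= addrK.
apply: (@le_trans _ _ ((\sum_(lo <= i < hi) `|c i * x ^+ i|) * x ^+ d)).
  by rewrite ler_wpM2r ?exprn_ge0//; exact: ler_norm_sum.
rewrite !mulr_suml big_seq [leRHS]big_seq.
apply: ler_sum => i; rewrite mem_index_iota => /andP[loi ihi].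
have [hii|ihi'] := ltnP hi (i + d).
  by rewrite c0 ?loi// mul0r normr0 !mul0r.
by rewrite normrM normrX (ger0_norm x0) -mulrA -exprD ler_wpM2l// ler_weXn2l.
Qed.

Lemma poly_fun_sign_near0 c lo hi : (lo <= hi)%N -> c lo != 0 ->
  exists2 e : R, 0 < e & forall x, 0 < x <= e -> 0 < c lo * poly_fun c lo hi x.
Proof.
move=> lohi cN0; have [|C C0 H] := @poly_fun_near0 c lo hi 1 lohi.
  by move=> i /andP[h1]; rewrite addn1 ltnS leqNgt h1.
have c0 : 0 < `|c lo| by rewrite normr_gt0.
exists (Num.min 1 (`|c lo| / (C + 1))).
  by rewrite lt_min ltr01 divr_gt0// ltr_wpDl.
move=> x /andP[x0]; rewrite le_min => /andP[x1 xC].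
have := H x; rewrite ltW//= x1 => /(_ isT).
rewrite addn1 exprSr mulrA => Hx.
have xl : 0 < x ^+ lo by rewrite exprn_gt0.
have Cx : C * x < `|c lo|.
  rewrite ler_pdivlMr ?ltr_wpDl// in xC.
  by apply: lt_le_trans xC; rewrite mulrC ltr_pM2l// ltrDl.
set y := poly_fun c lo hi x; have : `|c lo * (y - c lo * x ^+ lo)| < c lo ^+ 2 * x ^+ lo.
  rewrite normrM -(real_normK (num_real _)) expr2 -mulrA ltr_pM2l//.
  by apply: (le_lt_trans Hx); rewrite mulrAC ltr_pM2r.
rewrite ltr_norml => /andP[+ _]; rewrite mulrBr mulrA -expr2; lra.
Qed.

End PolynomialFunctions.

Section Thresholds.
Variable R : realType.
Implicit Types (a b c : nat -> R) (A B x e : R).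

Lemma expr_2n1 x (n : nat) : x ^+ (2 * n + 1) = x ^+ n * x ^+ n.+1.
Proof. by rewrite -exprD; congr (_ ^+ _); lia. Qed.

Lemma threshold_slack (N A B : R) : 0 <= N -> B ^+ 2 < 4 * N * A ->
  exists2 e, 0 < e & (`|B| + e) ^+ 2 < 4 * N * (A - e).
Proof.
(* For e <= 1 the two sides move towards each other by 2 e |B| + e^2 + 4 N e <= e S in all, and e S
   <= D / 2. *)
move=> N0 H; pose D := 4 * N * A - B ^+ 2; pose S := 2 * `|B| + 1 + 4 * N.
have D0 : 0 < D by rewrite subr_gt0.
have B0 : 0 <= `|B| by [].
have S1 : 1 <= S by rewrite /S; lra.
have S0 : 0 < S by lra.
exists (Num.min 1 (D / (2 * S))).
  by rewrite lt_min ltr01 divr_gt0// mulr_gt0.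
set e := Num.min _ _.
have e0 : 0 < e by rewrite lt_min ltr01 divr_gt0// mulr_gt0.
have e1 : e <= 1 by rewrite ge_min lexx.
have eS : e * (2 * S) <= D by rewrite -ler_pdivlMr ?mulr_gt0// ge_min lexx orbT.
have e2 : e ^+ 2 <= e by rewrite expr2 ler_piMr// ltW.
have BE : `|B| ^+ 2 = B ^+ 2 by rewrite real_normK ?num_real.
rewrite sqrrD BE; move: eS; rewrite /D /S => eS.
have p1 : 0 <= e * `|B| by rewrite mulr_ge0// ltW.
have p2 : 0 <= e * N by rewrite mulr_ge0// ltW.
by nra.
Qed.

(* Near the origin, resp. infinity, (f, g) is dominated by the quasi-homogeneous
   pair (B x^k, A x^(2k+1)), whose phase portrait is a focus since B^2 < 4(k+1)A. *)
Definition focus_near0 (f g : R -> R) (k : nat) := exists A B x1 : R,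
  [/\ 0 < x1, B ^+ 2 < 4 * k.+1%:R * A &
    forall x, 0 < x <= x1 -> `|f x| <= B * x ^+ k /\ A * x ^+ (2 * k + 1) <= g x].

Definition focus_nearoo (f g : R -> R) (k : nat) := exists A B x1 : R,
  [/\ 0 < x1, B ^+ 2 < 4 * k.+1%:R * A &
    forall x, x1 <= x -> `|f x| <= B * x ^+ k /\ A * x ^+ (2 * k + 1) <= g x].

Lemma poly_focus_near0 a b (r m s n : nat) : (r <= m)%N -> (s <= n)%N ->
  ((r < 2 * s + 1)%N /\ 0 < a r) \/ (r = (2 * s + 1)%N /\ b s ^+ 2 < 4 * s.+1%:R * a r) ->
  focus_near0 (poly_fun b s n) (poly_fun a r m) s.
Proof.
move=> rm sn H.
have [|Cg Cg0 Hg] := @poly_fun_near0 _ a r m 1 rm.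
  by move=> i /andP[h1]; rewrite addn1 ltnS leqNgt h1.
have [|Cf Cf0 Hf] := @poly_fun_near0 _ b s n 1 sn.
  by move=> i /andP[h1]; rewrite addn1 ltnS leqNgt h1.
have Bf B x e : 0 < x <= 1 -> Cf * x <= e -> `|b s| + e <= B -> `|poly_fun b s n x| <= B * x ^+ s.
  move=> /andP[x0 x1] Ce bB; have := Hf x; rewrite (ltW x0) x1 => /(_ isT).
  have xs : 0 < x ^+ s by rewrite exprn_gt0.
  rewrite addn1 exprSr mulrA [_ * _ * x]mulrAC => Hx.
  rewrite -[poly_fun _ _ _ _](subrK (b s * x ^+ s)) (le_trans (ler_normD _ _))//.
  rewrite normrM [`|_ ^+ s|]ger0_norm ?(ltW xs)//.
  have h1 : Cf * x * x ^+ s <= e * x ^+ s by rewrite ler_wpM2r// ltW.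
  have h2 : (`|b s| + e) * x ^+ s <= B * x ^+ s by rewrite ler_wpM2r// ltW.
  by lra.
have Ag A x e : 0 < x <= 1 -> Cg * x <= e -> A <= a r - e -> A * x ^+ r <= poly_fun a r m x.
  move=> /andP[x0 x1] Ce bB; have := Hg x; rewrite (ltW x0) x1 => /(_ isT).
  have xs : 0 < x ^+ r by rewrite exprn_gt0.
  rewrite addn1 exprSr mulrA [_ * _ * x]mulrAC ler_norml => /andP[Hx _].
  have h1 : Cg * x * x ^+ r <= e * x ^+ r by rewrite ler_wpM2r// ltW.
  have h2 : A * x ^+ r <= (a r - e) * x ^+ r by rewrite ler_wpM2r// ltW.
  by lra.
case: H => [[rs ar0]|[rE H]].
(* Near 0 the term a_r x^r dominates every multiple of x^(2s+1), so [A] can be chosen after [B],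
   large enough for the discriminant to be negative. *)
- pose B := `|b s| + Cf; pose A := (B ^+ 2 + 1) / (4 * s.+1%:R).
  have s0 : 0 < 4 * s.+1%:R :> R by rewrite mulr_gt0// ltr0n.
  have A0 : 0 < A by rewrite divr_gt0// ltr_wpDl// sqr_ge0.
  exists A, B, (Num.min 1 (a r / (2 * (A + Cg)))).
  have ACg : 0 < A + Cg by lra.
  split; first by rewrite lt_min ltr01 divr_gt0// mulr_gt0.
    by rewrite /A mulrC divfK ?gt_eqF// ltrDl.
  move=> x /andP[x0]; rewrite le_min => /andP[x1].
  rewrite ler_pdivlMr ?mulr_gt0// => xA.
  split; first by apply: (@Bf B x Cf); rewrite ?x0// ler_piMr.
  apply: (@le_trans _ _ (a r / 2 * x ^+ r)); last first.
    apply: (@Ag _ x (a r / 2)); rewrite ?x0//; last lra.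
    by have := mulr_gt0 A0 x0; lra.
  have -> : (2 * s + 1 = (2 * s - r).+1 + r)%N by lia.
  rewrite exprD mulrA ler_wpM2r ?exprn_ge0 ?(ltW x0)// exprS.
  have : x ^+ (2 * s - r) <= 1 by rewrite exprn_ile1 ?(ltW x0).
  have q0 : 0 <= A * x by rewrite mulr_ge0 ?ltW//.
  have q1 : 0 <= Cg * x by rewrite mulr_ge0// ltW.
  move=> xx; rewrite mulrA (le_trans (ler_wpM2l q0 xx))//; lra.
- have [e e0 He] := threshold_slack (ler0n _ _) H.
  exists (a r - e), (`|b s| + e), (Num.min 1 (e / (Cf + Cg + 1))).
  have CC : 0 < Cf + Cg + 1 by lra.
  split => //; first by rewrite lt_min ltr01 divr_gt0.
  move=> x /andP[x0]; rewrite le_min => /andP[x1].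
  rewrite ler_pdivlMr// => xe.
  have q0 : 0 <= x * Cf by rewrite mulr_ge0// ltW.
  have q1 : 0 <= x * Cg by rewrite mulr_ge0// ltW.
  split; first by apply: (@Bf _ x e); rewrite ?x0//; lra.
  by rewrite -rE; apply: (@Ag _ x e); rewrite ?x0//; lra.
Qed.

Lemma poly_focus_nearoo a b (r m s n : nat) : (r <= m)%N -> (s <= n)%N ->
  ((2 * n + 1 < m)%N /\ 0 < a m) \/ (m = (2 * n + 1)%N /\ b n ^+ 2 < 4 * n.+1%:R * a m) ->
  focus_nearoo (poly_fun b s n) (poly_fun a r m) n.
Proof.
move=> rm sn H.
have [|Cg Cg0 Hg] := @poly_fun_nearoo _ a r m 1 rm.
  by move=> i /andP[_ h1]; rewrite addn1 ltnS leqNgt h1.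
have [|Cf Cf0 Hf] := @poly_fun_nearoo _ b s n 1 sn.
  by move=> i /andP[_ h1]; rewrite addn1 ltnS leqNgt h1.
have Bf B x e : 1 <= x -> Cf <= e * x -> `|b n| + e <= B -> `|poly_fun b s n x| <= B * x ^+ n.
  move=> x1 Ce bB; have x0 : 0 < x by lra.
  have := Hf x x1; rewrite expr1 => Hx.
  have xs : 0 < x ^+ n by rewrite exprn_gt0.
  have h1 : Cf * x ^+ n <= e * x * x ^+ n by rewrite ler_wpM2r// ltW.
  have Hx' : `|poly_fun b s n x - b n * x ^+ n| <= e * x ^+ n.
    rewrite -(ler_pM2r x0) (le_trans Hx)// (le_trans h1)//.
    by rewrite mulrAC.
  rewrite -[poly_fun _ _ _ _](subrK (b n * x ^+ n)) (le_trans (ler_normD _ _))//.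
  rewrite normrM [`|_ ^+ n|]ger0_norm ?(ltW xs)//.
  have h2 : (`|b n| + e) * x ^+ n <= B * x ^+ n by rewrite ler_wpM2r// ltW.
  by lra.
have Ag A x e : 1 <= x -> Cg <= e * x -> A <= a m - e -> A * x ^+ m <= poly_fun a r m x.
  move=> x1 Ce bB; have x0 : 0 < x by lra.
  have := Hg x x1; rewrite expr1 => Hx.
  have xs : 0 < x ^+ m by rewrite exprn_gt0.
  have h1 : Cg * x ^+ m <= e * x * x ^+ m by rewrite ler_wpM2r// ltW.
  have Hx' : `|poly_fun a r m x - a m * x ^+ m| <= e * x ^+ m.
    rewrite -(ler_pM2r x0) (le_trans Hx)// (le_trans h1)//.
    by rewrite mulrAC.
  move: Hx'; rewrite ler_norml => /andP[Hx' _].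
  have h2 : A * x ^+ m <= (a m - e) * x ^+ m by rewrite ler_wpM2r// ltW.
  by lra.
case: H => [[rs am0]|[mE H]].
- pose B := `|b n| + Cf; pose A := (B ^+ 2 + 1) / (4 * n.+1%:R).
  have s0 : 0 < 4 * n.+1%:R :> R by rewrite mulr_gt0// ltr0n.
  have A0 : 0 < A by rewrite divr_gt0// ltr_wpDl// sqr_ge0.
  exists A, B, (Num.max 1 (2 * (A + Cg) / a m)).
  split; first by rewrite lt_max ltr01.
    by rewrite /A mulrC divfK ?gt_eqF// ltrDl.
  move=> x; rewrite ge_max => /andP[x1].
  rewrite ler_pdivrMr// => xA; have x0 : 0 < x by lra.
  split; first by apply: (@Bf B x Cf) => //; rewrite ler_peMr.
  apply: (@le_trans _ _ (a m / 2 * x ^+ m)); last first.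
    by apply: (@Ag _ x (a m / 2)) => //; lra.
  have -> : x ^+ m = x ^+ (m - (2 * n).+2).+1 * x ^+ (2 * n + 1).
    by rewrite -exprD; congr (_ ^+ _); lia.
  rewrite mulrA ler_wpM2r ?exprn_ge0 ?(ltW x0)// exprS.
  have : 1 <= x ^+ (m - (2 * n).+2) by rewrite exprn_ege1.
  have q0 : 0 <= a m / 2 * x by rewrite mulr_ge0 ?ltW// divr_gt0.
  move=> xx; rewrite mulrA (le_trans _ (ler_wpM2l q0 xx))//; lra.
- have [e e0 He] := threshold_slack (ler0n _ _) H.
  exists (a m - e), (`|b n| + e), (Num.max 1 ((Cf + Cg) / e)).
  split => //; first by rewrite lt_max ltr01.
  move=> x; rewrite ge_max => /andP[x1].
  rewrite ler_pdivrMr// => xe.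
  split; first by apply: (@Bf _ x e); rewrite //; lra.
  by rewrite -mE; apply: (@Ag _ x e); rewrite //; lra.
Qed.

End Thresholds.

(** * Half-plane arcs *)

Section LienardArcs.
Variable R : realType.
Implicit Types (x z : R -> R) (t s c d e K u v : R).

Lemma ivt_le (h : R -> R) a b v : a <= b -> continuous h -> h a <= v <= h b ->
  exists2 c, a <= c <= b & h c = v.
Proof.
move=> ab ch hv; have [||c] := @IVT R h a b v ab.
- by apply: continuous_within_seg => t _; exact: ch.
- by move: hv => /andP[av vb]; rewrite ge_min av /= le_max vb orbT.
by rewrite in_itv; exists c.
Qed.

Lemma quadratic_coercive (N A B : R) : 0 < N -> B ^+ 2 < 4 * N * A ->
  exists2 d, 0 < d & forall v, d * (1 + v ^+ 2) <= N * v ^+ 2 - B * `|v| + A.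
Proof.
move=> N0 H; have A0 : 0 < A.
  have N4 : 0 < 4 * N by rewrite mulr_gt0.
  by rewrite -(pmulr_rgt0 _ N4) (le_lt_trans (sqr_ge0 B) H).
(* With this [d] the terms linear in d cancel in 4 (N - d) (A - d) - B^2, which becomes 4 d^2;
   completing the square then proves the bound. *)
pose d := (4 * N * A - B ^+ 2) / (4 * (N + A)).
have NA : 0 < 4 * (N + A) by rewrite mulr_gt0// addr_gt0.
have d0 : 0 < d by rewrite divr_gt0// subr_gt0.
have dE : d * (4 * (N + A)) = 4 * N * A - B ^+ 2 by rewrite divfK ?gt_eqF.
have dN : d < N.
  rewrite ltr_pdivrMr//; have := sqr_ge0 B; have := mulr_gt0 N0 N0; lra.
exists d => // v; rewrite -[v ^+ 2]real_normK ?num_real//.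
move: `|v| => w; have Nd : 0 < N - d by lra.
rewrite -subr_ge0 -(pmulr_rge0 _ (_ : 0 < 4 * (N - d))) ?mulr_gt0//.
have -> : 4 * (N - d) * (N * w ^+ 2 - B * w + A - d * (1 + w ^+ 2)) =
  (2 * (N - d) * w - B) ^+ 2 + (4 * N * A - B ^+ 2 - d * (4 * (N + A))) + 4 * d ^+ 2 by ring.
by rewrite dE subrr addr0 addr_ge0 ?sqr_ge0// mulr_ge0// sqr_ge0.
Qed.

Variables F f g : R -> R.
Hypothesis dF : forall u, is_derive u (1 : R) F (f u).
Hypothesis cg : continuous g.
Hypothesis g_pos : forall u, 0 < u -> 0 < g u.

Lemma lienard_cts : continuous F.
Proof. by move=> u; exact: is_derive_cts (dF u). Qed.

Section Solution.
Variables x z : R -> R.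
Hypothesis S : lsol F g x z.
Let y t := z t - F (x t).

Lemma lsol_dx t : is_derive t (1 : R) x (y t).
Proof. by have [] := S t. Qed.

Lemma lsol_dz t : is_derive t (1 : R) z (- g (x t)).
Proof. by have [] := S t. Qed.

Lemma lsol_dy t : is_derive t (1 : R) y (- g (x t) - f (x t) * y t).
Proof.
have [d1 d2] := S t.
exact: (is_deriveB1 d2 (is_derive_comp1 (dF _) d1)).
Qed.

Lemma lsol_cx t : {for t, continuous x}. Proof. exact: is_derive_cts (lsol_dx t). Qed.
Lemma lsol_cz t : {for t, continuous z}. Proof. exact: is_derive_cts (lsol_dz t). Qed.
Lemma lsol_cy t : {for t, continuous y}. Proof. exact: is_derive_cts (lsol_dy t). Qed.

Lemma lsol_z_le a b : a <= b -> (forall t, a < t < b -> 0 <= x t) ->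
  g 0 = 0 -> z b <= z a.
Proof.
move=> ab x0 g0; apply: derive_le0_ge => // t tab; first exact: lsol_cz.
exists (- g (x t)); last exact: lsol_dz.
rewrite oppr_le0; have := x0 _ tab; rewrite le_eqVlt => /predU1P[<-|/g_pos/ltW//].
by rewrite g0.
Qed.

Lemma lsol_x_lower c a : 0 < c -> (forall t, a <= t -> y t <= - c) -> exists2 t, a <= t & x t <= 0.
Proof.
move=> c0 yc; pose T := a + `|x a| / c.
have aT : a <= T by rewrite lerDl divr_ge0// ltW.
exists T => //.
have : x T + c * T <= x a + c * a.
  apply: (@derive_le0_ge _ (fun t => x t + c * t)) => // t tab.
    by apply: continuousD; [exact: lsol_cx|apply: continuousM; [exact: cvg_cst|exact: cvg_id]].
  exists (y t + c); first by have := yc t; move: tab => /andP[/ltW -> _ /(_ isT)]; lra.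
  apply: (is_derive_eq (is_deriveD1 (lsol_dx t) (is_deriveM1 (is_deriveC1 c t) (is_derive_id1 t)))).
  by ring.
rewrite /T mulrDr mulrCA divff ?gt_eqF// mulr1.
have := ler_norm (x a); lra.
Qed.

(** On the compact interval [[l, u]] the force [g] has a positive lower bound, so [z] falls at least
    linearly while [F (x t)] stays bounded. *)
Lemma lsol_y_unbounded a (l u : R) : 0 < l -> (forall t, a <= t -> l <= x t <= u) ->
  forall M : R, exists2 b, a <= b & forall t, b <= t -> y t <= M.
Proof.
move=> l0 xlu M.
have [|c c0 Hc] := @continuous_pos_bounded _ g l u (fun v _ => @cg v).
  by move=> v /andP[lv _]; apply: g_pos; exact: lt_le_trans lv.
have [M' M'0 HM'] := @continuous_bounded _ F l u (fun v _ => @lienard_cts v).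
pose b := a + `|z a + M' - M| / c.
have ab : a <= b by rewrite lerDl divr_ge0// ltW.
exists b => // t bt; have at_ : a <= t := le_trans ab bt.
have : z t + c * t <= z a + c * a.
  apply: (@derive_le0_ge _ (fun t => z t + c * t)) => // s sab.
    by apply: continuousD; [exact: lsol_cz|apply: continuousM; [exact: cvg_cst|exact: cvg_id]].
  exists (- g (x s) + c).
    by rewrite addrC subr_le0 Hc// xlu// ltW//; case/andP: sab.
  apply: (is_derive_eq (is_deriveD1 (lsol_dz s) (is_deriveM1 (is_deriveC1 c s) (is_derive_id1 s)))).
  by ring.
have := HM' _ (xlu _ at_); rewrite ler_norml => /andP[h1 _].
have h2 : c * b <= c * t by rewrite ler_wpM2l// ltW.
move: h2; rewrite /b mulrDr mulrCA divff ?gt_eqF// mulr1.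
rewrite /y; have := ler_norm (z a + M' - M); lra.
Qed.

Section Focus.
Variables (n k : nat) (A B dl l u : R).
Hypothesis coer : forall v, dl * (1 + v ^+ 2) <= n.+1%:R * v ^+ 2 - B * `|v| + A.
Hypothesis kdl : 1 <= 2 * k%:R * dl.

Hypothesis bnd : forall v, l <= v <= u -> 0 < v ->
  `|f v| <= B * v ^+ n /\ A * v ^+ (2 * n + 1) <= g v.
Let v t := y t / x t ^+ n.+1.

(* In the quasi-polar coordinates (x, v) of the comparison system,
   x dv/dx <= - dl (1 + v^2) / v along the flow when v > 0 (and the reverse
   inequality when v < 0), so (1 + v^2)^k x is monotone as long as y keeps its sign. *)
Definition focus_energy t := (1 + v t ^+ 2) ^+ k * x t.

(** The logarithmic derivative of the energy with respect to x is 2 k v v_x / (1 + v^2) + 1/x. The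
    first term is at most - 2 k dl / x by [coer], hence at most - 1/x by [kdl]. Stating the sign of
    [d * y t] covers both signs of y, that is both directions in which x moves. *)
Lemma focus_energy_der t : 0 < x t -> l <= x t <= u ->
  exists2 d, d * y t <= 0 & is_derive t (1 : R) focus_energy d.
Proof.
move=> x0 xlu; have [fB gA] := bnd xlu x0.
have xn0 : 0 < x t ^+ n by rewrite exprn_gt0.
pose w := (- g (x t) - f (x t) * y t) / x t ^+ n.+1 - n.+1%:R * v t ^+ 2 * x t ^+ n.
have dv : is_derive t (1 : R) v w.
  have dI := @is_deriveV R (fun s => x s ^+ n.+1) t _ 1 _ (is_deriveX1 n.+1 (lsol_dx t)).
  have xN : x t ^+ n.+1 != 0 by rewrite expf_neq0// gt_eqF.
  apply: (is_derive_eq (is_deriveM1 (lsol_dy t) (dI xN))).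
  rewrite /w /v /GRing.scale /= (exprS _ n); move: (x t ^+ n) xn0 => q q0; move: (x t) x0 => p p0.
  by field; rewrite (gt_eqF q0) (gt_eqF p0).
have w_le : dl * (1 + v t ^+ 2) * x t ^+ n <= - w.
  have vE : y t = v t * x t ^+ n.+1 by rewrite /v divfK// expf_neq0// gt_eqF.
  have fy : - (f (x t) * y t) <= B * `|v t| * x t ^+ (2 * n + 1).
    rewrite -mulNr (le_trans (ler_norm _))// normrM normrN vE normrM [`|_ ^+ _|]gtr0_norm ?exprn_gt0//.
    have -> : B * `|v t| * x t ^+ (2 * n + 1) = B * x t ^+ n * (`|v t| * x t ^+ n.+1).
      by rewrite expr_2n1; ring.
    by rewrite ler_wpM2r// mulr_ge0// exprn_ge0// ltW.
  have : (A - B * `|v t|) * x t ^+ (2 * n + 1) <= g (x t) + f (x t) * y t.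
    by rewrite mulrBl; lra.
  rewrite expr_2n1.
  rewrite mulrA -ler_pdivlMr ?exprn_gt0// => H1.
  have := ler_wpM2r (ltW xn0) (coer (v t)).
  rewrite /w -opprD mulNr; lra.
exists ((1 + v t ^+ 2) ^+ k.-1 * (2 * k%:R * v t * w * x t + (1 + v t ^+ 2) * y t)).
  have vE : y t = v t * x t * x t ^+ n by rewrite -mulrA -exprS /v divfK// expf_neq0// gt_eqF.
  have v1 : 0 < 1 + v t ^+ 2 by rewrite ltr_wpDr// sqr_ge0.
  rewrite -mulrA pmulr_rle0 ?exprn_gt0//.
  have -> : (2 * k%:R * v t * w * x t + (1 + v t ^+ 2) * y t) * y t =
    (v t * x t) ^+ 2 * x t ^+ n * (2 * k%:R * w + (1 + v t ^+ 2) * x t ^+ n).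
    by rewrite vE; ring.
  apply: mulr_ge0_le0; first by apply: mulr_ge0; [exact: sqr_ge0|exact: ltW].
  have k2 : 0 <= 2 * k%:R :> R by rewrite mulr_ge0.
  have := ler_wpM2l k2 w_le.
  have := ler_wpM2r (ltW (mulr_gt0 v1 xn0)) kdl; lra.
have k0 : (0 < k)%N by rewrite lt0n; apply: contraTneq kdl => ->; rewrite mulr0 mul0r -ltNge.
apply: (is_derive_eq (is_deriveM1 (is_deriveX1 k (is_deriveD1 (is_deriveC1 1 t) (is_deriveX1 2 dv))) (lsol_dx t))).
have -> : (1 + v t ^+ 2) ^+ k = (1 + v t ^+ 2) * (1 + v t ^+ 2) ^+ k.-1 by rewrite -exprS prednK.
by rewrite /=; ring.
Qed.

Lemma focus_energy_nincr a b : a <= b -> (forall t, a <= t <= b -> 0 < x t /\ l <= x t <= u) ->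
  (forall t, a < t < b -> 0 < y t) -> focus_energy b <= focus_energy a.
Proof.
move=> ab xlu yp; apply: derive_le0_ge => // t tab.
  by have [x0 lu] := xlu t tab; have [d _ /is_derive_cts] := focus_energy_der x0 lu.
have tab' : a <= t <= b by case/andP: tab => /ltW-> /ltW->.
have [x0 lu] := xlu t tab'; have [d dy dE] := focus_energy_der x0 lu.
by exists d => //; move: dy; rewrite pmulr_lle0// yp.
Qed.

Lemma focus_energy_ndecr a b : a <= b -> (forall t, a <= t <= b -> 0 < x t /\ l <= x t <= u) ->
  (forall t, a < t < b -> y t < 0) -> focus_energy a <= focus_energy b.
Proof.
move=> ab xlu yp; apply: derive_ge0_le => // t tab.
  by have [x0 lu] := xlu t tab; have [d _ /is_derive_cts] := focus_energy_der x0 lu.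
have tab' : a <= t <= b by case/andP: tab => /ltW-> /ltW->.
have [x0 lu] := xlu t tab'; have [d dy dE] := focus_energy_der x0 lu.
by exists d => //; move: dy; rewrite nmulr_lle0// yp.
Qed.

End Focus.

Lemma lsol_x_ge a b : a <= b -> (forall t, a < t < b -> 0 <= y t) -> x a <= x b.
Proof.
move=> ab yp; apply: derive_ge0_le => // t tab; first exact: lsol_cx.
by exists (y t); [exact: yp|exact: lsol_dx].
Qed.

Lemma lsol_x_gt a b : a < b -> (forall t, a < t < b -> 0 < y t) -> x a < x b.
Proof.
move=> ab yp; apply: derive_gt0_lt => // t tab; first exact: lsol_cx.
by exists (y t); [exact: yp|exact: lsol_dx].
Qed.

Lemma lsol_x_le a b : a <= b -> (forall t, a < t < b -> y t <= 0) -> x b <= x a.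
Proof.
move=> ab yp; apply: derive_le0_ge => // t tab; first exact: lsol_cx.
by exists (y t); [exact: yp|exact: lsol_dx].
Qed.

Lemma lsol_x_lt a b : a < b -> (forall t, a < t < b -> y t < 0) -> x b < x a.
Proof.
move=> ab yp; apply: derive_lt0_gt => // t tab; first exact: lsol_cx.
by exists (y t); [exact: yp|exact: lsol_dx].
Qed.

(** Since [z] does not increase, y is at most [Y1] when the abscissa [x1] is crossed. This bounds
    the energy there, and from then on the energy does not increase and is at least x. Hence x
    cannot exceed the left-hand side of the last hypothesis. *)
Lemma ascending_arc (n k : nat) (A B dl x1 K Y1 : R) :
  (forall v, dl * (1 + v ^+ 2) <= n.+1%:R * v ^+ 2 - B * `|v| + A) ->
  1 <= 2 * k%:R * dl ->
  (forall v, x1 <= v <= K -> 0 < v -> `|f v| <= B * v ^+ n /\ A * v ^+ (2 * n + 1) <= g v) ->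
  g 0 = 0 -> 0 < x1 -> 0 <= x 0 <= x1 -> 0 < y 0 -> z 0 - F x1 <= Y1 ->
  (1 + (Y1 / x1 ^+ n.+1) ^+ 2) ^+ k * x1 < K ->
  exists T, [/\ 0 < T, y T = 0, x 0 < x T < K & forall t, 0 <= t < T -> 0 < y t].
Proof.
move=> coer kdl bnd g0 x10 /andP[x00 x01] y0 Y1P.
set Xm := _ * x1 => XmK.
have x1Xm : x1 <= Xm.
  by rewrite ler_peMl ?(ltW x10)// exprn_ege1// lerDl sqr_ge0.
have bound t : 0 <= t -> (forall s, 0 <= s <= t -> 0 < y s) -> x t <= Xm.
  move=> t0 yp; rewrite leNgt; apply/negP => Xmx.
  have mono s1 s2 : 0 <= s1 -> s1 <= s2 -> s2 <= t -> x s1 <= x s2.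
    move=> h1 h2 h3; apply: lsol_x_ge => // s /andP[s_1 s_2]; apply/ltW/yp.
    by rewrite (le_trans h1 (ltW s_1)) (le_trans (ltW s_2)).
  (* The estimates on [f] and [g] hold only up to [K], so the energy is evaluated at an abscissa
     between [Xm] and [K] that has been crossed by time [t]. *)
  pose X2 := Num.min (x t) ((Xm + K) / 2).
  have X2P : Xm < X2 by rewrite lt_min Xmx; lra.
  have X2K : X2 < K by rewrite gt_min; apply/orP; right; lra.
  have X2t : X2 <= x t by rewrite ge_min lexx.
  have cx : continuous x by move=> s; exact: lsol_cx.
  have x0X2 : x 0 <= X2 by rewrite (le_trans x01)// (le_trans x1Xm)// ltW.
  have [|t2 /andP[t20 t2t] t2E] := @ivt_le x 0 t X2 t0 cx; first by rewrite x0X2.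
  have [|t1 /andP[t10 t1t2] t1E] := @ivt_le x 0 t2 x1 t20 cx.
    by rewrite x01 t2E (le_trans x1Xm)// ltW.
  have : focus_energy n k t2 <= focus_energy n k t1.
    apply: (focus_energy_nincr coer kdl bnd) => //.
      move=> s /andP[s1 s2]; have h1 : x1 <= x s.
        by rewrite -t1E mono//; exact: le_trans t2t.
      split; first exact: lt_le_trans h1.
      by rewrite h1 (le_trans _ (ltW X2K))// -t2E mono// (le_trans t10).
    move=> s /andP[s1 s2]; apply: yp.
    by rewrite (le_trans t10 (ltW s1)) (le_trans (ltW s2)).
  apply/negP; rewrite -ltNge /focus_energy t1E t2E.
  apply: (@le_lt_trans _ _ Xm); last first.
    by rewrite (lt_le_trans X2P)// ler_peMl ?exprn_ege1 ?lerDl ?sqr_ge0// ltW// (lt_trans _ X2P)// (lt_le_trans x10).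
  have y1 : 0 < y t1 by apply: yp; rewrite t10 (le_trans t1t2).
  have yY : y t1 <= Y1.
    apply: le_trans Y1P; rewrite /y t1E lerD2r; apply: lsol_z_le => // s /andP[s1 s2].
    apply: (le_trans x00); apply: mono => //; first exact: ltW.
    exact: (le_trans (ltW s2) (le_trans t1t2 t2t)).
  rewrite /Xm ler_wpM2r ?(ltW x10)// lerXn2r ?nnegrE ?addr_ge0 ?sqr_ge0// lerD2l.
  rewrite ler_sqr ?nnegrE ?divr_ge0 ?exprn_ge0 ?(ltW x10) ?(ltW y1)//; last exact: le_trans (ltW y1) yY.
  by rewrite ler_wpM2r// invr_ge0 exprn_ge0// ltW.
(* If y stayed positive, x would remain in [[x 1, Xm]] from time 1 on and [lsol_y_unbounded] would
   push y down to 0. Time 1 is used because [x 0] may be 0. *)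
have [t t0 yt] : exists2 t, 0 <= t & y t <= 0.
  apply: contrapT => H.
  have yp t : 0 <= t -> 0 < y t.
    by move=> t0; rewrite ltNge; apply/negP => yt; apply: H; exists t.
  have x1_0 : 0 < x 1.
    by apply: (le_lt_trans x00); apply: lsol_x_gt => // s /andP[/ltW/yp].
  have [|b b1 /(_ b (lexx b))] := @lsol_y_unbounded 1 (x 1) Xm x1_0 _ 0.
    move=> s s1; have s0 : 0 <= s by exact: le_trans s1.
    rewrite bound// ?andbT => [|r /andP[/yp//]].
    by apply: lsol_x_ge => // r /andP[r1 _]; apply/ltW/yp; rewrite (le_trans _ (ltW r1)).
  by rewrite leNgt yp// (le_trans _ b1).
have [T /andP[T0 Tt] [yT yp]] := first_zero t0 (fun s _ => @lsol_cy s) y0 yt.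
exists T; split=> //; apply/andP; split.
  by apply: lsol_x_gt => // s /andP[s0 sT]; apply: yp; rewrite sT ltW.
apply: le_lt_trans XmK; rewrite leNgt; apply/negP => XmT.
have [e e0 He] := continuous_gt (@lsol_cx T) XmT.
pose s := Num.max 0 (T - e / 2).
have s0 : 0 <= s by rewrite le_max lexx.
have sT : s < T by rewrite gt_max T0 /= ltrBlDr ltrDl divr_gt0.
have := bound s s0; rewrite leNgt He; last first.
  rewrite ltr0_norm ?subr_lt0// opprB ltrBlDl -ltrBlDr.
  by rewrite lt_max; apply/orP; right; rewrite ltrD2l ltrN2 ltr_pdivrMr// ltr_pMr// ltr1n.
move=> H; suff : false by []; apply: H => r /andP[r0 rs].
by apply: yp; rewrite r0 (le_lt_trans rs).
Qed.

Lemma descending_y_neg b : 0 < x 0 -> y 0 = 0 -> (forall t, 0 <= t <= b -> 0 < x t) ->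
  forall t, 0 < t <= b -> y t < 0.
Proof.
move=> x0 y0 xp; apply: barrier => [|t _|t tb _ yt]; [by rewrite y0|exact: lsol_cy|].
exists (- g (x t)); first by rewrite oppr_lt0 g_pos// xp.
by apply: (is_derive_eq (lsol_dy t)); rewrite yt mulr0 subr0.
Qed.

(** At [T] the inequality on y is weak, since the arc might end at the origin. Uniqueness, or the
    definition of a periodic solution, excludes this where the lemma is applied. *)
Lemma descending_arc : 0 < x 0 -> y 0 = 0 -> (exists2 t, 0 <= t & x t <= 0) ->
  exists T, [/\ 0 < T, x T = 0, y T <= 0, forall t, 0 <= t < T -> 0 < x t &
   forall t, 0 < t < T -> y t < 0].
Proof.
move=> x0 y0 [t t0 xt].
have [T /andP[T0 Tt] [xT xp]] := first_zero t0 (fun s _ => @lsol_cx s) x0 xt.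
have yn s : 0 < s < T -> y s < 0.
  move=> /andP[s0 sT]; apply: (@descending_y_neg s) => //; last by rewrite s0 lexx.
  by move=> r /andP[r0 rs]; apply: xp; rewrite r0 (le_lt_trans rs).
exists T; split=> //.
rewrite leNgt; apply/negP => yT.
have [e e0 He] := continuous_gt (@lsol_cy T) yT.
pose s := Num.max (T / 2) (T - e / 2).
have sT : s < T by rewrite gt_max ltrBlDr ltrDl divr_gt0// andbT; lra.
have s0 : 0 < s by rewrite lt_max divr_gt0.
have : y s < 0 by apply: yn; rewrite s0.
apply/negP; rewrite -leNgt ltW// He//.
rewrite ltr0_norm ?subr_lt0// opprB ltrBlDl -ltrBlDr.
by rewrite lt_max; apply/orP; right; rewrite ltrD2l ltrN2 ltr_pdivrMr// ltr_pMr// ltr1n.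
Qed.

(** Suppose x stays positive. It gets arbitrarily small, since otherwise y would tend to minus
    infinity. The energy (1 + v^2)^k x does not decrease while y < 0, so |v| becomes large as x
    becomes small; from such a time on y stays below a negative constant, and x reaches 0 after
    all. *)
Lemma focus_descends (n : nat) : focus_near0 f g n -> F 0 = 0 -> g 0 = 0 ->
  0 < x 0 -> y 0 = 0 -> exists2 t, 0 <= t & x t <= 0.
Proof.
move=> [A [B [x1 [x10 AB bnd]]]] F0 g0 x0 y0; apply: contrapT => H.
have xp t : 0 <= t -> 0 < x t.
  by move=> t0; rewrite ltNge; apply/negP => xt; apply: H; exists t.
have yn t : 0 < t -> y t < 0.
  move=> t0; apply: (@descending_y_neg t) => //; last by rewrite t0 lexx.
  by move=> s /andP[/xp].
have mono s t : 0 <= s -> s <= t -> x t <= x s.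
  move=> s0 st; apply: lsol_x_le => // r /andP[sr _].
  by apply/ltW/yn; exact: le_lt_trans sr.
have small e : 0 < e -> exists2 t, 0 < t & x t <= e.
  move=> e0; apply: contrapT => He.
  have xe t : 0 < t -> e < x t.
    by move=> t0; rewrite ltNge; apply/negP => xt; apply: He; exists t.
  have [|b b1 Hb] := @lsol_y_unbounded 1 e (x 0) e0 _ (- 1).
    move=> t t1; have t0 : 0 < t by exact: lt_le_trans t1.
    by rewrite (ltW (xe _ t0)) mono// ltW.
  have [t bt xt] := lsol_x_lower ltr01 Hb.
  by apply: H; exists t => //; rewrite (le_trans _ bt)// (le_trans _ b1).
have [dl dl0 coer] := quadratic_coercive (ltr0Sn R n) AB.
pose k := (Num.bound (1 / (2 * dl))).
have kdl : 1 <= 2 * k%:R * dl.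
  have := archi_boundP (_ : 0 <= 1 / (2 * dl)); rewrite divr_ge0 ?mulr_ge0 ?(ltW dl0)// => /(_ isT).
  rewrite ltr_pdivrMr ?mulr_gt0// -/k => h; rewrite ltW//; lra.
have bnd' v : 0 <= v <= x1 -> 0 < v -> `|f v| <= B * v ^+ n /\ A * v ^+ (2 * n + 1) <= g v.
  by move=> /andP[_ v1] v0; apply: bnd; rewrite v0.
have B0 : 0 <= B.
  have [|h _] := bnd x1; first by rewrite x10 lexx.
  by have := le_trans (normr_ge0 _) h; rewrite pmulr_lge0 ?exprn_gt0.
have FB v : 0 <= v <= x1 -> `|F v| <= B * v ^+ n.+1.
  move=> /andP[v0 v1].
  have dB u : is_derive u (1 : R) (fun u => B * u ^+ n.+1) (n.+1%:R * (B * u ^+ n)).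
    apply: (is_derive_eq (is_deriveM1 (is_deriveC1 B u) (is_deriveX1 n.+1 (is_derive_id1 u)))).
    by rewrite /=; ring.
  have df u : 0 < u < v -> `|f u| <= n.+1%:R * (B * u ^+ n).
    move=> /andP[u0 uv]; have [|h _] := bnd u; first by rewrite u0 (le_trans (ltW uv)).
    by rewrite (le_trans h)// ler_peMl ?ler1n// mulr_ge0// exprn_ge0// ltW.
  rewrite ler_norml; apply/andP; split.
  - suff : B * 0 ^+ n.+1 + F 0 <= B * v ^+ n.+1 + F v by rewrite expr0n F0 mulr0; lra.
    apply: (@derive_ge0_le _ (fun u => B * u ^+ n.+1 + F u)) => // u uv.
      exact: is_derive_cts (is_deriveD1 (dB u) (dF u)).
    exists (n.+1%:R * (B * u ^+ n) + f u); last exact: is_deriveD1.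
    by have := df u uv; rewrite ler_norml; lra.
  - suff : B * 0 ^+ n.+1 - F 0 <= B * v ^+ n.+1 - F v by rewrite expr0n F0 mulr0; lra.
    apply: (@derive_ge0_le _ (fun u => B * u ^+ n.+1 - F u)) => // u uv.
      exact: is_derive_cts (is_deriveB1 (dB u) (dF u)).
    exists (n.+1%:R * (B * u ^+ n) - f u); last exact: is_deriveB1.
    by have := df u uv; rewrite ler_norml; lra.
have [t1 t10 xt1] := small x1 x10.
have xt1_0 := xp _ (ltW t10).
(* As |F| <= B x^(n+1) here, the two values of [F] in y(t) <= y(t2) + F(x(t2)) - F(x(t)) cost at
   most 2B x(t2)^(n+1). The remaining 1 in [N0] keeps y away from 0. *)
pose E1 := focus_energy n k t1; pose N0 := 2 * B + 1.
have E10 : 0 < E1 by rewrite mulr_gt0// exprn_gt0// ltr_wpDr// sqr_ge0.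
have P0 : 0 < 2 * (1 + N0 ^+ 2) ^+ k by rewrite mulr_gt0// exprn_gt0// ltr_wpDr// sqr_ge0.
have [|t2' t20' xt2'] := small (Num.min (x t1) (E1 / (2 * (1 + N0 ^+ 2) ^+ k))).
  by rewrite lt_min xt1_0 divr_gt0.
pose t2 := Num.max t1 t2'.
have t12 : t1 <= t2 by rewrite le_max lexx.
have t20 : 0 < t2 := lt_le_trans t10 t12.
have xt2 : x t2 <= E1 / (2 * (1 + N0 ^+ 2) ^+ k).
  apply: (@le_trans _ _ (x t2')); first by rewrite mono ?(ltW t20')// le_max lexx orbT.
  by apply: (le_trans xt2'); rewrite ge_min lexx orbT.
have E12 : E1 <= focus_energy n k t2.
  apply: (focus_energy_ndecr coer kdl bnd') => // t /andP[t1t tt2].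
    have t0 : 0 <= t by rewrite (le_trans _ t1t)// ltW.
    by rewrite xp// ltW ?xp//= (le_trans _ xt1)// mono// ltW.
  by apply: yn; exact: lt_trans t1t.
have xt2_0 := xp _ (ltW t20); have yt2 := yn _ t20.
have X0 : 0 < x t2 ^+ n.+1 by rewrite exprn_gt0.
have v2N : N0 * x t2 ^+ n.+1 <= - y t2.
  rewrite -ler_pdivlMr// mulNr leNgt; apply/negP => vN.
  have : focus_energy n k t2 <= E1 / 2.
    apply: (@le_trans _ _ ((1 + N0 ^+ 2) ^+ k * (E1 / (2 * (1 + N0 ^+ 2) ^+ k)))).
      rewrite /focus_energy ler_pM ?(ltW xt2_0) ?exprn_ge0 ?addr_ge0 ?sqr_ge0//.
      rewrite lerXn2r ?nnegrE ?addr_ge0 ?sqr_ge0// lerD2l.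
      rewrite -[leLHS]sqrrN ler_sqr ?nnegrE ?(ltW vN)//; last by rewrite /N0; lra.
      by rewrite -mulNr divr_ge0// ?(ltW X0)// oppr_ge0 ltW.
    move: P0; move: (_ ^+ k) => q q0; have q1 : q != 0 by apply: contraTneq q0 => ->; rewrite mulr0 ltxx.
    by rewrite le_eqVlt; apply/orP; left; apply/eqP; field.
  by move: E12 E10; lra.
have [|t tt2 xt] := @lsol_x_lower (x t2 ^+ n.+1) t2 X0; last first.
  by apply: H; exists t => //; rewrite (le_trans (ltW t20)).
move=> t t2t.
have h1 : z t <= z t2.
  by apply: lsol_z_le => // s /andP[ts _]; apply/ltW/xp; rewrite (le_trans (ltW t20)) ?ltW.
have x12 : x t2 <= x1 by rewrite (le_trans _ xt1)// mono// ltW.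
have xt2t : x t <= x t2 by rewrite mono// ltW.
have xt0 : 0 < x t by rewrite xp// (le_trans (ltW t20)).
have h2 : `|F (x t2)| <= B * x t2 ^+ n.+1 by apply: FB; rewrite x12 ltW.
have h3 : `|F (x t)| <= B * x t2 ^+ n.+1.
  apply: (@le_trans _ _ (B * x t ^+ n.+1)).
    by apply: FB; rewrite (ltW xt0) (le_trans xt2t).
  by rewrite ler_wpM2l// lerXn2r ?nnegrE ?(ltW xt0) ?(ltW xt2_0).
move: h2 h3 v2N; rewrite /N0 /y !ler_norml; lra.
Qed.

End Solution.
End LienardArcs.

(** * Ovals *)

Section Ovals.
Variable R : realType.
Implicit Types (F f g x z : R -> R) (t s c d e K u v : R).

(* The arc of a solution on [-T2, T1] in the half plane x >= 0: it rises from the y-axis to (xs, 0),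
   where it is at time 0, and comes down to the y-axis again; z - F x is the ordinate y. *)
Record oval F x z (xs T1 T2 : R) : Prop := Oval {
  oval_T1 : 0 < T1;
  oval_T2 : 0 < T2;
  oval_x0 : x 0 = xs;
  oval_z0 : z 0 = F xs;
  oval_xT1 : x T1 = 0;
  oval_xT2 : x (- T2) = 0;
  oval_xpos : forall t, - T2 < t < T1 -> 0 < x t;
  oval_yneg : forall t, 0 < t <= T1 -> z t - F (x t) < 0;
  oval_ypos : forall t, - T2 <= t < 0 -> 0 < z t - F (x t) }.

Lemma even_primitive F f : (forall u, is_derive u (1 : R) F (f u)) ->
  odd_function f -> forall u, F (- u) = F u.
Proof.
move=> dF fo.
suff H u : 0 <= u -> F (- u) = F u.
  move=> u; have [u0|u0] := leP 0 u; first exact: H.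
  by rewrite -(H (- u)) ?opprK// oppr_ge0 ltW.
move=> u0; have D s : is_derive s (1 : R) (fun s => F s - F (- s)) 0.
  apply: (is_derive_eq (is_deriveB1 (dF s) (is_derive_oppr_arg (dF (- s))))).
  by rewrite fo !opprK subrr.
have := @derive0_cst _ (fun s => F s - F (- s)) 0 u u0 (fun s _ => D s).
by rewrite oppr0 subrr => /esym/eqP; rewrite subr_eq0 => /eqP.
Qed.

Lemma lsol_not_origin F g x z : locally_lipschitz F -> locally_lipschitz g ->
  F 0 = 0 -> g 0 = 0 -> lsol F g x z -> ~ (x 0 = 0 /\ z 0 = 0) ->
  forall t, ~ (x t = 0 /\ z t = 0).
Proof.
move=> lF lg F0 g0 S N t [xt zt]; apply: N.
have C : lsol F g (fun _ => 0) (fun _ => 0).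
  by move=> s; rewrite F0 g0 subr0 oppr0; split; exact: is_deriveC1.
have := @lsol_unique _ F g x z (fun _ => 0) (fun _ => 0) t lF lg S C xt zt 0.
by [].
Qed.

Lemma oval_of_descents F f g x z : (forall u, is_derive u (1 : R) F (f u)) ->
  continuous g -> (forall u, 0 < u -> 0 < g u) -> F 0 = 0 ->
  lsol F g x z -> 0 < x 0 -> z 0 = F (x 0) ->
  (forall t, ~ (x t = 0 /\ z t = 0)) ->
  (exists2 t, 0 <= t & x t <= 0) -> (exists2 t, 0 <= t & x (- t) <= 0) ->
  exists T1 T2, oval F x z (x 0) T1 T2.
Proof.
move=> dF cg gpos F0 S x0 z0 N h1 h2.
have y0 : z 0 - F (x 0) = 0 by rewrite z0 subrr.
have [T1 [T10 xT1 yT1 xp1 yn1]] := descending_arc dF gpos S x0 y0 h1.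
have dFN u : is_derive u (1 : R) (fun u => - F u) (- f u) by exact: is_deriveN1.
have S' := lsol_reverse S.
have x0' : 0 < x (- 0) by rewrite oppr0.
have y0' : - z (- 0) - - F (x (- 0)) = 0 by rewrite oppr0 opprK z0 addNr.
have [T2 [T20 xT2 yT2 xp2 yn2]] := descending_arc dFN gpos S' x0' y0' h2.
exists T1, T2; split=> // t /andP[].
- move=> t1 t2; have [t0|t0] := leP 0 t; first by apply: xp1; rewrite t0.
  by rewrite -(opprK t); apply: xp2; rewrite oppr_ge0 (ltW t0)/= ltrNl.
- move=> t0; rewrite le_eqVlt => /predU1P[->|tT]; last by apply: yn1; rewrite t0.
  rewrite lt_neqAle yT1 andbT xT1 F0 subr0; apply/negP => /eqP zT.
  by apply: (N T1).
- rewrite le_eqVlt => /predU1P[<-|tT] t0.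
    rewrite xT2 F0 subr0; move: yT2; rewrite xT2 F0 oppr0 subr0 oppr_le0.
    rewrite le_eqVlt => /predU1P[zT|//]; exfalso; exact: (N (- T2)).
  have := yn2 (- t); rewrite oppr_gt0 t0 ltrNl tT => /(_ isT).
  by rewrite opprK; lra.
Qed.

(** * Closing an arc by reflection *)

Section Symmetric.
Variables (F g x z : R -> R) (xs T1 T2 : R).
Hypothesis lF : locally_lipschitz F.
Hypothesis lg : locally_lipschitz g.
Hypothesis Fev : forall u, F (- u) = F u.
Hypothesis god : odd_function g.
Hypothesis S : lsol F g x z.
Hypothesis O : oval F x z xs T1 T2.

(** The mirror image of the solution under (t, x) -> (2T - t, - x) is again a solution and agrees
    with it at [T], where x vanishes. The reflections about [T1] and [- T2] compose to the
    translation by [P], which is the period. *)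
Lemma lsol_reflect T : x T = 0 -> forall t, x (2 * T - t) = - x t /\ z (2 * T - t) = z t.
Proof.
move=> xT t.
have S' : lsol F g (fun t => - x (- t)) (fun t => z (- t)).
  move=> s; have [d1 d2] := lsol_mirror god S s.
  by split=> //; apply: (is_derive_eq d1); rewrite Fev.
have := @lsol_unique _ F g _ _ _ _ T lF lg S (lsol_shift (- (2 * T)) S').
have e : - (- (2 * T) + T) = T by ring.
rewrite e xT oppr0 => /(_ erefl erefl t)[-> ->].
by rewrite opprD !opprK.
Qed.

Let P := 2 * (T1 + T2).

Lemma oval_period t : x (t + P) = x t /\ z (t + P) = z t.
Proof.
have -> : t + P = 2 * T1 - (2 * - T2 - t) by rewrite /P; ring.
have [-> ->] := lsol_reflect (oval_xT1 O) (2 * - T2 - t).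
by have [-> ->] := lsol_reflect (oval_xT2 O) t; rewrite opprK.
Qed.

Lemma oval_period_gt0 : 0 < P.
Proof. by rewrite mulr_gt0// addr_gt0// (oval_T1 O, oval_T2 O). Qed.

(** Subtracting whole periods brings [t] into an interval of length [P] starting at [- T2]; what
    exceeds [T1] is folded back by the reflection about [T1]. *)
Lemma oval_range t : exists2 s, - T2 <= s <= T1 & (x t = x s \/ x t = - x s) /\ z t = z s.
Proof.
have P0 := oval_period_gt0.
have shiftn n s : x (s + n%:R * P) = x s /\ z (s + n%:R * P) = z s.
  elim: n => [|n IH]; first by rewrite mul0r addr0.
  have -> : s + n.+1%:R * P = (s + n%:R * P) + P by rewrite -natr1; ring.
  by have [-> ->] := oval_period (s + n%:R * P).
have shiftz k s : x (s + k%:~R * P) = x s /\ z (s + k%:~R * P) = z s.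
  case: k => n; first exact: shiftn.
  have [<- <-] := shiftn n.+1 (s + (Negz n)%:~R * P).
  by rewrite NegzE mulrNz; split; congr (_ _); ring.
pose k := Num.floor ((t + T2) / P).
pose s := t + (- k)%:~R * P.
have [xs_ zs_] := shiftz (- k) t.
have k1 : k%:~R * P <= t + T2 by rewrite -ler_pdivlMr// floor_le_tmp.
have k2 : t + T2 < (k + 1)%:~R * P by rewrite -ltr_pdivrMr// floorD1_gt.
have s1 : - T2 <= s by rewrite /s mulrNz; lra.
have s2 : s < - T2 + P by rewrite /s mulrNz; move: k2; rewrite intrD; lra.
rewrite -/s in xs_ zs_.
have [sT|Ts] := leP s T1.
  by exists s; [rewrite s1|rewrite -xs_ -zs_; split=> //; left].
exists (2 * T1 - s).
  by apply/andP; split; move: s2; rewrite /P; lra.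
have [-> ->] := lsol_reflect (oval_xT1 O) s.
by rewrite opprK xs_ zs_; split=> //; right.
Qed.

Lemma oval_arc_bound s : - T2 <= s <= T1 -> 0 <= x s <= xs.
Proof.
move=> /andP[s1 s2]; apply/andP; split.
  move: s1; rewrite le_eqVlt => /predU1P[<-|s1]; first by rewrite (oval_xT2 O).
  move: s2; rewrite le_eqVlt => /predU1P[->|s2]; first by rewrite (oval_xT1 O).
  by apply/ltW/(oval_xpos O); rewrite s1.
rewrite -(oval_x0 O); have [s0|s0] := leP 0 s.
  apply: (lsol_x_le S s0) => r /andP[r0 rs].
  by apply/ltW/(oval_yneg O); rewrite r0 (le_trans (ltW rs)).
apply: (lsol_x_ge S (ltW s0)) => r /andP[r0 rs].
by apply/ltW/(oval_ypos O); rewrite rs (le_trans s1 (ltW r0)).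
Qed.

Lemma oval_bound t : `|x t| <= xs.
Proof.
have [s /oval_arc_bound/andP[x0 xb] [[->|->] _]] := oval_range t.
  by rewrite ger0_norm.
by rewrite normrN ger0_norm.
Qed.

Lemma oval_not_origin t : F 0 = 0 -> ~ (x t = 0 /\ z t = 0).
Proof.
move=> F0 [xt zt]; have [s /andP[s1 s2] [hx hz]] := oval_range t.
have xs0 : x s = 0 by case: hx; rewrite xt => /esym/eqP; rewrite ?oppr_eq0 => /eqP.
have zs0 : z s = 0 by rewrite -hz.
have [s0|s0|s0] := ltgtP s 0.
- by have := oval_ypos O (t := s); rewrite s1 s0 zs0 xs0 F0 subr0 ltxx => /(_ isT).
- by have := oval_yneg O (t := s); rewrite s2 s0 zs0 xs0 F0 subr0 ltxx => /(_ isT).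
- have := oval_xpos O (t := s); rewrite xs0 ltxx s0 oppr_lt0 (oval_T2 O) (oval_T1 O).
  by move=> /(_ isT).
Qed.

End Symmetric.

Lemma lipschitz_fun_local (C : R) F : 0 <= C -> lipschitz_fun C F -> locally_lipschitz F.
Proof. by move=> C0 CF K; exists C => // u v _ _; exact: CF. Qed.

(** Truncating the argument rather than the value keeps [f] and [g] odd and [g] positive on the
    right, hence keeps the reversible symmetry of the system. *)
Definition clamp K u := Num.max (- K) (Num.min u K).

Lemma clamp_id K u : - K <= u <= K -> clamp K u = u.
Proof. by move=> /andP[h1 h2]; rewrite /clamp (min_idPl h2) (max_idPr h1). Qed.

Lemma clamp_in K u : 0 <= K -> - K <= clamp K u <= K.
Proof.
move=> K0; rewrite /clamp le_max lexx /= ge_max ge_min lexx orbT andbT; lra.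
Qed.

Lemma clampN K u : 0 <= K -> clamp K (- u) = - clamp K u.
Proof.
move=> K0; rewrite /clamp !maxEle !minEle.
by do !case: ifP => //; lra.
Qed.

Lemma clamp_lip K u v : 0 <= K -> `|clamp K u - clamp K v| <= `|u - v|.
Proof.
move=> K0.
suff H u' v' : u' <= v' -> `|clamp K v' - clamp K u'| <= `|v' - u'|.
  have [uv|vu] := leP u v; last by apply: H; exact: ltW.
  by rewrite distrC [`|u - v|]distrC; exact: H.
move=> uv; rewrite [leRHS]ger0_norm ?subr_ge0// ler_norml.
rewrite /clamp !maxEle !minEle.
by do !case: ifP => //; lra.
Qed.

Lemma clamp_gt0 K u : 0 < K -> 0 < u -> 0 < clamp K u.
Proof. by move=> K0 u0; rewrite /clamp lt_max lt_min u0 K0 orbT. Qed.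

(** * Ovals through given points, by truncation *)

Section Existence.
Variables (F f g : R -> R) (n s : nat).
Hypothesis dF : forall u, is_derive u (1 : R) F (f u).
Hypothesis cf : continuous f.
Hypothesis lg : locally_lipschitz g.
Hypothesis F0 : F 0 = 0.
Hypothesis god : odd_function g.
Hypothesis fod : odd_function f.
Hypothesis gpos : forall u, 0 < u -> 0 < g u.
Hypothesis foc0 : focus_near0 f g s.
Hypothesis focoo : focus_nearoo f g n.

Let g0 : g 0 = 0.
Proof. by have := god 0; rewrite oppr0; lra. Qed.

Lemma oval_through_upper (x0 y0 : R) : 0 <= x0 -> 0 <= y0 -> ~ (x0 = 0 /\ y0 = 0) ->
  exists x z xs T1 T2 t0, [/\ lsol F g x z, oval F x z xs T1 T2, x t0 = x0 & z t0 = y0 + F x0].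
Proof.
move=> x00 y00 N.
have [A [B [x1 [x10 AB bnd]]]] := focoo.
have [dl dl0 coer] := quadratic_coercive (ltr0Sn R n) AB.
have [k kdl] : exists k, 1 <= 2 * k%:R * dl.
  exists (Num.bound (1 / (2 * dl))).
  have := archi_boundP (_ : 0 <= 1 / (2 * dl)); rewrite divr_ge0 ?mulr_ge0 ?(ltW dl0)// => /(_ isT).
  rewrite ltr_pdivrMr ?mulr_gt0// => h; rewrite ltW//; lra.
(* [x1'] is beyond both [x0] and the threshold of the focus estimate. [Y1] bounds the ordinate at
   the crossing of [x1'] and [Xm] the amplitude. Both involve only the original data, so [K] is
   fixed before the truncation that it defines. *)
pose x1' := Num.max x1 (x0 + 1).
have x1'0 : 0 < x1' by rewrite lt_max x10.
have x0x1' : x0 < x1' by rewrite lt_max ltrDl ltr01 orbT.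
pose Y1 := y0 + F x0 - F x1'.
pose Xm := (1 + (Y1 / x1' ^+ n.+1) ^+ 2) ^+ k * x1'.
have x1Xm : x1' <= Xm.
  by rewrite ler_peMl ?(ltW x1'0)// exprn_ege1// lerDl sqr_ge0.
pose K := Xm + 1.
have XmK : Xm < K by rewrite ltrDl.
have K0 : 0 < K by lra.
pose fK u := f (clamp K u); pose gK u := g (clamp K u).
have cclamp : continuous (clamp K).
  have := @lipschitz_fun_continuous R 1 (clamp K) ler01; apply.
  by move=> u v; rewrite mul1r; apply: clamp_lip; exact: ltW.
have cfK : continuous fK.
  by move=> u; apply: continuous_comp; [exact: cclamp|exact: cf].
have [FK0 dFK] := primP cfK; set FK := prim fK in FK0 dFK.
have [M M0 HM] := @continuous_bounded R f (- K) K (fun t _ => @cf t).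
have LF : lipschitz_fun M FK.
  move=> u v; apply: (@bounded_derive_lipschitz _ FK fK (- (`|u| + `|v|)) (`|u| + `|v|)) => //.
  - by move=> w _; apply: HM; apply: clamp_in; exact: ltW.
  - by rewrite -ler_norml lerDl.
  - by rewrite -ler_norml lerDr.
have [L L0 HL] := lg K.
have Lg : lipschitz_fun L gK.
  move=> u v; apply: (@le_trans _ _ (L * `|clamp K u - clamp K v|)).
    by apply: HL; rewrite ler_norml clamp_in// ltW.
  by rewrite ler_wpM2l// clamp_lip// ltW.
have gKod : odd_function gK by move=> u; rewrite /gK clampN ?god// ltW.
have fKod : odd_function fK by move=> u; rewrite /fK clampN ?fod// ltW.
have FKE u : - K <= u <= K -> FK u = F u.
  have D v : - K <= v <= K -> is_derive v (1 : R) (fun v => FK v - F v) 0.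
    move=> vK; apply: (is_derive_eq (is_deriveB1 (dFK v) (dF v))).
    by rewrite /fK clamp_id// subrr.
  move=> /andP[u1 u2]; apply/eqP; rewrite -subr_eq0; apply/eqP.
  have E0 : FK 0 - F 0 = 0 by rewrite FK0 F0 subrr.
  rewrite -[RHS]E0; have [u0|u0] := leP 0 u.
    apply/esym/(@derive0_cst _ (fun v => FK v - F v)) => // v /andP[v0 vu].
    by apply: D; lra.
  apply: (@derive0_cst _ (fun v => FK v - F v)); first exact: ltW.
  by move=> v /andP[v0 vu]; apply: D; lra.
have gKpos u : 0 < u -> 0 < gK u by move=> u0; apply/gpos/clamp_gt0.
have gK0 : gK 0 = 0 by rewrite /gK clamp_id ?g0//; lra.
have cgK := lipschitz_fun_continuous L0 Lg.
have foc0K : focus_near0 fK gK s.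
  have [A' [B' [x1'' [h1 h2 h3]]]] := foc0.
  exists A', B', (Num.min x1'' K); split=> //; first by rewrite lt_min h1.
  move=> v /andP[v0]; rewrite le_min => /andP[v1 vK].
  by rewrite /fK /gK clamp_id; [apply: h3; rewrite v0|lra].
have LF' : lipschitz_fun (M + L) FK.
  by move=> u v; rewrite (le_trans (LF u v))// ler_wpM2r// lerDl.
have Lg' : lipschitz_fun (M + L) gK.
  by move=> u v; rewrite (le_trans (Lg u v))// ler_wpM2r// lerDr ltW.
have [x [z [S xx0 zz0]]] := lsol_exists x0 (y0 + F x0) (addr_ge0 (ltW M0) L0) LF' Lg'.
have lFK := lipschitz_fun_local (ltW M0) LF; have lgK := lipschitz_fun_local L0 Lg.
have x0K : - K <= x0 <= K by lra.
have [T yT xT] : exists2 T, z T - FK (x T) = 0 & 0 < x T < K.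
  move: y00; rewrite le_eqVlt => /predU1P[y0E|y00].
    exists 0; first by rewrite zz0 xx0 -y0E FKE// add0r subrr.
    rewrite xx0.
    apply/andP; split; last lra.
    by rewrite lt_neqAle x00 andbT; apply/negP => /eqP xE; apply: N.
  have [||||T [T0 yT /andP[xT1 xT2] yp]] :=
      ascending_arc dFK cgK gKpos S (Y1 := Y1) coer kdl _ gK0 x1'0 _ _ _ XmK.
  - move=> v /andP[v1 v2] v0; rewrite /fK /gK clamp_id; last lra.
    by apply: bnd; apply: le_trans v1; rewrite le_max lexx.
  - by rewrite xx0 x00 ltW.
  - by rewrite xx0 zz0 FKE// addrK.
  - by rewrite zz0 /Y1 FKE//; lra.
  exists T => //; rewrite xT2 andbT; apply: le_lt_trans xT1.
  by rewrite xx0.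
pose x' t := x (T + t); pose z' t := z (T + t).
have S' : lsol FK gK x' z' := lsol_shift T S.
have /andP[xT0 xTK] := xT.
have x'0 : 0 < x' 0 by rewrite /x' addr0.
have z'0 : z' 0 = FK (x' 0) by rewrite /x' /z' addr0; apply/eqP; rewrite -subr_eq0 yT.
have h1 : exists2 t, 0 <= t & x' t <= 0.
  by apply: (focus_descends dFK cgK gKpos S' foc0K FK0 gK0 x'0); rewrite z'0 subrr.
have h2 : exists2 t, 0 <= t & x' (- t) <= 0.
  have dFKN u : is_derive u (1 : R) (fun u => - FK u) (- fK u) by exact: is_deriveN1.
  apply: (focus_descends dFKN cgK gKpos (lsol_reverse S') (n := s)) => //.
  - have [A' [B' [x1'' [k1 k2 k3]]]] := foc0K.
    by exists A', B', x1''; split=> // v /k3; rewrite normrN.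
  - by rewrite FK0 oppr0.
  - by rewrite oppr0.
  - by rewrite oppr0 opprK z'0 addNr.
have NO : ~ (x' 0 = 0 /\ z' 0 = 0) by move=> [xE _]; move: x'0; rewrite xE ltxx.
have [T1 [T2 O]] := oval_of_descents dFK cgK gKpos FK0 S' x'0 z'0
  (lsol_not_origin lFK lgK FK0 gK0 S' NO) h1 h2.
(* The closed orbit stays within its turning abscissa, which is below [K]. On [[- K, K]] the
   truncated functions coincide with the original ones, so the original system is solved. *)
have bnd' t : - K <= x' t <= K.
  rewrite -ler_norml (le_trans (oval_bound lFK lgK (even_primitive dFK fKod) gKod S' O t))//.
  by rewrite /x' addr0 ltW.
exists x', z', (x' 0), T1, T2, (- T); split.
- move=> t; have [d1 d2] := S' t; rewrite -(FKE _ (bnd' t)).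
  by split=> //; move: d2; rewrite /gK clamp_id.
- have [q1 q2 q3 q4 q5 q6 q7 q8 q9] := O.
  split=> // [|t /q8|t /q9]; rewrite -FKE//.
- by rewrite /x' subrr xx0.
- by rewrite /z' subrr zz0.
Qed.

End Existence.

(** Time reversal carries the lower half plane to the upper one and exchanges [T1] and [T2]; a point
    with negative abscissa is the reflection of a point on a symmetric oval already found. *)
Theorem oval_through F f g (n s : nat) (x0 y0 : R) :
  (forall u, is_derive u (1 : R) F (f u)) -> continuous f -> locally_lipschitz g ->
  F 0 = 0 -> odd_function g -> odd_function f -> (forall u, 0 < u -> 0 < g u) ->
  focus_near0 f g s -> focus_nearoo f g n -> ~ (x0 = 0 /\ y0 = 0) ->
  exists x z xs T1 T2 t0, [/\ lsol F g x z, oval F x z xs T1 T2, x t0 = x0 & z t0 = y0 + F x0].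
Proof.
move=> dF cf lg F0 god fod gpos foc0 focoo.
have lF := C1_locally_lipschitz dF cf.
have right_half (v w : R) : 0 <= v -> ~ (v = 0 /\ w = 0) -> exists x z xs T1 T2 t0,
    [/\ lsol F g x z, oval F x z xs T1 T2, x t0 = v & z t0 = w + F v].
  move=> v0 N; have [w0|w0] := leP 0 w.
    exact: (oval_through_upper dF cf lg F0 god fod gpos foc0 focoo).
  have dFN u : is_derive u (1 : R) (fun u => - F u) (- f u) by exact: is_deriveN1.
  have [| | | | | | | x [z [xs [T1 [T2 [t0 [S O xt0 zt0]]]]]]] :=
    oval_through_upper dFN (n := n) (s := s) _ lg _ god _ gpos _ _ v0 (_ : 0 <= - w).
  - by move=> u; apply: continuousN; exact: cf.
  - by rewrite F0 oppr0.
  - by move=> u; rewrite fod.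
  - have [A' [B' [x1'' [k1 k2 k3]]]] := foc0.
    by exists A', B', x1''; split=> // u /k3; rewrite normrN.
  - have [A' [B' [x1'' [k1 k2 k3]]]] := focoo.
    by exists A', B', x1''; split=> // u /k3; rewrite normrN.
  - by rewrite oppr_ge0 ltW.
  - by move=> [v00 /eqP]; rewrite oppr_eq0 => /eqP w00; exact: N.
  have [q1 q2 q3 q4 q5 q6 q7 q8 q9] := O.
  exists (fun t => x (- t)), (fun t => - z (- t)), xs, T2, T1, (- t0); split.
  - move=> t; have [d1 d2] := lsol_reverse S t.
    by split=> //; apply: (is_derive_eq d1); rewrite opprK.
  - split=> //; rewrite ?oppr0 ?opprK ?q4 ?opprK//.
    + by move=> t t12; apply: q7; lra.
    + move=> t t12; have h : - T2 <= - t < 0 by lra.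
      by have := q9 _ h; lra.
    + move=> t t12; have h : 0 < - t <= T1 by lra.
      by have := q8 _ h; lra.
  - by rewrite opprK.
  - by rewrite opprK zt0 opprD !opprK.
move=> N; have [x00|x00] := leP 0 x0; first exact: right_half.
have [||x [z [xs [T1 [T2 [t0 [S O xt0 zt0]]]]]]] := right_half (- x0) y0.
- by rewrite oppr_ge0 ltW.
- by move=> [/eqP]; rewrite oppr_eq0 => /eqP h1 h2; exact: N.
exists x, z, xs, T1, T2, (2 * T1 - t0).
have [-> ->] := lsol_reflect lF lg (even_primitive dF fod) god S (oval_xT1 O) t0.
by split=> //; rewrite ?xt0 ?opprK// zt0 (even_primitive dF fod).
Qed.

End Ovals.

(** * Topology of the plane *)

Section Plane.
Variable R : realType.
Local Notation plane := 'rV[R]_2.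
Implicit Types (p q : plane) (x y z : R -> R) (t s c d e K u v a b : R).

Definition pt (u v : R) : plane := \row_(j < 2) if j == 0 then u else v.

Lemma pt0 u v : pt u v 0 0 = u. Proof. by rewrite mxE. Qed.
Lemma pt1 u v : pt u v 0 1 = v. Proof. by rewrite mxE. Qed.

Lemma ord2_cases (j : 'I_2) : j = 0 \/ j = 1.
Proof. by case: j => [[|[|//]] jlt]; [left|right]; apply/val_inj. Qed.

Lemma rV2_eq p q : p 0 0 = q 0 0 -> p 0 1 = q 0 1 -> p = q.
Proof.
by move=> e0 e1; apply/rowP => j; have [->|->] := ord2_cases j.
Qed.

Lemma pt_coord p : p = pt (p 0 0) (p 0 1).
Proof. by apply: rV2_eq; rewrite ?pt0 ?pt1. Qed.

Lemma pt_eq0 u v : (pt u v = 0) <-> (u = 0 /\ v = 0).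
Proof.
split=> [E|[-> ->]]; last by apply: rV2_eq; rewrite ?pt0 ?pt1 mxE.
by split; [rewrite -(pt0 u v)|rewrite -(pt1 u v)]; rewrite E mxE.
Qed.

Lemma rV2_le p a : `|p 0 0| <= a -> `|p 0 1| <= a -> `|p| <= a.
Proof.
move=> h0 h1; have a0 : 0 <= a := le_trans (normr_ge0 _) h0.
rewrite /Num.Def.normr/= mx_normrE bigmax_le// => -[i j] _ /=.
by rewrite (ord1 i); have [->|->] := ord2_cases j.
Qed.

Lemma is_derive_rV2 (u : R -> plane) t (d : plane) :
  is_derive t (1 : R) u d <->
  is_derive t (1 : R) (fun s => u s 0 0) (d 0 0) /\ is_derive t (1 : R) (fun s => u s 0 1) (d 0 1).
Proof.
split=> [[du dE]|[[d0 e0] [d1 e1]]].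
  have dij i j := (derivable_mxP u t 1).1 du i j.
  by split; apply: DeriveDef => //; rewrite -dE derive_mx// mxE.
have du : derivable u t 1.
  apply/derivable_mxP => i j; rewrite (ord1 i).
  by have [->|->] := ord2_cases j; [exact: d0|exact: d1].
apply: DeriveDef => //; rewrite derive_mx//.
by apply: rV2_eq; rewrite mxE.
Qed.

Lemma lienard_solutionP (F f g : R -> R) x z : (forall u, is_derive u (1 : R) F (f u)) ->
  lsol F g x z -> is_solution (lienard f g) (fun t => pt (x t) (z t - F (x t))).
Proof.
move=> dF S t; apply/is_derive_rV2; rewrite /lienard !mxE /=.
split.
  rewrite (_ : (fun s => _) = x); last by apply/funext => s; rewrite pt0.
  exact: (lsol_dx S t).
rewrite (_ : (fun s => _) = (fun s => z s - F (x s))); last by apply/funext => s; rewrite pt1.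
exact: (lsol_dy dF S t).
Qed.

Lemma solution_lienard (F f g : R -> R) (u : R -> plane) : (forall u, is_derive u (1 : R) F (f u)) ->
  is_solution (lienard f g) u -> lsol F g (fun t => u t 0 0) (fun t => u t 0 1 + F (u t 0 0)).
Proof.
move=> dF S t; have /is_derive_rV2[] := S t; rewrite /lienard !mxE /= => d0 d1.
split; first by rewrite addrK.
apply: (is_derive_eq (is_deriveD1 d1 (is_derive_comp1 (dF _) d0))).
by ring.
Qed.

Lemma coord_cts (j : 'I_2) : continuous (fun p : plane => p 0 j).
Proof. exact: coord_continuous. Qed.

Lemma connected_star (A : set plane) (c : plane) : A c ->
  (forall q t, A q -> 0 <= t <= 1 -> A (c + t *: (q - c))) -> connected A.
Proof.
move=> Ac Aseg.
have -> : A = \bigcup_(q in A) [set c + t *: (q - c) | t in `[0, 1]].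
  apply/seteqP; split=> [q Aq|q [r Ar [t /=]]].
    exists q => //; exists 1; first by rewrite /= in_itv /= ler01 lexx.
    by rewrite scale1r addrC subrK.
  by rewrite in_itv /= => t01 <-; exact: Aseg.
apply: bigcup_connected.
  exists c => q Aq; exists 0; first by rewrite /= in_itv /= lexx ler01.
  by rewrite scale0r addr0.
move=> q Aq; apply: connected_continuous_connected; first exact: segment_connected.
apply: continuous_subspaceT => t.
by apply: cvgD; [exact: cvg_cst|apply: cvgZr_tmp; exact: cvg_id].
Qed.

(** The punctured plane is a chain of four open half planes, each meeting the union of the preceding
    ones. *)
Lemma connected_punctured_plane : connected (~` [set (0 : plane)]).
Proof.
have half (j : 'I_2) (s : R) (c : plane) : 0 < s * c 0 j -> connected [set p : plane | 0 < s * p 0 j].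
  move=> cj; apply: (@connected_star _ c) => //= q t qj /andP[t0 t1].
  rewrite !mxE; have -> : s * (c 0 j + t * (q 0 j - c 0 j)) = (1 - t) * (s * c 0 j) + t * (s * q 0 j).
    by ring.
  move: t0; rewrite le_eqVlt => /predU1P[<-|t0]; first by rewrite subr0 mul1r mul0r addr0.
  apply: ltr_wpDl; last exact: mulr_gt0.
  by apply: mulr_ge0; [rewrite subr_ge0|exact: ltW].
have -> : ~` [set (0 : plane)] =
    (([set p : plane | 0 < 1 * p 0 0] `|` [set p : plane | 0 < 1 * p 0 1])
      `|` [set p : plane | 0 < -1 * p 0 0]) `|` [set p : plane | 0 < -1 * p 0 1].
  apply/seteqP; split=> p /=.
    move=> pN0; have [p0|p0|p0] := ltgtP (p 0 0) 0.
    - by left; right; rewrite mulN1r oppr_gt0.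
    - by left; left; left; rewrite mul1r.
    - have [p1|p1|p1] := ltgtP (p 0 1) 0.
      + by right; rewrite mulN1r oppr_gt0.
      + by left; left; right; rewrite mul1r.
      + by exfalso; apply: pN0; rewrite (pt_coord p) p0 p1; apply/pt_eq0.
  by move=> H E; move: H; rewrite E !mxE !mulr0 ltxx => -[[[]|]|].
have in0 (s u v : R) : 0 < s * u -> [set p : plane | 0 < s * p 0 0] (pt u v).
  by move=> su; rewrite /mkset pt0.
have in1 (s u v : R) : 0 < s * v -> [set p : plane | 0 < s * p 0 1] (pt u v).
  by move=> sv; rewrite /mkset pt1.
apply: connectedU; last 2 first.
- apply: connectedU; last 2 first.
  + apply: connectedU.
    * by exists (pt 1 1); split; [apply: in0|apply: in1]; lra.
    * by apply: (half 0 1 (pt 1 1)); rewrite pt0; lra.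
    * by apply: (half 1 1 (pt 1 1)); rewrite pt1; lra.
  + by apply: (half 0 (-1) (pt (-1) 1)); rewrite pt0; lra.
  + by exists (pt (-1) 1); split; [right; apply: in1|apply: in0]; lra.
- by apply: (half 1 (-1) (pt 1 (-1))); rewrite pt1; lra.
- by exists (pt 1 (-1)); split; [left; left; apply: in0|apply: in1]; lra.
Qed.

Lemma punctured_plane_boundary : boundary (~` [set (0 : plane)]) 0.
Proof.
split; last by apply: subset_closure; rewrite setCK.
move=> B /nbhs_ballP[e /= e0 eB].
exists (pt (e / 2) 0); split.
  by move=> /pt_eq0[/eqP]; rewrite gt_eqF// divr_gt0.
apply: eB; rewrite mx_norm_ball /ball_ /= sub0r normrN.
apply: (@le_lt_trans _ _ (e / 2)); last by rewrite ltr_pdivrMr// ltr_pMr// ltr1n.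
by apply: rV2_le; rewrite ?pt0 ?pt1 ?normr0 ?ger0_norm// divr_ge0// ltW.
Qed.

(** Maximality is automatic: orbits surrounding the origin avoid it, so no annular set exceeds the
    punctured plane. *)
Lemma global_center_of_orbits (X : plane -> plane) : X 0 = 0 ->
  (forall q, q <> 0 -> exists O, [/\ periodic_orbit X O, surrounds O 0 & O q]) ->
  global_center X 0.
Proof.
move=> X0 H.
have sub O : surrounds O 0 -> O `<=` ~` [set (0 : plane)].
  by move=> [NO _] q Oq q0; apply: NO; rewrite -q0.
split.
  split=> //; exists setT; first exact: filterT.
  move=> q [_ /= /H[C [pC sC Cq]]]; exists C; split=> //.
  by move=> r /(sub _ sC) r0; split.
split.
  split; [|exact: connected_punctured_plane|exact: punctured_plane_boundary].
  by move=> q /= /H[C [pC sC Cq]]; exists C; split=> //; exact: sub.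
move=> B [HB _ _] AB; apply/seteqP; split=> // q Bq.
by have [C [_ sC Cq _]] := HB _ Bq; exact: sub Cq.
Qed.

(** Extending the inverse by constants outside the range of [h] makes it continuous on the whole
    line, so that arcs become graphs of globally continuous functions. *)
Lemma increasing_inverse (h : R -> R) a b : a < b -> continuous h ->
  (forall s t, a <= s -> s < t -> t <= b -> h s < h t) ->
  exists k : R -> R, [/\ continuous k, forall v, a <= k v <= b,
    forall t, a <= t <= b -> k (h t) = t &
    forall v, h (k v) = Num.max (h a) (Num.min v (h b))].
Proof.
move=> ab ch inc.
pose cl v := Num.max (h a) (Num.min v (h b)).
have hab : h a < h b by apply: inc.
have clab v : h a <= cl v <= h b.
  by rewrite /cl le_max lexx ge_max (ltW hab) ge_min lexx orbT.
have H v : exists t, a <= t <= b /\ h t = cl v.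
  by have [t] := @ivt_le _ h a b (cl v) (ltW ab) ch (clab v); exists t.
have [k kP] := choice H.
have inc' s t : a <= s <= b -> a <= t <= b -> h s < h t -> s < t.
  move=> /andP[_ sb] /andP[at_ _] hst; rewrite ltNge; apply/negP.
  rewrite le_eqVlt => /predU1P[E|ts]; first by rewrite E ltxx in hst.
  by have := inc t s at_ ts sb; rewrite ltNge (ltW hst).
have cl_lip u v : `|cl u - cl v| <= `|u - v|.
  suff L u' v' : u' <= v' -> `|cl v' - cl u'| <= `|v' - u'|.
    have [uv|vu] := leP u v; last by apply: L; exact: ltW.
    by rewrite distrC [`|u - v|]distrC; exact: L.
  move=> uv; rewrite [leRHS]ger0_norm ?subr_ge0// ler_norml.
  rewrite /cl !maxEle !minEle.
  by do !case: ifP => //; lra.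
exists k; split.
- move=> v; apply/cvgrPdist_lt => e e0.
  have [/andP[akv kvb] hk] := kP v.
  have [d1 d10 H1] : exists2 d : R, 0 < d & forall v', `|v - v'| < d -> k v' < k v + e.
    have [sb|bs] := leP (k v + e / 2) b; last first.
      exists 1 => // v' _; have [/andP[_ h1] _] := kP v'; lra.
    exists (h (k v + e / 2) - h (k v)); first by rewrite subr_gt0 inc//; lra.
    move=> v' vv'; have [k' hk'] := kP v'.
    suff : k v' < k v + e / 2 by lra.
    apply: inc' => //; first by rewrite sb; lra.
    have := le_lt_trans (cl_lip v v') vv'; rewrite hk' hk ltr_norml; lra.
  have [d2 d20 H2] : exists2 d : R, 0 < d & forall v', `|v - v'| < d -> k v - e < k v'.
    have [sb|bs] := leP a (k v - e / 2); last first.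
      exists 1 => // v' _; have [/andP[h1 _] _] := kP v'; lra.
    exists (h (k v) - h (k v - e / 2)); first by rewrite subr_gt0 inc//; lra.
    move=> v' vv'; have [k' hk'] := kP v'.
    suff : k v - e / 2 < k v' by lra.
    apply: inc' => //; first by rewrite sb; lra.
    have := le_lt_trans (cl_lip v v') vv'; rewrite hk' hk ltr_norml; lra.
  near=> v'.
  have h1 : k v' < k v + e by apply: H1; near: v'; apply: cvgr_dist_lt => //; exact: cvg_id.
  have h2 : k v - e < k v' by apply: H2; near: v'; apply: cvgr_dist_lt => //; exact: cvg_id.
  by rewrite ltr_norml; lra.
- by move=> v; have [] := kP v.
- move=> t tab; have [k1 k2] := kP (h t).
  have clt : cl (h t) = h t.
    have /andP[at_ tb] := tab.
    have h1 : h a <= h t by move: at_; rewrite le_eqVlt => /predU1P[->//|at_]; rewrite ltW// inc.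
    have h2 : h t <= h b by move: tb; rewrite le_eqVlt => /predU1P[->//|tb]; rewrite ltW// inc.
    by rewrite /cl (min_idPl h2) (max_idPr h1).
  rewrite clt in k2; apply/eqP; rewrite eq_le !leNgt.
  have /andP[at_ tb] := tab; have /andP[ak kb] := k1.
  apply/andP; split; apply/negP => tk.
    by have := inc _ _ at_ tk kb; rewrite k2 ltxx.
  by have := inc _ _ ak tk tb; rewrite k2 ltxx.
- by move=> v; have [] := kP v.
Unshelve. all: by end_near.
Qed.

End Plane.

Section MaxMin.
Variables (R : realType) (T : topologicalType).

Lemma continuous_maxr (f g : T -> R) : continuous f -> continuous g ->
  continuous (fun t => Num.max (f t) (g t)).
Proof. by move=> cf cg t; exact: (@continuous_max R T f g t (cf t) (cg t)). Qed.

Lemma continuous_minr (f g : T -> R) : continuous f -> continuous g ->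
  continuous (fun t => Num.min (f t) (g t)).
Proof. by move=> cf cg t; exact: (@continuous_min R T f g t (cf t) (cg t)). Qed.

Lemma continuous_subr (f g : T -> R) : continuous f -> continuous g ->
  continuous (fun t => f t - g t).
Proof. by move=> cf cg t; exact: (cvgB (cf t) (cg t)). Qed.

Lemma continuous_comp_real (f : T -> R) (g : R -> R) : continuous f -> continuous g ->
  continuous (fun t => g (f t)).
Proof. by move=> cf cg t; apply: continuous_comp; [exact: cf|exact: cg]. Qed.

End MaxMin.

(** * Ovals are periodic orbits surrounding the origin *)

Section OvalOrbits.
Variable R : realType.
Local Notation plane := 'rV[R]_2.
Variables (F f g x z : R -> R) (xs T1 T2 : R).
Hypothesis dF : forall u, is_derive u (1 : R) F (f u).
Hypothesis lF : locally_lipschitz F.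
Hypothesis lg : locally_lipschitz g.
Hypothesis F0 : F 0 = 0.
Hypothesis god : odd_function g.
Hypothesis fod : odd_function f.
Hypothesis S : lsol F g x z.
Hypothesis O : oval F x z xs T1 T2.
Let y t := z t - F (x t).
Let u t : plane := pt (x t) (y t).
Let Fev := even_primitive dF fod.

Lemma oval_increasing s t : - T2 <= s -> s < t -> t <= 0 -> x s < x t.
Proof.
move=> s0 st t0; apply: (lsol_x_gt S st) => r /andP[sr rt].
by apply: (oval_ypos O); rewrite (le_trans s0 (ltW sr)) (lt_le_trans rt).
Qed.

Lemma oval_decreasing s t : 0 <= s -> s < t -> t <= T1 -> x t < x s.
Proof.
move=> s0 st t0; apply: (lsol_x_lt S st) => r /andP[sr rt].
by apply: (oval_yneg O); rewrite (le_lt_trans s0 sr) (le_trans (ltW rt)).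
Qed.

Lemma oval_xs_gt0 : 0 < xs.
Proof.
rewrite -(oval_x0 O); apply: (oval_xpos O).
by rewrite oppr_lt0 (oval_T2 O) (oval_T1 O).
Qed.

Lemma oval_inverse_up : exists k : R -> R, [/\ continuous k, forall v, - T2 <= k v <= 0,
  forall t, - T2 <= t <= 0 -> k (x t) = t &
  forall v, x (k v) = Num.max 0 (Num.min v xs)].
Proof.
have T20 : - T2 < 0 by rewrite oppr_lt0 (oval_T2 O).
have [k [k1 k2 k3 k4]] := increasing_inverse T20 (proj1 (lsol_cts S)) oval_increasing.
by exists k; split=> // v; rewrite k4 (oval_xT2 O) (oval_x0 O).
Qed.

Lemma oval_inverse_down : exists k : R -> R, [/\ continuous k, forall v, 0 <= k v <= T1,
  forall t, 0 <= t <= T1 -> k (x t) = t &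
  forall v, x (k v) = Num.max 0 (Num.min v xs)].
Proof.
have T10 : - T1 < 0 by rewrite oppr_lt0 (oval_T1 O).
have cxN : continuous (fun t => x (- t)).
  move=> t; apply: continuous_comp; first exact: opp_continuous.
  exact: (proj1 (lsol_cts S)).
have [|k [k1 k2 k3 k4]] := increasing_inverse T10 cxN.
  by move=> s t sT st t0; apply: oval_decreasing; rewrite ?ltrN2 ?oppr_ge0 // lerNl.
exists (fun v => - k v); split.
- by move=> v; apply: continuousN; exact: k1.
- by move=> v; have := k2 v; lra.
- by move=> t tT; rewrite -{1}(opprK t) k3 ?opprK//; lra.
- by move=> v; rewrite k4 opprK oppr0 (oval_xT1 O) (oval_x0 O).
Qed.

Lemma oval_orbit_periodic : periodic_orbit (lienard f g) (range u).
Proof.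
exists u; split=> //.
- exact: lienard_solutionP.
- exists (2 * (T1 + T2)); first by rewrite mulr_gt0// addr_gt0// (oval_T1 O, oval_T2 O).
  by move=> t; rewrite /u /y; have [-> ->] := oval_period lF lg Fev god S O t.
- exists T1; apply/eqP => /(congr1 (fun p : plane => p 0 0)).
  by rewrite !pt0 (oval_xT1 O) (oval_x0 O) => /esym/eqP; rewrite gt_eqF// oval_xs_gt0.
Qed.

(* The oval is the boundary of the region between the graphs of two continuous
   functions of |x|, one for each monotone half of the arc. *)
Lemma oval_orbit_surrounds : surrounds (range u) 0.
Proof.
have not0 : ~ range u 0.
  move=> [t _ /esym/esym/pt_eq0[xt yt]].
  apply: (oval_not_origin lF lg Fev god S O (t := t) F0); split=> //.
  by move: yt; rewrite /y xt F0 subr0.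
split=> //.
have [kp [ckp kp1 kp2 kp3]] := oval_inverse_up.
have [km [ckm km1 km2 km3]] := oval_inverse_down.
have xs0 := oval_xs_gt0.
have cy : continuous y by move=> t; exact: (lsol_cy dF S).
(* Since the inverses are constant beyond [xs], both heights would vanish there and the segment of
   the x-axis outside the oval would be a zero set; the penalty makes [phi] negative for |x| >
   xs. *)
pose pen (v : R) : R := Num.max 0 (`|v| - xs).
pose Hp (v : R) : R := y (kp `|v|) - pen v.
pose Hm (v : R) : R := - y (km `|v|) - pen v.
have cpen : continuous pen.
  apply: continuous_maxr => v; first exact: cvg_cst.
  by apply: continuousB; [exact: norm_continuous|exact: cvg_cst].
have cabs (k : R -> R) : continuous k -> continuous (fun v : R => y (k `|v|)).
  move=> ck v; apply: (@continuous_comp _ _ _ (fun v : R => k `|v|) y); last exact: cy.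
  by apply: continuous_comp; [exact: norm_continuous|exact: ck].
have cHp : continuous Hp by move=> v; exact: (continuousB (cabs _ ckp v) (cpen v)).
have cHm : continuous Hm.
  by move=> v; exact: (continuousB (continuousN (cabs _ ckm v)) (cpen v)).
pose phi (p : plane) : R := Num.min (Hp (p 0 0) - p 0 1) (Hm (p 0 0) + p 0 1).
have cphi : continuous phi.
  have c0 (h : R -> R) : continuous h -> continuous (fun p : plane => h (p 0 0)).
    by move=> ch p; apply: (@continuous_comp _ _ _ (fun p : plane => p 0 0) h); [exact: coord_cts|exact: ch].
  apply: continuous_minr => p; first exact: (continuousB (c0 _ cHp p) (@coord_cts R 1 p)).
  exact: (continuousD (c0 _ cHm p) (@coord_cts R 1 p)).
have pen0 v : `|v| <= xs -> pen v = 0.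
  by move=> h; rewrite /pen (max_idPl _)// subr_le0.
have xkp (v : R) : `|v| <= xs -> x (kp `|v|) = `|v|.
  by move=> h; rewrite kp3 (min_idPl h) (max_idPr _).
have xkm (v : R) : `|v| <= xs -> x (km `|v|) = `|v|.
  by move=> h; rewrite km3 (min_idPl h) (max_idPr _).
have out v : xs < `|v| -> Hp v < 0 /\ Hm v < 0.
  move=> h; have penE : pen v = `|v| - xs by rewrite /pen (max_idPr _)// subr_ge0 ltW.
  have kp0 : kp `|v| = 0.
    have := kp3 `|v|; rewrite (min_idPr (ltW h)) (max_idPr (ltW xs0)) -(oval_x0 O).
    move=> xk; rewrite -(kp2 (kp `|v|) (kp1 _)) xk kp2// lexx oppr_le0.
    by rewrite ltW// (oval_T2 O).
  have km0 : km `|v| = 0.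
    have := km3 `|v|; rewrite (min_idPr (ltW h)) (max_idPr (ltW xs0)) -(oval_x0 O).
    move=> xk; rewrite -(km2 (km `|v|) (km1 _)) xk km2// lexx.
    by rewrite ltW// (oval_T1 O).
  have y0 : y 0 = 0 by rewrite /y (oval_x0 O) (oval_z0 O) subrr.
  by rewrite /Hp /Hm kp0 km0 y0 penE; lra.
have on_oval t (p : plane) : `|p 0 0| = x t -> p 0 1 = y t -> range u p.
  move=> h0 h1; have [p0|p0] := leP 0 (p 0 0).
    exists t => //; rewrite /u -h1 -h0 ger0_norm//.
    exact/esym/pt_coord.
  exists (2 * T1 - t) => //; rewrite /u /y.
  have [-> ->] := lsol_reflect lF lg Fev god S (oval_xT1 O) t.
  rewrite Fev -[z t - _]/(y t) -h0 ltr0_norm// opprK -h1.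
  exact/esym/pt_coord.
have phi0 (p : plane) : phi p = 0 -> range u p.
  move=> ph; have ph1 : 0 <= Hp (p 0 0) - p 0 1 by rewrite -ph ge_min lexx.
  have ph2 : 0 <= Hm (p 0 0) + p 0 1 by rewrite -ph ge_min lexx orbT.
  have [vx|xv] := leP `|p 0 0| xs; last by have [h1 h2] := out _ xv; lra.
  have : phi p = Hp (p 0 0) - p 0 1 \/ phi p = Hm (p 0 0) + p 0 1.
    by rewrite /phi minEle; case: ifP => _; [left|right].
  rewrite ph /Hp /Hm pen0// !subr0 => -[] h.
    by apply: (on_oval (kp `|p 0 0|)); [rewrite xkp|lra].
  by apply: (on_oval (km `|p 0 0|)); [rewrite xkm|lra].
have phi00 : 0 < phi 0.
  have n0 : `|0 : R| <= xs by rewrite normr0 ltW.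
  rewrite /phi !mxE subr0 addr0 lt_min /Hp /Hm pen0// !subr0 normr0.
  have kp00 : kp 0 = - T2 by rewrite -(oval_xT2 O) kp2// lexx oppr_le0 ltW// (oval_T2 O).
  have km00 : km 0 = T1 by rewrite -(oval_xT1 O) km2// lexx andbT ltW// (oval_T1 O).
  rewrite kp00 km00 oppr_gt0; apply/andP; split.
    by apply: (oval_ypos O); rewrite lexx oppr_lt0 (oval_T2 O).
  by apply: (oval_yneg O); rewrite lexx (oval_T1 O).
set C := connected_component _ _.
have C0 : C 0 by apply: connected_component_refl.
have CO (p : plane) : C p -> ~ range u p := fun Cp => connected_component_sub Cp.
(* As [phi] vanishes only on the oval, the set where it is positive meets the component in a part
   that is both open and closed in it, and contains 0. *)
have CphiE : C `&` [set p : plane | 0 < phi p] = C.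
  apply: (component_connected).
  - by exists 0.
  - exists [set p : plane | 0 < phi p] => //.
    exact: (open_comp (fun p _ => cphi p) (@open_gt R 0)).
  - exists [set p : plane | 0 <= phi p].
      exact: (closed_comp (fun p _ => cphi p) (@closed_ge R 0)).
    apply/seteqP; split=> p [Cp php]; split=> //=; first exact: ltW.
    rewrite lt_neqAle php andbT; apply/negP => /eqP/esym/phi0.
    exact: CO.
have [M1 M10 HM1] := @continuous_bounded R Hp (- xs) xs (fun t _ => @cHp t).
have [M2 M20 HM2] := @continuous_bounded R Hm (- xs) xs (fun t _ => @cHm t).
exists (xs + M1 + M2); split; first exact: num_real.
move=> M MM p; rewrite -CphiE => -[_ /=].
rewrite lt_min => /andP[h1 h2].
have vx : `|p 0 0| <= xs.
  by rewrite leNgt; apply/negP => /out[]; lra.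
apply: rV2_le; first by lra.
have vx' : - xs <= p 0 0 <= xs by rewrite -ler_norml.
have := HM1 _ vx'; have := HM2 _ vx'; rewrite !ler_norml; lra.
Qed.

End OvalOrbits.

(** * Obstructions to periodicity *)

Section Necessity.
Variable R : realType.
Implicit Types (F f g x z : R -> R) (t s c d e u v a b : R).

Definition periodic_lsol F g x z P := [/\ lsol F g x z, 0 < P,
  forall t, x (t + P) = x t /\ z (t + P) = z t & forall t, ~ (x t = 0 /\ z t = 0)].

(** This is all that the necessity half retains of a global center. The last clause excludes
    equilibria, whose constant solutions are trivially periodic. *)
Definition all_periodic F g := forall u v, ~ (u = 0 /\ v = 0) ->
  exists x z P, [/\ periodic_lsol F g x z P, x 0 = u, z 0 = v &
    exists t, x t <> u \/ z t <> v].

Lemma periodic_lsol_reverse F g x z P : periodic_lsol F g x z P ->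
  periodic_lsol (fun u => - F u) g (fun t => x (- t)) (fun t => - z (- t)) P.
Proof.
move=> [S P0 per N]; split=> //; first exact: lsol_reverse.
- move=> t; have [<- <-] := per (- (t + P)).
  by have -> : - (t + P) + P = - t by ring.
- move=> t [xt /eqP]; rewrite oppr_eq0 => /eqP zt; exact: (N (- t)).
Qed.

Lemma all_periodic_reverse F g : all_periodic F g -> all_periodic (fun u => - F u) g.
Proof.
move=> H u v N; have [|x [z [P [per x0 z0 [t nt]]]]] := H u (- v).
  by move=> [u0 /eqP]; rewrite oppr_eq0 => /eqP v0; exact: N.
exists (fun t => x (- t)), (fun t => - z (- t)), P; split.
- exact: periodic_lsol_reverse.
- by rewrite oppr0.
- by rewrite oppr0 z0 opprK.
- exists (- t); rewrite opprK; case: nt => nt; [by left|right].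
  by move=> zv; apply: nt; rewrite -zv opprK.
Qed.

Lemma periodic_lsol_mult F g x z P (n : nat) : periodic_lsol F g x z P ->
  x (n%:R * P) = x 0.
Proof.
move=> [_ _ per _]; elim: n => [|n IH]; first by rewrite mul0r.
by rewrite -natr1 mulrDl mul1r; have [-> _] := per (n%:R * P).
Qed.

Lemma periodic_not_increasing F g x z P : periodic_lsol F g x z P ->
  (forall t, 0 < t -> 0 < z t - F (x t)) -> False.
Proof.
move=> [S P0 per N] yp.
have : x 0 < x P by apply: (lsol_x_gt S P0) => t /andP[/yp].
by rewrite -[P]add0r (proj1 (per 0)) ltxx.
Qed.

Lemma periodic_descends F f g x z P : (forall u, is_derive u (1 : R) F (f u)) ->
  (forall u, 0 < u -> 0 < g u) -> periodic_lsol F g x z P ->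
  0 < x 0 -> z 0 = F (x 0) -> exists2 t, 0 <= t & x t <= 0.
Proof.
move=> dF gpos [S P0 per N] x0 z0; apply: contrapT => H.
have xp t : 0 <= t -> 0 < x t.
  by move=> t0; rewrite ltNge; apply/negP => xt; apply: H; exists t.
have : x P < x 0.
  apply: (lsol_x_lt S P0) => t /andP[t0 tP].
  apply: (descending_y_neg dF gpos S x0 _ (b := t)); [by rewrite z0 subrr| |by rewrite t0 lexx].
  by move=> s /andP[/xp].
by rewrite -[P]add0r (proj1 (per 0)) ltxx.
Qed.

Lemma all_periodic_g_neq0 F g : locally_lipschitz F -> locally_lipschitz g ->
  all_periodic F g -> forall u, u != 0 -> g u != 0.
Proof.
move=> lF lg H u u0; apply/negP => /eqP gu.
have [|x [z [P [[S _ _ _] x0 z0 [t nt]]]]] := H u (F u).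
  by move=> [uE _]; rewrite uE eqxx in u0.
have C : lsol F g (fun _ => u) (fun _ => F u).
  by move=> s; rewrite subrr gu oppr0; split; exact: is_deriveC1.
have [xt zt] := lsol_unique lF lg S C x0 z0 t.
by case: nt.
Qed.

(** Since [g] has no zero off the origin, one negative value on the right makes it negative on the
    whole half line. A solution leaving the x-axis there then has y > 0 and moves right forever. *)
Lemma all_periodic_g_pos F f g : (forall u, is_derive u (1 : R) F (f u)) ->
  continuous f -> locally_lipschitz g -> continuous g ->
  all_periodic F g -> forall u, 0 < u -> 0 < g u.
Proof.
move=> dF cf lg cg H.
have lF := C1_locally_lipschitz dF cf.
have gN0 := all_periodic_g_neq0 lF lg H.
move=> u u0; rewrite ltNge; apply/negP => gu.
have gneg v : 0 < v -> g v < 0.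
  move=> v0; rewrite ltNge; apply/negP => gv.
  suff [w w0 gw] : exists2 w, 0 < w & g w = 0.
    by have := gN0 w; rewrite gw eqxx gt_eqF// => /(_ isT).
  have [uv|vu] := leP u v.
    have [|w /andP[uw _] gw] := @ivt_le _ g u v 0 uv cg; first by rewrite gu.
    by exists w => //; exact: lt_le_trans uw.
  have cgN : continuous (fun v => - g v) by move=> w; apply: continuousN; exact: cg.
  have [|w /andP[uw _] gw] := @ivt_le _ _ v u 0 (ltW vu) cgN.
    by rewrite oppr_le0 oppr_ge0 gv.
  by exists w; [exact: lt_le_trans uw|rewrite -[g w]opprK gw oppr0].
have [|x [z [P [per x0 z0 _]]]] := H u (F u).
  by move=> [uE _]; rewrite uE ltxx in u0.
have [S P0 _ _] := per.
apply: (periodic_not_increasing per) => t t0.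
rewrite -oppr_lt0.
apply: (@barrier _ (fun t => - (z t - F (x t))) 0 t); last by rewrite t0 lexx.
- by rewrite x0 z0 subrr oppr0.
- by move=> s _; apply: continuousN; exact: (lsol_cy dF S).
move=> s /andP[s0 _] ys /eqP; rewrite oppr_eq0 => /eqP ys0.
exists (g (x s)).
  apply: gneg; apply: (lt_le_trans u0); rewrite -x0.
  apply: (lsol_x_ge S s0) => r /andP[r0 rs].
  by rewrite -oppr_le0 ys// (ltW r0) ltW.
apply: (is_derive_eq (is_deriveN1 (lsol_dy dF S s))).
by rewrite ys0 mulr0 subr0 opprK.
Qed.

(* A curve y = - phi x in the fourth quadrant that the flow crosses upwards and that ends at the
   origin traps the solution starting at (e, 0), which then converges to the origin. *)
Lemma trapped_at_origin F f g (phi dphi : R -> R) e :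
  (forall u, is_derive u (1 : R) F (f u)) -> F 0 = 0 -> (forall u, 0 < u -> 0 < g u) ->
  0 < e -> (forall u, is_derive u (1 : R) phi (dphi u)) -> phi 0 = 0 ->
  (forall u, 0 < u <= e -> 0 < phi u /\ g u - f u * phi u + dphi u * phi u < 0) ->
  ~ all_periodic F g.
Proof.
move=> dF F0 gpos e0 dphiP phi0 trap H.
have [|x [z [P [per x0 z0 _]]]] := H e (F e).
  by move=> [eE _]; rewrite eE ltxx in e0.
have x0e : 0 < x 0 by rewrite x0.
have z0F : z 0 = F (x 0) by rewrite x0.
have y00 : z 0 - F (x 0) = 0 by rewrite z0F subrr.
have h := periodic_descends dF gpos per x0e z0F.
have [S P0 _ N] := per.
have [T [T0 xT yT xp yn]] := descending_arc dF gpos S x0e y00 h.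
pose psi t := - (z t - F (x t)) - phi (x t).
have cpsi t : {for t, continuous psi}.
  apply: (@is_derive_cts _ _ t _ (is_deriveB1 (is_deriveN1 (lsol_dy dF S t))
    (is_derive_comp1 (dphiP (x t)) (lsol_dx S t)))).
have psiT t : 0 <= t < T -> psi t <= 0.
  move=> /andP[t0 tT]; move: t0; rewrite le_eqVlt => /predU1P[<-|t0].
    rewrite /psi y00 oppr0 sub0r oppr_le0 x0 ltW//.
    by have [] := trap e; rewrite // e0 lexx.
  apply/ltW/(@barrier _ psi 0 t); last by rewrite t0 lexx.
  - rewrite /psi y00 oppr0 sub0r oppr_le0 x0 ltW//.
    by have [] := trap e; rewrite // e0 lexx.
  - by move=> s _; exact: cpsi.
  move=> s /andP[s0 st] _ psis.
  have xs0 : 0 < x s by apply: xp; rewrite s0 (le_lt_trans st).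
  have xse : x s <= e.
    rewrite -x0; apply: (lsol_x_le S s0) => r /andP[r0 rs].
    by apply/ltW/yn; rewrite r0 (lt_trans (lt_le_trans rs st)).
  have [|phis trs] := trap (x s); first by rewrite xs0.
  exists (g (x s) - f (x s) * phi (x s) + dphi (x s) * phi (x s)) => //.
  have ysE : z s - F (x s) = - phi (x s) by move: psis; rewrite /psi; lra.
  apply: (is_derive_eq (is_deriveB1 (is_deriveN1 (lsol_dy dF S s))
    (is_derive_comp1 (dphiP (x s)) (lsol_dx S s)))).
  by rewrite ysE; ring.
have : psi T <= 0.
  rewrite leNgt; apply/negP => psT.
  have [d d0 Hd] := continuous_gt (@cpsi T) psT.
  pose s := Num.max 0 (T - d / 2).
  have sT : s < T by rewrite gt_max T0 /= ltrBlDr ltrDl divr_gt0.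
  have s0 : 0 <= s by rewrite le_max lexx.
  have sd : T - d / 2 <= s by rewrite le_max lexx orbT.
  have : psi s <= 0 by apply: psiT; rewrite s0.
  by rewrite leNgt Hd// ltr0_norm ?subr_lt0//; lra.
rewrite /psi xT phi0 subr0 F0 subr0 oppr_le0 => zT.
apply: (N T); split=> //; apply/eqP; rewrite eq_le zT andbT.
by move: yT; rewrite xT F0 subr0.
Qed.

(** Above the curve y = phi x the solution moves right, and wherever it meets the curve y - phi x
    increases. So it stays above, never turns back and cannot be periodic. *)
Lemma trapped_at_infinity F f g (phi dphi : R -> R) e :
  (forall u, is_derive u (1 : R) F (f u)) -> 0 < e ->
  (forall u, is_derive u (1 : R) phi (dphi u)) -> (forall u, 0 < u -> 0 < phi u) ->
  (forall u, e <= u -> g u + f u * phi u + dphi u * phi u < 0) ->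
  ~ all_periodic F g.
Proof.
move=> dF e0 dphiP phip trap H.
have [|x [z [P [per x0 z0 _]]]] := H e (phi e + F e).
  by move=> [eE _]; rewrite eE ltxx in e0.
have [S P0 _ N] := per.
pose psi t := phi (x t) - (z t - F (x t)).
have dpsi t := is_deriveB1 (is_derive_comp1 (dphiP (x t)) (lsol_dx S t)) (lsol_dy dF S t).
have cpsi t : {for t, continuous psi} by exact: is_derive_cts (dpsi t).
(* [phi] is positive only for positive abscissas, so x must first be kept positive: up to its first
   zero the solution only moves right from [e], which rules the zero out. *)
have xge t : 0 <= t -> (forall s, 0 <= s <= t -> psi s <= 0) -> e <= x t.
  move=> t0 ps.
  have xe s : 0 <= s <= t -> (forall r, 0 <= r < s -> 0 < x r) -> e <= x s.
    move=> /andP[s0 st] xr; rewrite -x0; apply: (lsol_x_ge S s0) => r /andP[r0 rs].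
    have := ps r; rewrite (ltW r0) (ltW (lt_le_trans rs st)) => /(_ isT).
    have := phip (x r); rewrite xr ?rs ?andbT ?(ltW r0)// => /(_ isT).
    by rewrite /psi; lra.
  apply: (xe t) => [|r /andP[r0 rt]]; first by rewrite t0 lexx.
  rewrite ltNge; apply/negP => xr0.
  have [|T /andP[T0 Tr] [xT xp]] := first_zero r0 (fun s _ => @lsol_cx _ F g _ _ S s) _ xr0.
    by rewrite x0.
  have := xe T; rewrite (ltW T0) (le_trans Tr (ltW rt)) xT => /(_ isT xp).
  by rewrite leNgt e0.
have psn t : 0 < t -> psi t < 0.
  move=> t0; apply: (@barrier _ psi 0 t); last by rewrite t0 lexx.
  - by rewrite /psi x0 z0; lra.
  - by move=> s _; exact: cpsi.
  move=> s /andP[s0 st] ps pss; have xs := xge s s0 ps.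
  have ysE : z s - F (x s) = phi (x s) by move: pss; rewrite /psi; lra.
  exists (g (x s) + f (x s) * phi (x s) + dphi (x s) * phi (x s)); first exact: trap.
  by apply: (is_derive_eq (dpsi s)); rewrite ysE; ring.
apply: (periodic_not_increasing per) => t t0.
have xt : 0 < x t.
  apply: (lt_le_trans e0); apply: xge => [|s /andP[+ _]]; first exact: ltW.
  by rewrite le_eqVlt => /predU1P[<-|/psn/ltW//]; rewrite /psi x0 z0; lra.
by have := phip _ xt; have := psn _ t0; rewrite /psi; lra.
Qed.

Lemma left_limit_ge0 (phi : R -> R) a b : a < b -> {for b, continuous phi} ->
  (forall s, a <= s < b -> 0 < phi s) -> 0 <= phi b.
Proof.
move=> ab cphi H; rewrite leNgt; apply/negP => pb.
have [d d0 Hd] := continuous_lt cphi pb.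
pose s := Num.max a (b - d / 2).
have sb : s < b by rewrite gt_max ab /= ltrBlDr ltrDl divr_gt0.
have sa : a <= s by rewrite le_max lexx.
have sd : b - d / 2 <= s by rewrite le_max lexx orbT.
have : 0 < phi s by apply: H; rewrite sa.
by rewrite ltNge ltW// Hd// ltr0_norm ?subr_lt0//; lra.
Qed.

End Necessity.
(* If F u > F (- u) for small u > 0, the arc of a periodic solution in x >= 0 together with its mirror image
   bounds a region which the solution enters strictly when it crosses to x < 0 and cannot leave. *)
Section EvenPart.
Variable R : realType.
Variables (F f g x z : R -> R) (e T1 T2 P : R).
Hypothesis dF : forall u, is_derive u (1 : R) F (f u).
Hypothesis lF : locally_lipschitz F.
Hypothesis lg : locally_lipschitz g.
Hypothesis cg : continuous g.
Hypothesis F0 : F 0 = 0.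
Hypothesis god : odd_function g.
Hypothesis gpos : forall u : R, 0 < u -> 0 < g u.
Hypothesis FD : forall u : R, 0 < u <= e -> F (- u) < F u.
Hypothesis S : lsol F g x z.
Hypothesis O : oval F x z e T1 T2.
Variables (kp km : R -> R).
Hypothesis ckp : continuous kp.
Hypothesis kp1 : forall v, - T2 <= kp v <= 0.
Hypothesis kp2 : forall t, - T2 <= t <= 0 -> kp (x t) = t.
Hypothesis kp3 : forall v, x (kp v) = Num.max 0 (Num.min v e).
Hypothesis ckm : continuous km.
Hypothesis km1 : forall v, 0 <= km v <= T1.
Hypothesis km2 : forall t, 0 <= t <= T1 -> km (x t) = t.
Hypothesis km3 : forall v, x (km v) = Num.max 0 (Num.min v e).

Let T10 : 0 < T1 := oval_T1 O.
Let T20 : 0 < T2 := oval_T2 O.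
Let e0 : 0 < e := oval_xs_gt0 O.
Let cF : continuous F := lienard_cts dF.
Let cx : continuous x := proj1 (lsol_cts S).
Let cz : continuous z := proj2 (lsol_cts S).
Let g0 : g 0 = 0.
Proof. by have := god 0; rewrite oppr0; lra. Qed.

Let h v := z (kp v).
Let l v := z (km v).

Lemma inner_h_cts : continuous h.
Proof. by move=> v; apply: continuous_comp; [exact: ckp|exact: cz]. Qed.

Lemma inner_l_cts : continuous l.
Proof. by move=> v; apply: continuous_comp; [exact: ckm|exact: cz]. Qed.

Lemma inner_kp v : 0 <= v <= e -> x (kp v) = v.
Proof. by move=> /andP[v0 ve]; rewrite kp3 (min_idPl ve) (max_idPr v0). Qed.

Lemma inner_km v : 0 <= v <= e -> x (km v) = v.
Proof. by move=> /andP[v0 ve]; rewrite km3 (min_idPl ve) (max_idPr v0). Qed.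

Lemma inner_h_gt v : 0 <= v < e -> 0 < h v - F v.
Proof.
move=> /andP[v0 ve]; have xk := inner_kp (v := v); rewrite v0 (ltW ve) in xk.
rewrite -{2}(xk isT); apply: (oval_ypos O).
have /andP[-> k0] := kp1 v; rewrite lt_neqAle k0 andbT; apply/negP => /eqP k0E.
by have := xk isT; rewrite k0E (oval_x0 O) => ev; rewrite ev ltxx in ve.
Qed.

Lemma inner_l_lt v : 0 <= v < e -> 0 < F v - l v.
Proof.
move=> /andP[v0 ve]; have xk := inner_km (v := v); rewrite v0 (ltW ve) in xk.
rewrite -{1}(xk isT) subr_gt0 -subr_lt0; apply: (oval_yneg O).
have /andP[k0 ->] := km1 v; rewrite lt_neqAle k0 !andbT; apply/negP => /eqP k0E.
by have := xk isT; rewrite -k0E (oval_x0 O) => ev; rewrite ev ltxx in ve.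
Qed.

Lemma inner_inverse_der (k : R -> R) (a b v : R) : a < k v < b ->
  (forall t, a <= t <= b -> k (x t) = t) -> x (k v) = v -> z (k v) - F v != 0 ->
  is_derive v (1 : R) (fun v => z (k v)) (- g v / (z (k v) - F v)).
Proof.
move=> /andP[ak kb] kx xk yN0.
have dk : is_derive v (1 : R) k (z (k v) - F v)^-1.
  rewrite -{1}xk; apply: is_derive_inverse.
  - near=> t; apply: kx; apply/andP; split; apply/ltW; near: t.
      exact: lt_nbhsr.
    exact: lt_nbhsl.
  - by near=> t; exact: cx.
  - by have := lsol_dx S (k v); rewrite xk.
  - exact: yN0.
apply: (is_derive_eq (is_derive_comp1 (lsol_dz S (k v)) dk)).
by rewrite xk.
Unshelve. all: by end_near.
Qed.

Lemma inner_h_der v : 0 < v < e -> is_derive v (1 : R) h (- g v / (h v - F v)).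
Proof.
move=> /andP[v0 ve]; have yN : 0 < h v - F v by apply: inner_h_gt; rewrite ve ltW.
have xk : x (kp v) = v by apply: inner_kp; rewrite !ltW.
apply: (@inner_inverse_der kp (- T2) 0) => //; last by rewrite gt_eqF.
have /andP[k1 k2] := kp1 v; rewrite !lt_neqAle k1 k2 !andbT; apply/andP; split; apply/negP => /eqP E.
  by move: xk; rewrite -E (oval_xT2 O) => v0E; rewrite -v0E ltxx in v0.
by move: xk; rewrite E (oval_x0 O) => veE; rewrite -veE ltxx in ve.
Qed.

Lemma inner_l_der v : 0 < v < e -> is_derive v (1 : R) l (g v / (F v - l v)).
Proof.
move=> /andP[v0 ve]; have yN : 0 < F v - l v by apply: inner_l_lt; rewrite ve ltW.
have xk : x (km v) = v by apply: inner_km; rewrite !ltW.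
have yN0 : z (km v) - F v != 0 by rewrite -oppr_eq0 opprB gt_eqF.
apply: (is_derive_eq (@inner_inverse_der km 0 T1 v _ km2 xk yN0)).
  have /andP[k1 k2] := km1 v; rewrite !lt_neqAle k1 k2 !andbT; apply/andP; split; apply/negP => /eqP E.
    by move: xk; rewrite -E (oval_x0 O) => veE; rewrite veE ltxx in ve.
  by move: xk; rewrite E (oval_xT1 O) => v0E; rewrite v0E ltxx in v0.
by rewrite -[F v - _]opprB invrN mulrN mulNr.
Qed.

Let up t := h (- x t) - z t.
Let dn t := z t - l (- x t).

(** The mirrored arc solves the system with [F (- u)] in place of [F u], so the gap to it obeys a
    linear equation whose source is the defect [F (- x) - F x], positive for x < 0. The coefficient
    is given explicitly because its smallness near x = 0 is used at the corners. *)
Lemma inner_up_der t : 0 < - x t < e -> exists k, [/\ 0 < k,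
  k = g (- x t) / (h (- x t) - F (- x t)) &
  is_derive t (1 : R) up (k * (F (- x t) - F (x t) - up t))].
Proof.
move=> /[dup] xt /andP[x0 xe]; have yp : 0 < h (- x t) - F (- x t) by apply: inner_h_gt; rewrite xe ltW.
exists (g (- x t) / (h (- x t) - F (- x t))); split=> //; first by rewrite divr_gt0// gpos.
apply: (is_derive_eq (is_deriveB1 (@is_derive_comp1 R h (fun s => - x s) t _ _ (inner_h_der xt)
  (is_deriveN1 (lsol_dx S t))) (lsol_dz S t))).
have -> : g (x t) = - g (- x t) by rewrite god opprK.
rewrite /up.
by field; rewrite gt_eqF.
Qed.

Lemma inner_dn_der t : 0 < - x t < e -> exists k, [/\ 0 < k,
  k = g (- x t) / (F (- x t) - l (- x t)) &
  is_derive t (1 : R) dn (k * (F (- x t) - F (x t) + dn t))].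
Proof.
move=> /[dup] xt /andP[x0 xe]; have yp : 0 < F (- x t) - l (- x t) by apply: inner_l_lt; rewrite xe ltW.
exists (g (- x t) / (F (- x t) - l (- x t))); split=> //; first by rewrite divr_gt0// gpos.
apply: (is_derive_eq (is_deriveB1 (lsol_dz S t) (@is_derive_comp1 R l (fun s => - x s) t _ _ (inner_l_der xt)
  (is_deriveN1 (lsol_dx S t))))).
have -> : g (x t) = - g (- x t) by rewrite god opprK.
rewrite /dn.
by field; rewrite gt_eqF.
Qed.

Lemma inner_defect t : 0 < - x t <= e -> 0 < F (- x t) - F (x t).
Proof. by move=> /FD; rewrite opprK subr_gt0. Qed.

(** In the coordinate z the arc and its mirror image are the graphs of the same [l] and [h] over
    [|x|]; in y they would differ, [F] not being even. *)
Definition inner t := [/\ `|x t| < e, l `|x t| < z t & z t < h `|x t|].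

Let cabs (k : R -> R) : continuous k -> continuous (fun t : R => k `|x t|).
Proof.
move=> ck t; apply: (@continuous_comp _ _ _ (fun t : R => `|x t|) k); last exact: ck.
by apply: continuous_comp; [exact: cx|exact: norm_continuous].
Qed.

Let cgap1 : continuous ((fun t => e - `|x t|) : R -> R).
Proof. apply: continuous_subr; first by move=> t; exact: cvg_cst.
by apply: (cabs (k := id)) => u; exact: cvg_id. Qed.

Let cgap2 : continuous ((fun t => z t - l `|x t|) : R -> R).
Proof.
exact: (continuous_subr cz (cabs inner_l_cts)). Qed.

Let cgap3 : continuous ((fun t => h `|x t| - z t) : R -> R).
Proof.
exact: (continuous_subr (cabs inner_h_cts) cz). Qed.

Lemma inner_gaps t : inner t <-> [/\ 0 < e - `|x t|, 0 < z t - l `|x t| & 0 < h `|x t| - z t].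
Proof. by rewrite !subr_gt0. Qed.

Lemma inner_open t : inner t -> exists2 d, 0 < d & forall s, `|s - t| < d -> inner s.
Proof.
move=> /inner_gaps[h1 h2 h3].
have [d1 d10 H1] := continuous_gt (@cgap1 t) h1.
have [d2 d20 H2] := continuous_gt (@cgap2 t) h2.
have [d3 d30 H3] := continuous_gt (@cgap3 t) h3.
exists (Num.min d1 (Num.min d2 d3)); first by rewrite !lt_min d10 d20.
by move=> s; rewrite !lt_min => /and3P[s1 s2 s3]; apply/inner_gaps; split; [exact: H1|exact: H2|exact: H3].
Qed.

(* By uniqueness the solution can only be on the right arc after having been on it. *)
Lemma inner_not_on_arc a t tau : a < t -> (forall s, a <= s < t -> inner s) ->
  - T2 < tau <= T1 -> x t = x tau -> z t = z tau -> False.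
Proof.
move=> at_ Hin /andP[tau1 tau2] xE zE.
pose d := Num.min (t - a) (tau + T2).
have d0 : 0 < d by rewrite lt_min subr_gt0 at_; lra.
have da : d <= t - a by rewrite ge_min lexx.
have dT : d <= tau + T2 by rewrite ge_min lexx orbT.
have [xd zd] : x (t - d) = x (tau - d) /\ z (t - d) = z (tau - d).
  have e1 : tau - t + t = tau by ring.
  have := @lsol_unique _ F g x z _ _ t lF lg S (lsol_shift (tau - t) S).
  rewrite /= e1 => /(_ xE zE (t - d)).
  by have -> : tau - t + (t - d) = tau - d by ring.
have [|_ zl zh] := Hin (t - d); first by lra.
have bd : - T2 <= tau - d <= T1 by lra.
have /andP[x0 _] := oval_arc_bound S O bd.
have [s0|s0] := leP 0 (tau - d).
  have sT : 0 <= tau - d <= T1 by lra.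
  by move: zl; rewrite xd zd ger0_norm// /l km2// ltxx.
have sT : - T2 <= tau - d <= 0 by lra.
by move: zh; rewrite xd zd ger0_norm// /h kp2// ltxx.
Qed.

(** A boundary point with x < 0 would be reached with a gap that is zero and increasing, hence
    negative just before. One with x >= 0 lies on the arc, which uniqueness forbids, except at the
    initial end of the arc, where the solution has no earlier time on the arc to be compared
    with. *)
Lemma inner_close a t : a < t -> (forall s, a <= s < t -> inner s) -> inner t.
Proof.
move=> at_ Hin.
have gap s : a <= s < t -> [/\ 0 < e - `|x s|, 0 < z s - l `|x s| & 0 < h `|x s| - z s].
  by move=> /Hin/inner_gaps.
have p1 : 0 <= e - `|x t| by apply: (left_limit_ge0 at_ (@cgap1 t)) => s /gap[].
have p2 : 0 <= z t - l `|x t| by apply: (left_limit_ge0 at_ (@cgap2 t)) => s /gap[].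
have p3 : 0 <= h `|x t| - z t by apply: (left_limit_ge0 at_ (@cgap3 t)) => s /gap[].
have xe : `|x t| <= e by rewrite -subr_ge0.
have le_ : l e = F e.
  have kme : km e = 0 by rewrite -(oval_x0 O) km2// lexx ltW.
  by rewrite /l kme (oval_z0 O).
have he_ : h e = F e.
  have kpe : kp e = 0 by rewrite -(oval_x0 O) kp2// lexx oppr_le0 ltW.
  by rewrite /h kpe (oval_z0 O).
have back d : 0 < d -> exists2 s, 0 < s < d & inner (t - s).
  move=> d0; exists (Num.min (d / 2) (t - a)).
    by rewrite lt_min divr_gt0// subr_gt0 at_/= gt_min ltr_pdivrMr// ltr_pMr// ltr1n.
  apply: Hin; have h1 : Num.min (d / 2) (t - a) <= t - a by rewrite ge_min lexx orbT.
  have h2 : 0 < Num.min (d / 2) (t - a) by rewrite lt_min divr_gt0// subr_gt0.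
  by lra.
have near_x d : x t < 0 -> 0 < d -> exists2 s, 0 < s < d & inner (t - s) /\ x (t - s) < 0.
  move=> xt0 d0; have [r r0 Hr] := continuous_lt (@cx t) xt0.
  have [|s /andP[s0 sd] ins] := back (Num.min d r); first by rewrite lt_min d0.
  move: sd; rewrite lt_min => /andP[sd sr].
  exists s; first by rewrite s0.
  by split=> //; apply: Hr; rewrite addrC addKr normrN gtr0_norm.
apply/inner_gaps.
have [x0|x0] := ltP (x t) 0.
  have absx : `|x t| = - x t by rewrite ltr0_norm.
  rewrite absx in p1 p2 p3 xe *.
  have D0 := inner_defect (t := t); rewrite oppr_gt0 x0 xe in D0; have {D0} := D0 isT => D0.
  (* At the left tip (- e, F e) the velocity F e - F (- e) is positive, so the solution would come
     from |x| > e. *)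
  have e1 : 0 < e - - x t.
    rewrite lt_neqAle p1 andbT; apply/negP => /eqP/esym/eqP; rewrite subr_eq0 => /eqP eE.
    have zt : z t = F e.
      apply/eqP; rewrite eq_le; move: p2 p3; rewrite -eE le_ he_; lra.
    have dx0 : 0 < z t - F (x t) by rewrite zt [in F e]eE.
    have [d d0 Hd] := derive_gt0_near (lsol_dx S t) dx0.
    have [s sd [ins xs0]] := near_x d x0 d0.
    have /andP[h1 _] := Hd s sd.
    have [+ _ _] := ins; rewrite ltr0_norm//; lra.
  have xt : 0 < - x t < e by rewrite oppr_gt0 x0 -subr_gt0.
  split=> //.
    rewrite lt_neqAle p2 andbT; apply/negP => /eqP/esym E.
    have [k [k0 _ dk]] := inner_dn_der xt.
    have E' : dn t = 0 by [].
    have [|d d0 Hd] := derive_gt0_near dk; first by rewrite E' addr0 mulr_gt0.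
    have [s sd [ins xs0]] := near_x d x0 d0.
    have /andP[h1 _] := Hd s sd.
    by have [_ + _] := ins; rewrite ltr0_norm//; move: h1; rewrite E' /dn; lra.
  rewrite lt_neqAle p3 andbT; apply/negP => /eqP/esym E.
  have [k [k0 _ dk]] := inner_up_der xt.
  have E' : up t = 0 by [].
  have [|d d0 Hd] := derive_gt0_near dk; first by rewrite E' subr0 mulr_gt0.
  have [s sd [ins xs0]] := near_x d x0 d0.
  have /andP[h1 _] := Hd s sd.
  by have [_ _ +] := ins; rewrite ltr0_norm//; move: h1; rewrite E' /up; lra.
have absx : `|x t| = x t by rewrite ger0_norm.
rewrite absx in p1 p2 p3 xe *.
have xte : 0 <= x t <= e by rewrite x0.
have arc tau := @inner_not_on_arc a t tau at_ Hin.
split.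
- rewrite lt_neqAle p1 andbT; apply/negP => /eqP/esym/eqP; rewrite subr_eq0 => /eqP eE.
  have zt : z t = F e.
    apply/eqP; rewrite eq_le; move: p2 p3; rewrite -eE le_ he_; lra.
  by apply: (arc 0); rewrite ?oppr_lt0 ?T20 ?(ltW T10)// ?(oval_x0 O) ?(oval_z0 O).
- rewrite lt_neqAle p2 andbT; apply/negP => /eqP/esym/eqP; rewrite subr_eq0 => /eqP zE.
  apply: (arc (km (x t))); rewrite ?inner_km//.
  have /andP[k1 ->] := km1 (x t); rewrite andbT; apply: lt_le_trans k1.
  by rewrite oppr_lt0.
- rewrite lt_neqAle p3 andbT; apply/negP => /eqP/esym/eqP; rewrite subr_eq0 => /eqP zE.
  move: x0; rewrite le_eqVlt => /predU1P[/esym x0|x0]; last first.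
    apply: (arc (kp (x t))); rewrite ?inner_kp//.
    have /andP[k1 k2] := kp1 (x t); rewrite (le_trans k2 (ltW T10)) andbT lt_neqAle k1 andbT.
    apply/negP => /eqP kE; have := inner_kp xte; rewrite -kE (oval_xT2 O) => xtE.
    by rewrite -xtE ltxx in x0.
  (* The solution comes back to the upper corner (0, h 0) from the left. *)
  have kp0 : kp 0 = - T2 by rewrite -(oval_xT2 O) kp2// lexx oppr_le0 ltW.
  have h00 : 0 < h 0 by have := inner_h_gt (v := 0); rewrite lexx e0 F0 subr0; apply.
  have zt0 : z t = h 0 by rewrite -zE x0.
  have dx0 : 0 < z t - F (x t) by rewrite x0 F0 subr0 zt0.
  have [d1 d10 Hd1] := derive_gt0_near (lsol_dx S t) dx0.
  (* This coefficient tends to 0 with x, so it is below 1 shortly before [t]. The gap [up] then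
     decays at most exponentially, by Gronwall, and cannot vanish at [t]. *)
  pose kap s := g (- x s) / (h (- x s) - F (- x s)).
  have [d2 d20 Hd2] : exists2 d, 0 < d & forall s, `|s - t| < d -> kap s < 1.
    apply: continuous_lt; last by rewrite /kap x0 oppr0 g0 mul0r.
    have cN (k : R -> R) : continuous k -> {for t, continuous (fun s => k (- x s))}.
      move=> ck; apply: (@continuous_comp _ _ _ (fun s => - x s) k); last exact: ck.
      by apply: continuousN; exact: cx.
    apply: continuousM; first exact: cN.
    apply: continuousV; first by rewrite /= x0 oppr0 F0 subr0 gt_eqF.
    by apply: continuousB; [exact: (cN _ inner_h_cts)|exact: (cN _ cF)].
  pose d := Num.min (t - a) (Num.min d1 d2) / 2.
  have m0 : 0 < Num.min (t - a) (Num.min d1 d2) by rewrite !lt_min subr_gt0 at_ d10.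
  have d0 : 0 < d by rewrite divr_gt0.
  have [da dd1 dd2] : [/\ d < t - a, d < d1 & d < d2].
    have dm : d < Num.min (t - a) (Num.min d1 d2) by rewrite ltr_pdivrMr// ltr_pMr// ltr1n.
    by move: dm; rewrite !lt_min => /and3P[].
  have left s : t - d <= s < t -> [/\ inner s, x s < 0 & kap s < 1].
    move=> /andP[s1 s2]; split; first by apply: Hin; lra.
      have ts : 0 < t - s < d1 by lra.
      by have /andP[+ _] := Hd1 _ ts; rewrite subKr x0.
    by apply: Hd2; rewrite ltr0_norm; lra.
  have upE s : x s <= 0 -> up s = h `|x s| - z s by move=> xs; rewrite /up ler0_norm.
  have upc : continuous up.
    apply: continuous_subr cz; apply: continuous_comp_real inner_h_cts.
    by move=> s; apply: continuousN; exact: cx.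
  have : - up t <= - up (t - d) * expR (-1 * (t - (t - d))).
    apply: (@gronwall _ (fun s => - up s)); first by lra.
      by move=> s _; apply: continuousN; exact: upc.
    move=> s /andP[s1 s2]; have [|ins xs0 kap1] := left s; first by rewrite s2 ltW.
    have [xse _ zh] := ins; rewrite ltr0_norm// in xse zh.
    have xs : 0 < - x s < e by rewrite oppr_gt0 xs0.
    have [k [k0 kE dk]] := inner_up_der xs.
    eexists; last exact: is_deriveN1 dk.
    have D0 := inner_defect (t := s); rewrite oppr_gt0 xs0 (ltW xse) in D0; have {D0} := D0 isT => D0.
    have up0 : 0 < up s by rewrite /up subr_gt0.
    rewrite /kap -kE in kap1.
    have : 0 < k * (F (- x s) - F (x s)) by rewrite mulr_gt0.
    have : k * up s <= 1 * up s by rewrite ler_wpM2r// ltW.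
    by lra.
  have -> : up t = 0 by rewrite /up x0 oppr0 zt0 subrr.
  have [|ins xs0 _] := left (t - d); first by lra.
  have : 0 < up (t - d).
    by have [_ _ zh] := ins; rewrite upE ?ltW// subr_gt0.
  by move=> u0; rewrite oppr0 [leRHS]mulNr oppr_ge0 leNgt mulr_gt0// expR_gt0.
Qed.

(** At [T1] the gap [dn], its coefficient and the defect all vanish, so the sign of a derivative
    says nothing there. Gronwall first shows that [dn] cannot become negative after [T1]; the
    barrier then makes it positive, starting from an intermediate time. *)
Lemma inner_start : exists2 d, 0 < d & forall t, T1 < t < T1 + d -> inner t.
Proof.
have km0 : km 0 = T1 by rewrite -(oval_xT1 O) km2// lexx andbT ltW.
have zb : z T1 < 0.
  by have := oval_yneg O (t := T1); rewrite T10 lexx (oval_xT1 O) F0 subr0; apply.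
have l00 : 0 < F 0 - l 0 by apply: inner_l_lt; rewrite lexx.
have h00 : 0 < h 0 by have := inner_h_gt (v := 0); rewrite lexx e0 F0 subr0; apply.
have [d1 d10 Hd1] : exists2 d, 0 < d & forall s, `|s - T1| < d -> 0 < e - `|x s|.
  by apply: (continuous_gt (@cgap1 T1)); rewrite (oval_xT1 O) normr0 subr0.
have [d2 d20 Hd2] : exists2 d, 0 < d & forall s, `|s - T1| < d -> 0 < h `|x s| - z s.
  by apply: (continuous_gt (@cgap3 T1)); rewrite (oval_xT1 O) normr0; lra.
have [d3 d30 Hd3] : exists2 d, 0 < d & forall s, `|s - T1| < d -> z s - F (x s) < 0.
  have cy : continuous (fun s => z s - F (x s)).
    by apply: continuous_subr cz _; exact: continuous_comp_real cx cF.
  by apply: (continuous_lt (@cy T1)); rewrite (oval_xT1 O) F0 subr0.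
pose kap s := g (- x s) / (F (- x s) - l (- x s)).
have cN (k : R -> R) : continuous k -> continuous (fun s => k (- x s)).
  move=> ck; apply: continuous_comp_real ck => s.
  by apply: continuousN; exact: cx.
have [d4 d40 Hd4] : exists2 d, 0 < d & forall s, `|s - T1| < d -> kap s < 1.
  apply: continuous_lt; last by rewrite /kap (oval_xT1 O) oppr0 g0 mul0r.
  apply: continuousM; first exact: cN.
  apply: continuousV; first by rewrite /= (oval_xT1 O) oppr0 gt_eqF.
  exact: (continuous_subr (cN _ cF) (cN _ inner_l_cts)).
pose d := Num.min (Num.min d1 d2) (Num.min d3 d4).
have d0 : 0 < d by rewrite !lt_min d10 d20 d30.
have near_T1 s : T1 < s < T1 + d -> [/\ 0 < - x s < e, 0 < h `|x s| - z s & kap s < 1].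
  move=> /andP[s1 s2].
  have : `|s - T1| < d by rewrite gtr0_norm; lra.
  rewrite !lt_min -andbA => /and4P[h1 h2 h3 h4].
  have xs0 : x s < 0.
    rewrite -(oval_xT1 O); apply: (lsol_x_lt S s1) => r /andP[r1 r2]; apply: Hd3.
    by rewrite gtr0_norm ?subr_gt0//; move: h3; rewrite gtr0_norm ?subr_gt0//; lra.
  split; [|exact: Hd2|exact: Hd4].
  by have := Hd1 _ h1; rewrite ltr0_norm//; lra.
have dnc : continuous dn by exact: (continuous_subr cz (cN _ inner_l_cts)).
have dnT : dn T1 = 0 by rewrite /dn (oval_xT1 O) oppr0 /l km0 subrr.
have bar a b : T1 < a -> a < b -> b < T1 + d -> 0 <= dn a -> 0 < dn b.
  move=> Ta ab bd dna; rewrite -oppr_lt0.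
  apply: (@barrier _ (fun s => - dn s) a b); last by rewrite ab lexx.
  - by rewrite oppr_le0.
  - by move=> s _; apply: continuousN; exact: dnc.
  move=> s /andP[s1 s2] _ /eqP; rewrite oppr_eq0 => /eqP dns.
  have [|xs _ _] := near_T1 s; first by lra.
  have [k [k0 _ dk]] := inner_dn_der xs.
  eexists; last exact: is_deriveN1 dk.
  have /andP[xs0 xse] := xs.
  have D0 := inner_defect (t := s); rewrite xs0 (ltW xse) in D0; have {D0} := D0 isT => D0.
  by rewrite dns addr0 oppr_lt0 mulr_gt0.
have dn_ge0 b : T1 < b < T1 + d -> 0 <= dn b.
  move=> /andP[Tb bd]; rewrite leNgt; apply/negP => dnb.
  have neg s : T1 < s <= b -> dn s < 0.
    move=> /andP[Ts]; rewrite le_eqVlt => /predU1P[->//|sb].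
    rewrite ltNge; apply/negP => dns.
    by have := bar s b Ts sb bd dns; rewrite ltNge ltW.
  have : - dn b <= - dn T1 * expR (1 * (b - T1)).
    apply: (@gronwall _ (fun s => - dn s)); first exact: ltW.
      by move=> s _; apply: continuousN; exact: dnc.
    move=> s /andP[s1 s2]; have [|xs _ kap1] := near_T1 s; first by lra.
    have [k [k0 kE dk]] := inner_dn_der xs.
    eexists; last exact: is_deriveN1 dk.
    have /andP[xs0 xse] := xs.
    have D0 := inner_defect (t := s); rewrite xs0 (ltW xse) in D0; have {D0} := D0 isT => D0.
    have dns : dn s < 0 by apply: neg; rewrite s1 ltW.
    rewrite /kap -kE in kap1.
    have : 0 < k * (F (- x s) - F (x s)) by rewrite mulr_gt0.
    have : k * - dn s <= 1 * - dn s by apply: ler_wpM2r; [rewrite oppr_ge0|]; exact: ltW.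
    by lra.
  by rewrite dnT oppr0 mul0r; lra.
exists d => // t /andP[t1 t2].
have [|/andP[xt0 xte] hz _] := near_T1 t; first by rewrite t1.
have absx : `|x t| = - x t by rewrite ltr0_norm// -oppr_gt0.
apply/inner_gaps; split => //; rewrite absx ?subr_gt0//.
rewrite -subr_gt0; apply: (bar ((T1 + t) / 2) t); try lra.
by apply: dn_ge0; lra.
Qed.

Lemma inner_forever : exists a, forall t, a <= t -> inner t.
Proof.
have [d d0 H] := inner_start.
exists (T1 + d / 2); apply: real_induction.
- by apply: H; lra.
- move=> t at_ Hin; have [|r r0 Hr] := @inner_open t; first by apply: Hin; rewrite at_ lexx.
  by exists r => // s /andP[ts st]; apply: Hr; rewrite gtr0_norm; lra.
- by move=> t at_; exact: inner_close.
Qed.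

End EvenPart.

(** * Periodicity forces an even primitive *)

Section OddDamping.
Variable R : realType.
Implicit Types (F f g : R -> R) (e u : R).

Lemma no_even_defect F f g e : (forall u, is_derive u (1 : R) F (f u)) -> continuous f ->
  locally_lipschitz g -> continuous g -> F 0 = 0 -> odd_function g ->
  (forall u, 0 < u -> 0 < g u) -> 0 < e -> (forall u, 0 < u <= e -> F (- u) < F u) ->
  ~ all_periodic F g.
Proof.
move=> dF cf lg cg F0 god gpos e0 FD H.
have lF := C1_locally_lipschitz dF cf.
have [|x [z [P [per x0 z0 _]]]] := H e (F e).
  by move=> [eE _]; rewrite eE ltxx in e0.
have [S P0 _ N] := per.
have x0e : 0 < x 0 by rewrite x0.
have z0F : z 0 = F (x 0) by rewrite x0.
have h1 := periodic_descends dF gpos per x0e z0F.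
have h2 : exists2 t, 0 <= t & x (- t) <= 0.
  have dFN u : is_derive u (1 : R) (fun u => - F u) (- f u) by exact: is_deriveN1.
  apply: (periodic_descends dFN gpos (periodic_lsol_reverse per)); rewrite oppr0//.
  by rewrite z0F.
have [T1 [T2 O]] := oval_of_descents dF cg gpos F0 S x0e z0F N h1 h2.
rewrite x0 in O.
have [kp [ckp kp1 kp2 kp3]] := oval_inverse_up S O.
have [km [ckm km1 km2 km3]] := oval_inverse_down S O.
have [a Ha] := inner_forever dF lF lg cg F0 god gpos FD S O ckp kp1 kp2 kp3 ckm km1 km2 km3.
(* A multiple of the period beyond [a] brings the solution back to x = e, whereas inner points
   satisfy |x| < e. *)
pose n := Num.bound (a / P).
have an : a <= n%:R * P.
  rewrite -ler_pdivrMr// ltW//; apply: le_lt_trans (ler_norm _) _.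
  have := archi_boundP (normr_ge0 (a / P)).
  by rewrite /n /Num.bound normr_id.
have [+ _ _] := Ha _ an.
by rewrite (periodic_lsol_mult n per) x0 gtr0_norm// ltxx.
Qed.

End OddDamping.

(** * The Jacobian matrix at the origin *)

Section JacobianAtOrigin.
Variable R : realType.
Local Notation plane := 'rV[R]_2.
Variables (f g : R -> R) (g1 : R).
Hypothesis dg : is_derive (0 : R) (1 : R) g g1.
Hypothesis df : derivable f 0 1.
Hypothesis g0 : g 0 = 0.

Let X := lienard f g.

Lemma lienard_coordE p : X p =
  p 0 1 *: pt 1 0 + (- g (p 0 0) - f (p 0 0) * p 0 1) *: pt 0 1.
Proof. by apply: rV2_eq; rewrite /X /lienard !mxE /=; ring. Qed.

Lemma lienard_differentiable : differentiable X 0.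
Proof.
rewrite (_ : X = fun p => p 0 1 *: pt 1 0 + (- g (p 0 0) - f (p 0 0) * p 0 1) *: pt 0 1);
  last exact/funext/lienard_coordE.
have d0 (j : 'I_2) : differentiable (fun p : plane => p 0 j) 0 by exact: differentiable_coord.
have comp0 (h : R -> R) : derivable h 0 1 -> differentiable (fun p : plane => h (p 0 0)) 0.
  move=> dh; apply: (@differentiable_comp _ _ _ _ (fun p : plane => p 0 0) h) => //.
  by rewrite mxE; apply/derivable1_diffP.
apply: differentiableD; apply: differentiableZl => //.
apply: differentiableB; last by apply: differentiableM; [exact: comp0|].
by apply: differentiableN; apply: comp0; case: dg.
Qed.

Lemma derive_along_line (v l : plane) :
  is_derive (0 : R) (1 : R) (fun t => X (t *: v)) l -> 'D_v X 0 = l.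
Proof.
move=> [_ <-]; rewrite /derive.
suff -> : (fun h : R => h^-1 *: ((X \o shift 0) (h *: v) - X 0)) =
  (fun h : R => h^-1 *: (((fun t : R => X (t *: v)) \o shift 0) (h *: (1 : R)) - X ((0 : R) *: v))) by [].
by apply/funext => t /=; rewrite !addr0 scale0r [t *: 1]mulr1.
Qed.

Lemma lienard_jacobian : 'J X 0 = \matrix_(i < 2, j < 2)
  (if i == 0 then if j == 0 then 0 else - g1 else if j == 0 then 1 else - f 0).
Proof.
apply/row_matrixP => i; rewrite rowE -deriveEjacobian; last exact: lienard_differentiable.
have [->|->] := ord2_cases i.
  apply: derive_along_line; apply/is_derive_rV2; rewrite !mxE /=; split.
    rewrite (_ : (fun t => _) = fun _ => 0); first exact: is_deriveC1.
    by apply/funext => t; rewrite /X /lienard !mxE /= mulr0.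
  rewrite (_ : (fun t => _) = fun t => - g t); first exact: is_deriveN1.
  by apply/funext => t; rewrite /X /lienard !mxE /= mulr0 mulr1 mulr0 subr0.
apply: derive_along_line; apply/is_derive_rV2; rewrite !mxE /=; split.
  rewrite (_ : (fun t => _) = fun t => t); first exact: is_derive_id1.
  by apply/funext => t; rewrite /X /lienard !mxE /= mulr1.
rewrite (_ : (fun t => _) = fun t => - (f 0 * t)).
  apply: (is_derive_eq (is_deriveN1 (is_deriveM1 (is_deriveC1 (f 0) 0) (is_derive_id1 0)))).
  by rewrite mul0r add0r mulr1.
by apply/funext => t; rewrite /X /lienard !mxE /= mulr0 mulr1 g0 oppr0 sub0r.
Qed.

Lemma mulmx_rV2 (K : fieldType) (v : 'rV[K]_2) (A : 'M[K]_2) j :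
  (v *m A) 0 j = v 0 0 * A 0 j + v 0 1 * A 1 j.
Proof.
rewrite mxE !big_ord_recl big_ord0 addr0.
by have -> : lift ord0 ord0 = 1 :> 'I_2 by apply/val_inj.
Qed.

(** The two equations are the real and imaginary parts of the characteristic equation z^2 + f(0) z +
    g1 = 0. *)
Lemma lienard_eigenvalueP (z : R[i]) : jacobian_eigenvalue X 0 z <->
  complex.Re z ^+ 2 - complex.Im z ^+ 2 + f 0 * complex.Re z + g1 = 0 /\
  (2 * complex.Re z + f 0) * complex.Im z = 0.
Proof.
have -> : (complex.Re z ^+ 2 - complex.Im z ^+ 2 + f 0 * complex.Re z + g1 = 0 /\
    (2 * complex.Re z + f 0) * complex.Im z = 0) <->
    z ^+ 2 + real_complex R (f 0) * z + real_complex R g1 = 0.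
  have reE : complex.Re (z ^+ 2 + real_complex R (f 0) * z + real_complex R g1) =
      complex.Re z ^+ 2 - complex.Im z ^+ 2 + f 0 * complex.Re z + g1.
    by case: z => x y /=; ring.
  have imE : complex.Im (z ^+ 2 + real_complex R (f 0) * z + real_complex R g1) =
      (2 * complex.Re z + f 0) * complex.Im z.
    by case: z {reE} => x y /=; ring.
  split=> [[h1 h2]|E]; last by rewrite -reE -imE E.
  by apply/eqP; rewrite eq_complex reE imE h1 h2 !eqxx.
rewrite /jacobian_eigenvalue lienard_jacobian; split.
  move=> /eigenvalueP[v vJ vN0].
  have e0 : v 0 1 = z * v 0 0.
    move: vJ => /(congr1 (fun w : 'rV_2 => w 0 0)); rewrite mulmx_rV2 !mxE /=.
    by rewrite rmorph0 rmorph1 mulr0 add0r mulr1.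
  have e1 : - real_complex R g1 * v 0 0 - real_complex R (f 0) * v 0 1 = z * v 0 1.
    move: vJ => /(congr1 (fun w : 'rV_2 => w 0 1)); rewrite mulmx_rV2 !mxE /= => <-.
    by rewrite !rmorphN /=; ring.
  have v00 : v 0 0 != 0.
    apply: contraNneq vN0 => v0; apply/eqP; apply/rowP => j; rewrite mxE.
    by have [->|->] := ord2_cases j; rewrite ?e0 v0 ?mulr0.
  apply: (mulIf v00); rewrite mul0r.
  rewrite e0 in e1.
  have -> : (z ^+ 2 + real_complex R (f 0) * z + real_complex R g1) * v 0 0 =
    z * (z * v 0 0) - (- real_complex R g1 * v 0 0 - real_complex R (f 0) * (z * v 0 0)) by ring.
  by rewrite e1 subrr.
move=> E; apply/eigenvalueP; exists (\row_j (if j == 0 then 1 else z)).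
  apply/rowP => j; rewrite mulmx_rV2 !mxE /=; have [->|->] := ord2_cases j; rewrite /=.
    by rewrite rmorph0 rmorph1; ring.
  have -> : z * z = - (real_complex R (f 0) * z + real_complex R g1).
    by apply/eqP; rewrite -subr_eq0 opprK -expr2 addrA E.
  by rewrite !rmorphN /=; ring.
apply/negP => /eqP/rowP/(_ 0); rewrite !mxE /= => /eqP.
by rewrite oner_eq0.
Qed.

Let disc := f 0 ^+ 2 - 4 * g1.

(** Both types are conditions on all eigenvalues, so eigenvalues have to be exhibited, for either
    sign of [disc], before anything can be deduced from them. *)
Lemma lienard_eigenvalue_real : 0 <= disc ->
  jacobian_eigenvalue X 0 (Complex ((- f 0 + Num.sqrt disc) / 2) 0) /\
  jacobian_eigenvalue X 0 (Complex ((- f 0 - Num.sqrt disc) / 2) 0).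
Proof.
move=> d0; have := sqr_sqrtr d0; rewrite /disc => dE.
split; apply/lienard_eigenvalueP; split=> /=; rewrite ?mulr0//.
  have -> : ((- f 0 + Num.sqrt (f 0 ^+ 2 - 4 * g1)) / 2) ^+ 2 - 0 ^+ 2 +
    f 0 * ((- f 0 + Num.sqrt (f 0 ^+ 2 - 4 * g1)) / 2) + g1 =
    (Num.sqrt (f 0 ^+ 2 - 4 * g1) ^+ 2 - (f 0 ^+ 2 - 4 * g1)) / 4 by field.
  by rewrite dE subrr mul0r.
have -> : ((- f 0 - Num.sqrt (f 0 ^+ 2 - 4 * g1)) / 2) ^+ 2 - 0 ^+ 2 +
  f 0 * ((- f 0 - Num.sqrt (f 0 ^+ 2 - 4 * g1)) / 2) + g1 =
  (Num.sqrt (f 0 ^+ 2 - 4 * g1) ^+ 2 - (f 0 ^+ 2 - 4 * g1)) / 4 by field.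
by rewrite dE subrr mul0r.
Qed.

Lemma lienard_eigenvalue_complex : disc < 0 ->
  jacobian_eigenvalue X 0 (Complex (- f 0 / 2) (Num.sqrt (- disc) / 2)).
Proof.
move=> d0; have : 0 <= - disc by rewrite oppr_ge0 ltW.
move=> /sqr_sqrtr; rewrite /disc => dE.
apply/lienard_eigenvalueP; split=> /=; last by field.
have -> : (- f 0 / 2) ^+ 2 - (Num.sqrt (- (f 0 ^+ 2 - 4 * g1)) / 2) ^+ 2 +
  f 0 * (- f 0 / 2) + g1 =
  - (Num.sqrt (- (f 0 ^+ 2 - 4 * g1)) ^+ 2 + (f 0 ^+ 2 - 4 * g1)) / 4 by field.
by rewrite dE addNr oppr0 mul0r.
Qed.

Lemma linear_typeP : linear_type X 0 <-> f 0 = 0 /\ 0 < g1.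
Proof.
split=> [H|[f0 g10] z /lienard_eigenvalueP].
  have [d0|d0] := leP 0 disc.
    by have [/H[]] := lienard_eigenvalue_real d0.
  have [/= f0 _] := H _ (lienard_eigenvalue_complex d0).
  have f00 : f 0 = 0 by lra.
  by split=> //; move: d0; rewrite /disc f00 expr0n /=; lra.
rewrite f0 mul0r !addr0 => -[h1 /eqP]; rewrite mulf_eq0 mulf_eq0 pnatr_eq0 /=.
case/orP => /eqP E; rewrite E expr0n /= ?sub0r ?subr0 in h1.
  split=> // I0; move: h1; rewrite I0 expr0n /=; lra.
by have := sqr_ge0 (complex.Re z); lra.
Qed.

Lemma nilpotent_typeP : nilpotent_type X 0 <-> f 0 = 0 /\ g1 = 0.
Proof.
split=> [[H _]|[f0 g10]].
  have [d0|d0] := leP 0 disc.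
    have [/H[h1] /H[h2]] := lienard_eigenvalue_real d0.
    have f00 : f 0 = 0 by lra.
    have s0 : Num.sqrt disc = 0 by lra.
    split=> //; have := sqr_sqrtr d0; rewrite s0 /disc f00 expr0n; lra.
  have [_ h2] := H _ (lienard_eigenvalue_complex d0).
  have : 0 < Num.sqrt (- disc) by rewrite sqrtr_gt0 oppr_gt0.
  by lra.
split.
  move=> z /lienard_eigenvalueP; rewrite f0 g10 mul0r !addr0 => -[h1 /eqP].
  rewrite mulf_eq0 mulf_eq0 pnatr_eq0 /= => h2.
  apply/eqP; rewrite eq_complex /=.
  case/orP: h2 => /eqP E; move: h1; rewrite E expr0n /= ?sub0r ?subr0 => /eqP.
    by rewrite oppr_eq0 sqrf_eq0 => ->; rewrite eqxx.
  by rewrite sqrf_eq0 => ->; rewrite eqxx.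
rewrite lienard_jacobian => /matrixP/(_ 1 0); rewrite !mxE /= => /eqP.
by rewrite oner_eq0.
Qed.

End JacobianAtOrigin.

(** * Criteria for global centers *)

Section GlobalCenters.
Variable R : realType.
Local Notation plane := 'rV[R]_2.
Implicit Types (F f g : R -> R) (u v A C : R).

Lemma global_center_sufficient F f g (n s : nat) :
  (forall u, is_derive u (1 : R) F (f u)) -> continuous f -> locally_lipschitz g ->
  F 0 = 0 -> odd_function g -> odd_function f -> (forall u, 0 < u -> 0 < g u) ->
  focus_near0 f g s -> focus_nearoo f g n -> global_center (lienard f g) 0.
Proof.
move=> dF cf lg F0 god fod gpos foc0 focoo.
have lF := C1_locally_lipschitz dF cf.
apply: global_center_of_orbits.
  have g0 : g 0 = 0 by have := god 0; rewrite oppr0; lra.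
  by apply: rV2_eq; rewrite /lienard !mxE //= g0 mulr0 subr0 oppr0.
move=> q qN0.
have N : ~ (q 0 0 = 0 /\ q 0 1 = 0) by move=> /pt_eq0; rewrite -pt_coord.
have [x [z [xs [T1 [T2 [t0 [S O xt0 zt0]]]]]]] :=
  oval_through dF cf lg F0 god fod gpos foc0 focoo N.
exists (range (fun t => pt (x t) (z t - F (x t)))); split.
- exact: oval_orbit_periodic O.
- exact: oval_orbit_surrounds O.
- by exists t0 => //; rewrite xt0 zt0 addrK -pt_coord.
Qed.

(** Time is shifted so that the solution is at the given point at time 0; it avoids the origin
    because its orbit surrounds it. *)
Lemma global_center_all_periodic F f g : (forall u, is_derive u (1 : R) F (f u)) ->
  F 0 = 0 -> global_center (lienard f g) 0 -> all_periodic F g.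
Proof.
move=> dF F0 [_ [[H _ _] _]] u v N.
have [|O [[w [S [P P0 per] [t nt] OE]] [NO _] Oq _]] := H (pt u (v - F u)).
  by move=> /pt_eq0[u0]; rewrite u0 F0 subr0 => v0; exact: N.
rewrite OE in NO Oq; have [t1 _ wt1] := Oq.
have S' := lsol_shift t1 (solution_lienard dF S).
exists (fun t => w (t1 + t) 0 0), (fun t => w (t1 + t) 0 1 + F (w (t1 + t) 0 0)), P; split.
- split=> //; first by move=> s; rewrite addrA per.
  move=> s [h0]; rewrite h0 F0 addr0 => h1; apply: NO.
  by exists (t1 + s) => //; apply: rV2_eq; rewrite ?h0 ?h1 mxE.
- by rewrite addr0 wt1 pt0.
- by rewrite addr0 wt1 pt0 pt1 subrK.
have D s : w (t1 + s) <> w t1 -> w (t1 + s) 0 0 <> u \/ w (t1 + s) 0 1 + F (w (t1 + s) 0 0) <> v.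
  move=> ne; have [h0|h0] := eqVneq (w (t1 + s) 0 0) u; last by left; apply/eqP.
  right=> h1; apply: ne; apply: rV2_eq; rewrite wt1 ?pt0 ?pt1 //.
  by rewrite -h1 h0 addrK.
have [w0|w0] := eqVneq (w 0) (w t1).
  exists (t - t1); apply: D; rewrite subrKC -w0; exact/eqP.
by exists (- t1); apply: D; rewrite subrr; exact/eqP.
Qed.

(** The trapping curve is x^(s+1) (nu - x). If nu is a double root the leading terms cancel, and
    differentiating the factor nu - x contributes - nu u, which for small u beats the corrections of
    order u^2 in the bounds on [f] and [g]. *)
Lemma slow_at_origin F f g (s : nat) (b A C C' : R) :
  (forall u, is_derive u (1 : R) F (f u)) -> F 0 = 0 -> (forall u, 0 < u -> 0 < g u) ->
  0 < b -> 4 * s.+1%:R * A <= b ^+ 2 -> 0 <= C -> 0 <= C' ->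
  (forall u, 0 < u <= 1 -> g u <= u ^+ (2 * s + 1) * (A + C * u ^+ 2) /\
     u ^+ s * (b - C' * u ^+ 2) <= f u) ->
  ~ all_periodic F g.
Proof.
move=> dF F0 gpos b0 Ab C0 C'0 bnd.
pose N : R := s.+1%:R; have N0 : 0 < N by rewrite ltr0n.
(* N v^2 - b v + A is minimal, and nonpositive, at v = nu. *)
pose nu := b / (2 * N).
have nu0 : 0 < nu by rewrite divr_gt0// mulr_gt0.
have bE : b = 2 * N * nu by rewrite /nu mulrC divfK// mulf_neq0// gt_eqF.
have AN : A <= N * nu ^+ 2.
  have : 4 * N * A <= 4 * N * (N * nu ^+ 2) by apply: (le_trans Ab); rewrite bE; lra.
  by rewrite ler_pM2l// mulr_gt0.
(* q - 1 is the coefficient of u^2 in the expanded bracket; u <= nu / q makes the linear term - nu u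
   prevail. *)
pose q := N + 2 + C + C' * nu.
have q0 : 0 < q by rewrite /q; have := mulr_ge0 C'0 (ltW nu0); lra.
pose e := Num.min 1 (nu / q).
have e0 : 0 < e by rewrite lt_min ltr01 divr_gt0.
pose phi u := u ^+ s.+1 * (nu - u).
pose dphi u := u ^+ s * (N * (nu - u) - u).
have dphiP u : is_derive u (1 : R) phi (dphi u).
  apply: (is_derive_eq (is_deriveM1 (is_deriveX1 s.+1 (is_derive_id1 u))
    (is_deriveB1 (is_deriveC1 nu u) (is_derive_id1 u)))).
  by rewrite /dphi /N -[s.+1.-1]/s exprS; ring.
apply: (trapped_at_origin dF F0 gpos e0 dphiP).
  by rewrite /phi expr0n mul0r.
move=> u /andP[u0]; rewrite le_min => /andP[u1]; rewrite ler_pdivlMr// => uq.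
have [|gu fu] := bnd u; first by rewrite u0.
have unu : u < nu.
  apply: lt_le_trans uq; rewrite ltr_pMr// /q.
  by have := mulr_ge0 C'0 (ltW nu0); lra.
have us : 0 < u ^+ s by rewrite exprn_gt0.
have us1 : 0 < u ^+ s.+1 by rewrite exprn_gt0.
have phi0 : 0 < phi u by rewrite mulr_gt0// subr_gt0.
split=> //.
have fphi : u ^+ s * (b - C' * u ^+ 2) * phi u <= f u * phi u by rewrite ler_wpM2r// ltW.
apply: (@le_lt_trans _ _ (u ^+ (2 * s + 1) * (A + C * u ^+ 2) -
  u ^+ s * (b - C' * u ^+ 2) * phi u + dphi u * phi u)); first by lra.
have -> : u ^+ (2 * s + 1) * (A + C * u ^+ 2) - u ^+ s * (b - C' * u ^+ 2) * phi u
   + dphi u * phi u = u ^+ s * u ^+ s.+1 *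
   (A + C * u ^+ 2 - (b - C' * u ^+ 2) * (nu - u) + (N * (nu - u) - u) * (nu - u)).
  by rewrite expr_2n1 /phi /dphi; ring.
rewrite pmulr_rlt0 ?mulr_gt0//.
have -> : A + C * u ^+ 2 - (b - C' * u ^+ 2) * (nu - u) + (N * (nu - u) - u) * (nu - u) =
  (A - N * nu ^+ 2) - u * (nu - u * (q - 1) ) - C' * u ^+ 3.
  by rewrite bE /q; ring.
have h1 : 0 <= C' * u ^+ 3 by rewrite mulr_ge0// exprn_ge0// ltW.
have h2 : 0 < u * (nu - u * (q - 1)) by rewrite mulr_gt0//; lra.
by lra.
Qed.

(** With p = 1/u the curve is u^(n+1) (nu + p). The bend has the sign opposite to that at the origin
    because p decreases with u: its derivative again contributes - nu p, against corrections of
    order p^2. *)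
Lemma fast_at_infinity F f g (n : nat) (b A C C' : R) :
  (forall u, is_derive u (1 : R) F (f u)) ->
  0 < b -> 4 * n.+1%:R * A <= b ^+ 2 -> 0 <= C -> 0 <= C' ->
  (forall u, 1 <= u -> g u <= u ^+ (2 * n + 1) * (A + C * u^-1 ^+ 2) /\
     f u <= u ^+ n * (- b + C' * u^-1 ^+ 2)) ->
  ~ all_periodic F g.
Proof.
move=> dF b0 Ab C0 C'0 bnd.
pose N : R := n.+1%:R; have N0 : 0 < N by rewrite ltr0n.
pose nu := b / (2 * N).
have nu0 : 0 < nu by rewrite divr_gt0// mulr_gt0.
have bE : b = 2 * N * nu by rewrite /nu mulrC divfK// mulf_neq0// gt_eqF.
have AN : A <= N * nu ^+ 2.
  have : 4 * N * A <= 4 * N * (N * nu ^+ 2) by apply: (le_trans Ab); rewrite bE; lra.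
  by rewrite ler_pM2l// mulr_gt0.
pose q := N + 1 + C + C' * (nu + 1).
have q1 : 1 < q by rewrite /q; have := mulr_ge0 C'0 (ltW nu0); lra.
pose e := Num.max 1 (q / nu).
have e0 : 0 < e by rewrite lt_max ltr01.
pose phi u := u ^+ n * (nu * u + 1).
pose dphi u := n%:R * u ^+ n.-1 * (nu * u + 1) + u ^+ n * nu.
have dphiP u : is_derive u (1 : R) phi (dphi u).
  apply: (is_derive_eq (is_deriveM1 (is_deriveX1 n (is_derive_id1 u))
    (is_deriveD1 (is_deriveM1 (is_deriveC1 nu u) (is_derive_id1 u)) (is_deriveC1 1 u)))).
  by rewrite /dphi; ring.
apply: (trapped_at_infinity dF e0 dphiP).
  by move=> u u0; rewrite mulr_gt0// ?exprn_gt0// addr_gt0// mulr_gt0.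
move=> u; rewrite ge_max => /andP[u1]; rewrite ler_pdivrMr// => uq.
have u0 : 0 < u by lra.
have [gu fu] := bnd u u1.
pose p := u^-1; rewrite -/p in gu fu.
have p0 : 0 < p by rewrite invr_gt0.
have up : u * p = 1 by rewrite divff// gt_eqF.
have p1 : p <= 1 by rewrite invf_le1.
have un : 0 < u ^+ n by rewrite exprn_gt0.
pose w := nu + p.
have w0 : 0 < w by rewrite addr_gt0.
have phiE : phi u = u ^+ n * u * w.
  by rewrite /phi -up /w; ring.
have dphiE : dphi u = u ^+ n * (N * w - p).
  (* The case n = 0 is separate because of the predecessor in [dphi]. *)
  rewrite /dphi /w /N; case: (n) => [|k]; first by rewrite expr0; ring.
  rewrite -[k.+1.-1]/k exprS -[in RHS]natr1.
  have -> : k.+1%:R * u ^+ k * (nu * u + 1) = k.+1%:R * u ^+ k * (nu * u + u * p) by rewrite up.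
  by ring.
have phi0 : 0 < phi u by rewrite phiE !mulr_gt0.
have fphi : f u * phi u <= u ^+ n * (- b + C' * p ^+ 2) * phi u by rewrite ler_wpM2r// ltW.
apply: (@le_lt_trans _ _ (u ^+ (2 * n + 1) * (A + C * p ^+ 2) +
  u ^+ n * (- b + C' * p ^+ 2) * phi u + dphi u * phi u)); first by lra.
have -> : u ^+ (2 * n + 1) = u ^+ n * u * u ^+ n by rewrite expr_2n1 exprS; ring.
rewrite phiE dphiE.
have -> : u ^+ n * u * u ^+ n * (A + C * p ^+ 2) +
  u ^+ n * (- b + C' * p ^+ 2) * (u ^+ n * u * w) + u ^+ n * (N * w - p) * (u ^+ n * u * w) =
  u ^+ n * u * u ^+ n * ((A - N * nu ^+ 2) - p * (nu - p * (N - 1 + C + C' * w))).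
  by rewrite bE /w; ring.
rewrite pmulr_rlt0 ?mulr_gt0//.
suff : 0 < p * (nu - p * (N - 1 + C + C' * w)) by lra.
rewrite mulr_gt0// subr_gt0.
have qp : q * p <= nu.
  by rewrite -(ler_pM2l u0) mulrCA up mulr1.
apply: lt_le_trans qp; rewrite mulrC ltr_pM2r// /q /w.
have : C' * p <= C' * 1 by rewrite ler_wpM2l.
by lra.
Qed.

End GlobalCenters.

(** * The polynomial system *)

Section PolynomialLienard.
Variable R : realType.
Implicit Types (c a b : nat -> R) (u x : R) (lo hi : nat).

Lemma poly_fun_trim c lo lo' hi x : (lo <= lo' <= hi.+1)%N ->
  (forall i, (lo <= i < lo')%N -> c i = 0) -> poly_fun c lo hi x = poly_fun c lo' hi x.
Proof.
move=> /andP[h1 h2] c0; rewrite /poly_fun (big_cat_nat h1 h2) /=.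
rewrite big_seq big1 ?add0r// => i; rewrite mem_index_iota => loi.
by rewrite c0// mul0r.
Qed.

Lemma odd_poly_lo c lo hi : (lo <= hi)%N -> c lo != 0 ->
  odd_function (poly_fun c lo hi) -> odd lo.
Proof.
move=> lohi cN0 /odd_poly_funP H; apply: contraNT cN0 => /H -> //.
by rewrite leqnn.
Qed.

Lemma odd_poly_hi c lo hi : (lo <= hi)%N -> c hi != 0 ->
  odd_function (poly_fun c lo hi) -> odd hi.
Proof.
move=> lohi cN0 /odd_poly_funP H; apply: contraNT cN0 => /H -> //.
by rewrite lohi leqnn.
Qed.

Lemma odd_poly_near0 c lo hi : (lo <= hi)%N -> c lo != 0 -> odd_function (poly_fun c lo hi) ->
  exists2 C, 0 <= C & forall x, 0 <= x <= 1 ->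
    `|poly_fun c lo hi x - c lo * x ^+ lo| <= C * x ^+ (lo + 2).
Proof.
move=> lohi cN0 od; have lo_odd := odd_poly_lo lohi cN0 od.
apply: poly_fun_near0 => // i /andP[h1 h2] h3.
have iE : i = lo.+1 by lia.
move/odd_poly_funP: od; apply; first by rewrite (ltnW h1).
by rewrite iE /= lo_odd.
Qed.

Lemma odd_poly_nearoo c lo hi : (lo <= hi)%N -> c hi != 0 -> odd_function (poly_fun c lo hi) ->
  exists2 C, 0 <= C & forall x, 1 <= x ->
    `|poly_fun c lo hi x - c hi * x ^+ hi| * x ^+ 2 <= C * x ^+ hi.
Proof.
move=> lohi cN0 od; have hi_odd := odd_poly_hi lohi cN0 od.
apply: poly_fun_nearoo => // i /andP[h1 h2] h3.
have hE : hi = i.+1 by lia.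
move/odd_poly_funP: od; apply; first by rewrite h1 ltnW.
by move: hi_odd; rewrite hE.
Qed.

Lemma poly_lo_gt0 c lo hi : (lo <= hi)%N -> c lo != 0 ->
  (forall u, 0 < u -> 0 < poly_fun c lo hi u) -> 0 < c lo.
Proof.
move=> lohi cN0 gpos; have [e e0 He] := poly_fun_sign_near0 lohi cN0.
by have := He e; rewrite e0 lexx => /(_ isT); rewrite pmulr_lgt0// gpos.
Qed.

Lemma poly_hi_gt0 c lo hi : (lo <= hi)%N -> c hi != 0 ->
  (forall u, 0 < u -> 0 < poly_fun c lo hi u) -> 0 < c hi.
Proof.
move=> lohi cN0 gpos.
have [|C C0 H] := @poly_fun_nearoo _ c lo hi 1 lohi.
  by move=> i /andP[_ h1]; rewrite addn1 ltnS leqNgt h1.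
rewrite lt_neqAle eq_sym cN0 leNgt; apply/negP => cn.
pose x := Num.max 1 (C / - c hi).
have x1 : 1 <= x by rewrite le_max lexx.
have x0 : 0 < x by lra.
have xC : C <= x * - c hi.
  by rewrite -ler_pdivrMr ?oppr_gt0// le_max lexx orbT.
have := H x x1; rewrite expr1 => Hx.
have xh : 0 < x ^+ hi by rewrite exprn_gt0.
have := gpos x x0; move: (poly_fun c lo hi x) Hx => y Hx y0.
have h1 : y - c hi * x ^+ hi <= `|y - c hi * x ^+ hi| := ler_norm _.
have h2 : (y - c hi * x ^+ hi) * x <= C * x ^+ hi.
  by apply: le_trans Hx; rewrite ler_wpM2r// ltW.
have h3 : C * x ^+ hi <= x * - c hi * x ^+ hi by rewrite ler_wpM2r// ltW.
have h4 : 0 < y * x by rewrite mulr_gt0.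
lra.
Qed.

Lemma poly_odd_damping a b (r m s n : nat) : (s <= n)%N ->
  continuous (poly_fun a r m) -> odd_function (poly_fun a r m) ->
  (forall u, 0 < u -> 0 < poly_fun a r m u) ->
  all_periodic (poly_fun (antideriv_coef b) s.+1 n.+1) (poly_fun a r m) ->
  odd_function (poly_fun b s n).
Proof.
move=> sn cg god gpos H.
set g := poly_fun a r m in cg god gpos H; set F := poly_fun _ s.+1 n.+1 in H.
have dF := is_derive_antideriv b s n.
have cf := @poly_fun_cts _ b s n.
have lg := @poly_fun_locally_lipschitz _ a r m.
have F0 : F 0 = 0 by exact: poly_fun0.
apply/odd_poly_funP => i0 i0sn i0ev; apply/eqP/negPn/negP => bi0.
have ex : exists i, [&& (s <= i <= n)%N, ~~ odd i & b i != 0].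
  by exists i0; rewrite i0sn i0ev.
have [j /and3P[/andP[sj jn] jev bj] jmin] := ex_minnP ex.
(* F(u) - F(- u) doubles the odd powers in [F], which come from the even powers in f. By minimality
   of [j] it starts with 2 b_j u^(j+1) / (j+1), whose sign decides between the flow and its time
   reversal. *)
pose c k := if odd k then 2 * antideriv_coef b k else 0.
have FcE u : F u - F (- u) = poly_fun c j.+1 n.+1 u.
  rewrite -(@poly_fun_trim c s.+1); last 2 first.
  - by rewrite !ltnS sj (leq_trans jn).
  - move=> [//|k]; rewrite !ltnS => /andP[sk kj]; rewrite /c /=.
    case: ifPn => // kev; rewrite /antideriv_coef /=.
    have [->|bk] := eqVneq (b k) 0; first by rewrite mul0r mulr0.
    by have := jmin k; rewrite sk kev bk (leq_trans (ltnW kj) jn) leqNgt kj => /(_ isT).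
  rewrite /F /poly_fun -sumrB; apply: eq_bigr => k _.
  rewrite /c exprNn -signr_odd; case: (odd k) => /=.
    by rewrite expr1; ring.
  by rewrite expr0 mul1r subrr mul0r.
have cj : c j.+1 = 2 * (b j / j.+1%:R) by rewrite /c /= jev.
have cjN0 : c j.+1 != 0 by rewrite cj !mulf_neq0// invr_eq0 pnatr_eq0.
have [|e e0 He] := @poly_fun_sign_near0 _ c j.+1 n.+1 _ cjN0; first by rewrite ltnS.
have [cp|cn|cE] := ltgtP 0 (c j.+1); last by rewrite -cE eqxx in cjN0.
  apply: (no_even_defect dF cf lg cg F0 god gpos e0 _ H) => u /He.
  by rewrite -FcE pmulr_rgt0// subr_gt0.
have dFN u : is_derive u (1 : R) (fun u => - F u) (- poly_fun b s n u).
  exact: is_deriveN1.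
apply: (no_even_defect dFN _ lg cg _ god gpos e0 _ (all_periodic_reverse H)).
- by move=> u; apply: continuousN; exact: cf.
- by rewrite F0 oppr0.
- by move=> u /He; rewrite -FcE nmulr_rgt0// subr_lt0 ltrN2.
Qed.

(** * Discriminant conditions at the origin and at infinity *)

Section Conditions.
Variables (a b : nat -> R) (r m s n : nat).
Hypothesis rm : (r <= m)%N.
Hypothesis sn : (s <= n)%N.
Hypothesis ar : a r != 0.
Hypothesis am : a m != 0.
Hypothesis bs : b s != 0.
Hypothesis bn : b n != 0.
Let g := poly_fun a r m.
Let f := poly_fun b s n.
Let F := poly_fun (antideriv_coef b) s.+1 n.+1.
Hypothesis god : odd_function g.
Hypothesis fod : odd_function f.
Hypothesis gpos : forall u, 0 < u -> 0 < g u.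
Hypothesis per : all_periodic F g.

Let dF : forall u, is_derive u (1 : R) F (f u) := is_derive_antideriv b s n.
Let F0 : F 0 = 0 := poly_fun0 _ _ (ltn0Sn s).

Lemma focus_condition_at_origin :
  (r < 2 * s + 1)%N \/ (r = (2 * s + 1)%N /\ b s ^+ 2 < 4 * s.+1%:R * a r).
Proof.
apply: contrapT => N.
have rodd := odd_poly_lo rm ar god.
have [Cg Cg0 Hg] := odd_poly_near0 rm ar god.
have [Cf Cf0 Hf] := odd_poly_near0 sn bs fod.
(* The coefficient of x^(2s+1) in [g]. When r > 2s+1 it is 0, and the discriminant inequality reads
   0 <= b_s^2. *)
pose A := if r == (2 * s + 1)%N then a r else 0.
have Ab : 4 * s.+1%:R * A <= b s ^+ 2.
  rewrite /A; case: eqP => rE; last by rewrite mulr0 sqr_ge0.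
  by rewrite leNgt; apply/negP => h; apply: N; right.
pose C := Cg + `|a r|.
have C0 : 0 <= C by rewrite addr_ge0.
have gA u : 0 < u <= 1 -> g u <= u ^+ (2 * s + 1) * (A + C * u ^+ 2).
  move=> /andP[u0 u1]; have := Hg u; rewrite (ltW u0) u1 => /(_ isT).
  rewrite -/g ler_norml => /andP[_ gu].
  have u2 : 0 <= u ^+ 2 by rewrite sqr_ge0.
  rewrite /A; case: eqP => rE.
    rewrite -rE mulrDr.
    have h1 : Cg * u ^+ (r + 2) <= u ^+ r * (C * u ^+ 2).
      rewrite exprD mulrCA ler_wpM2l ?exprn_ge0 ?(ltW u0)// ler_wpM2r//.
      by rewrite lerDl.
    lra.
  (* Both [r] and 2s+1 are odd, so r > 2s+1 gains two exponents, and all of [g] is a correction of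
     relative order u^2. *)
  have r2 : (2 * s + 1 + 2 <= r)%N.
    have : ~ (r < 2 * s + 1)%N by move=> h; apply: N; left.
    move: rodd rE; clear; lia.
  rewrite add0r.
  have h1 : Cg * u ^+ (r + 2) <= Cg * u ^+ r.
    by rewrite ler_wpM2l// ler_wiXn2l ?(ltW u0)// leq_addr.
  have h2 : a r * u ^+ r <= `|a r| * u ^+ r.
    by rewrite ler_wpM2r ?exprn_ge0 ?(ltW u0)// ler_norm.
  have h3 : C * u ^+ r <= C * u ^+ (2 * s + 1 + 2).
    by rewrite ler_wpM2l// ler_wiXn2l ?(ltW u0).
  rewrite mulrCA -exprD; move: h3; rewrite /C; lra.
have fb u : 0 < u <= 1 -> `|f u - b s * u ^+ s| <= Cf * u ^+ (s + 2).
  by move=> /andP[u0 u1]; apply: Hf; rewrite (ltW u0).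
have [bp|bneg|bE] := ltgtP 0 (b s); last by move: bs; rewrite -bE eqxx.
  apply: (slow_at_origin dF F0 gpos bp Ab C0 Cf0 _ per) => u u01; split; first exact: gA.
  by have := fb u u01; rewrite ler_norml exprD => /andP[+ _]; lra.
have dFN u : is_derive u (1 : R) (fun u => - F u) (- f u) by exact: is_deriveN1.
have FN0 : - F 0 = 0 by rewrite F0 oppr0.
have bp : 0 < - b s by rewrite oppr_gt0.
have Ab' : 4 * s.+1%:R * A <= (- b s) ^+ 2 by rewrite sqrrN.
apply: (slow_at_origin dFN FN0 gpos bp Ab' C0 Cf0 _ (all_periodic_reverse per)) => u u01.
split; first exact: gA.
by have := fb u u01; rewrite ler_norml exprD => /andP[_ +]; lra.
Qed.

Lemma focus_condition_at_infinity :
  (2 * n + 1 < m)%N \/ (m = (2 * n + 1)%N /\ b n ^+ 2 < 4 * n.+1%:R * a m).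
Proof.
apply: contrapT => N.
have modd := odd_poly_hi rm am god.
have [Cg Cg0 Hg] := odd_poly_nearoo rm am god.
have [Cf Cf0 Hf] := odd_poly_nearoo sn bn fod.
(* The coefficient of x^(2n+1) in [g], equal to 0 when m < 2n+1; by parity [g] is then a correction
   of relative order 1/u^2. *)
pose A := if m == (2 * n + 1)%N then a m else 0.
have Ab : 4 * n.+1%:R * A <= b n ^+ 2.
  rewrite /A; case: eqP => rE; last by rewrite mulr0 sqr_ge0.
  by rewrite leNgt; apply/negP => h; apply: N; right.
pose C := Cg + `|a m|.
have C0 : 0 <= C by rewrite addr_ge0.
have scale (K x y : R) : 1 <= x -> `|y| * x ^+ 2 <= K -> `|y| <= K * x^-1 ^+ 2.
  move=> x1; have x0 : 0 < x by lra.
  by rewrite exprVn ler_pdivlMr// exprn_gt0.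
have gA u : 1 <= u -> g u <= u ^+ (2 * n + 1) * (A + C * u^-1 ^+ 2).
  move=> u1; have u0 : 0 < u by lra.
  have := scale _ _ _ u1 (Hg u u1); rewrite -/g ler_norml => /andP[_ gu].
  have p0 : 0 <= u^-1 ^+ 2 by rewrite sqr_ge0.
  rewrite /A; case: eqP => mE.
    rewrite -mE.
    have h1 : Cg * u ^+ m * u^-1 ^+ 2 <= C * u ^+ m * u^-1 ^+ 2.
      by rewrite ler_wpM2r// ler_wpM2r ?exprn_ge0 ?(ltW u0)// lerDl.
    lra.
  have m2 : (m + 2 <= 2 * n + 1)%N.
    have : ~ (2 * n + 1 < m)%N by move=> h; apply: N; left.
    move: modd mE; clear; lia.
  rewrite add0r.
  have p1 : u^-1 ^+ 2 <= 1 by rewrite exprn_ile1// ?invr_ge0 ?(ltW u0)// invf_le1.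
  have um : 0 <= u ^+ m by rewrite exprn_ge0// ltW.
  have h1 : Cg * u ^+ m * u^-1 ^+ 2 <= Cg * u ^+ m * 1.
    by rewrite ler_wpM2l// mulr_ge0.
  have h2 : a m * u ^+ m <= `|a m| * u ^+ m by rewrite ler_wpM2r// ler_norm.
  have h3 : u ^+ m <= u ^+ (2 * n + 1) * u^-1 ^+ 2.
    rewrite exprVn ler_pdivlMr ?exprn_gt0// -exprD.
    exact: ler_weXn2l.
  have h4 : C * u ^+ m <= C * (u ^+ (2 * n + 1) * u^-1 ^+ 2) by rewrite ler_wpM2l.
  move: h4; rewrite {1}/C; lra.
have fb u : 1 <= u -> `|f u - b n * u ^+ n| <= Cf * u ^+ n * u^-1 ^+ 2.
  by move=> u1; apply: scale => //; exact: Hf.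
have [bp|bneg|bE] := ltgtP 0 (b n); last by move: bn; rewrite -bE eqxx.
  have dFN u : is_derive u (1 : R) (fun u => - F u) (- f u) by exact: is_deriveN1.
  apply: (fast_at_infinity dFN bp Ab C0 Cf0 _ (all_periodic_reverse per)) => u u1.
  split; first exact: gA.
  by have := fb u u1; rewrite ler_norml => /andP[+ _]; lra.
have bp : 0 < - b n by rewrite oppr_gt0.
have Ab' : 4 * n.+1%:R * A <= (- b n) ^+ 2 by rewrite sqrrN.
apply: (fast_at_infinity dF bp Ab' C0 Cf0 _ per) => u u1; split; first exact: gA.
by have := fb u u1; rewrite ler_norml => /andP[_ +]; lra.
Qed.

End Conditions.
End PolynomialLienard.

(** * The conditions on the coefficients and the two types of center *)

Theorem corollary3 (R : realType) (m n r s : nat) (a b : nat -> R)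
    (le_rm : (r <= m)%N) (le_sn : (s <= n)%N)
    (coef_neq0 : a r * a m * b s * b n != 0)
    (g_odd : odd_function (poly_fun a r m)) :
  let g := poly_fun a r m in
  let f := poly_fun b s n in
  let X := lienard f g in
  let cond_i := forall x : R, x != 0 -> 0 < x * g x in
  let cond_ii := [/\ r = 1%N, (1 <= s)%N & 0 < a r] in
  let cond_ii' :=
    [/\ odd r, (2 < r)%N, (r < 2 * s + 1)%N & 0 < a r] \/
    [/\ r = (2 * s + 1)%N, (3 <= r)%N & b s ^+ 2 - 2 * (r.+1)%:R * a r < 0] in
  let cond_iii :=
    [/\ odd m, (2 * n + 1 < m)%N & 0 < a m] \/
    (m = (2 * n + 1)%N /\ 1 < 4 * (n.+1)%:R * a m * (b n) ^- 2) in
  ((global_center X 0 /\ linear_type X 0) <->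
     [/\ cond_i, cond_ii, cond_iii & odd_function f]) /\
  ((global_center X 0 /\ nilpotent_type X 0) <->
     [/\ cond_i, cond_ii', cond_iii & odd_function f]).
Proof.
move=> g f X cond_i cond_ii cond_ii' cond_iii.
move: coef_neq0; rewrite !mulf_eq0 !negb_or -!andbA => /and4P[ar am bs bn].
have rodd := odd_poly_lo le_rm ar g_odd.
have modd := odd_poly_hi le_rm am g_odd.
pose F := poly_fun (antideriv_coef b) s.+1 n.+1.
have dF : forall u, is_derive u (1 : R) F (f u) := is_derive_antideriv b s n.
have F0 : F 0 = 0 by exact: poly_fun0.
have g0 : g 0 = 0 by apply: poly_fun0; case: (r) rodd.
have cf : continuous f := @poly_fun_cts _ b s n.
have cg : continuous g := @poly_fun_cts _ a r m.
have lg : locally_lipschitz g := @poly_fun_locally_lipschitz _ a r m.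
have dg : is_derive (0 : R) (1 : R) g (if r == 1%N then a 1%N else 0).
  apply: (is_derive_eq (poly_fun_derivable a r m 0)).
  rewrite horner_coef0 coef_deriv coef_poly_coef mulr1n.
  (* [r] is odd, hence positive, so the linear coefficient of [g] is a_1 when r = 1 and 0
     otherwise. *)
  have -> : (r <= 1 <= m)%N = (r == 1)%N by move: rodd le_rm; clear; lia.
  by [].
have df : derivable f 0 1 by have [] := poly_fun_derivable b s n 0.
have f0E : f 0 = 0 <-> (1 <= s)%N.
  split=> [|s0]; last exact: poly_fun0.
  rewrite lt0n => f0; apply: contraNneq bs => s0; rewrite -f0 /f s0 poly_funE horner_coef0.
  by rewrite coef_poly_coef.
have linE : linear_type X 0 <-> [/\ r = 1%N, (1 <= s)%N & 0 < a r].
  rewrite (linear_typeP dg df g0) f0E; case: eqP => [->|rN].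
    by split=> [[]|[]].
  by split=> [[_]|[/rN]//]; rewrite ltxx.
have nilE : nilpotent_type X 0 <-> (1 <= s)%N /\ (3 <= r)%N.
  rewrite (nilpotent_typeP dg df g0) f0E; case: eqP => [rE|rN].
    split=> [[_ a0]|[_]]; last by rewrite rE.
    by rewrite rE a0 eqxx in ar.
  split=> -[s0 _]; split=> //; move: rodd rN; clear; lia.
have iiiE : cond_iii <-> [\/ (2 * n + 1 < m)%N /\ 0 < a m |
    m = (2 * n + 1)%N /\ b n ^+ 2 < 4 * n.+1%:R * a m].
  have b2 : 0 < b n ^+ 2 by rewrite lt_neqAle eq_sym sqrf_eq0 bn sqr_ge0.
  by rewrite /cond_iii ltr_pdivlMr// mul1r modd; split=> [[[_ h1 h2]|h]|[[h1 h2]|h]]; [left|right|left|right].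
have iE : cond_i <-> forall u, 0 < u -> 0 < g u.
  split=> [H u u0|H u]; first by have := H u; rewrite gt_eqF// pmulr_rgt0// => /(_ isT).
  rewrite neq_lt => /orP[u0|u0]; last by rewrite mulr_gt0// H.
  by rewrite -mulrNN -g_odd mulr_gt0 ?H ?oppr_gt0.
have sufficient : cond_i -> cond_iii -> odd_function f ->
    (r < 2 * s + 1)%N /\ 0 < a r \/ r = (2 * s + 1)%N /\ b s ^+ 2 < 4 * s.+1%:R * a r ->
    global_center X 0.
  move=> /iE gpos /iiiE h3 fod h2.
  exact: (global_center_sufficient dF cf lg F0 g_odd fod gpos
    (poly_focus_near0 le_rm le_sn h2) (poly_focus_nearoo le_rm le_sn h3)).
have nec : global_center X 0 -> [/\ cond_i, cond_iii, odd_function f, 0 < a r &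
    (r < 2 * s + 1)%N \/ r = (2 * s + 1)%N /\ b s ^+ 2 < 4 * s.+1%:R * a r].
  move=> /(global_center_all_periodic dF F0) per.
  have gpos := all_periodic_g_pos dF cf lg cg per.
  have fod := poly_odd_damping le_sn cg g_odd gpos per.
  split=> //.
  - exact/iE.
  - apply/iiiE; have am0 := poly_hi_gt0 le_rm am gpos.
    by case: (focus_condition_at_infinity le_rm le_sn am bn g_odd fod per); [left|right].
  - exact: poly_lo_gt0 le_rm ar gpos.
  - exact: (focus_condition_at_origin le_rm le_sn ar bs g_odd fod gpos per).
(* For r = 2s+1 one has 2 (r + 1) = 4 (s + 1). *)
have sE : r = (2 * s + 1)%N -> b s ^+ 2 - 2 * (r.+1)%:R * a r < 0 <-> b s ^+ 2 < 4 * s.+1%:R * a r.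
  move=> ->; rewrite subr_lt0.
  have -> : (2 * s + 1).+1 = (2 * s.+1)%N by rewrite mulnS add2n addn1.
  by rewrite natrM mulrA -natrM.
split; split.
- by move=> [/nec[h1 h3 fod _ _] /linE h2].
- move=> [h1 h2 h3 fod]; split; last exact/linE.
  (* With r = 1 and s >= 1 the exponent r lies below 2s+1, so the origin is of focus type by the
     sign of a_r alone. *)
  by apply: sufficient => //; left; case: h2 => -> s0 a0; split=> //; move: s0; clear; lia.
- move=> [/nec[h1 h3 fod ar0 h2] /nilE[s0 r3]]; split=> //.
  by case: h2 => [h2|[rE h2]]; [left|right; split=> //; apply/sE].
- move=> [h1 h2 h3 fod]; split.
    apply: sufficient => //; case: h2 => [[_ _ h2 a0]|[rE _ h2]]; [by left|right].
    by split=> //; apply/sE.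
  by apply/nilE; case: h2 => [[_ h4 h5 _]|[rE h4 _]]; split=> //;
    move: h4; [move: h5|move: rE]; clear; lia.
Qed.
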